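(* Let $\beta\in\{1,2,4\}$, let $N\ge 1$, let $a_1,\ldots,a_N\in\mathbb{R}$, and let $C=A+G$, where $A=\operatorname{diag}(a_1,\ldots,a_N)$ is deterministic and $G$ is the $N\times N$ GOE/GUE/GSE random matrix (for $\beta=1,2,4$ respectively), normalized as in the context. Let $\boldsymbol{\lambda}=(\lambda_1\ge\cdots\ge\lambda_N)$ be the eigenvalues of $C$, and let $\boldsymbol{\mu}=(\mu_1\ge\cdots\ge\mu_{N-1})$ be the eigenvalues of the upper left $(N-1)\times(N-1)$ principal corner of $C$. Then the conditional density of $\boldsymbol{\lambda}$ given $\boldsymbol{\mu}$ is $$h(\boldsymbol{\lambda}\mid\boldsymbol{\mu})\propto \exp\Bigl(-\frac12\sum_{i=1}^N\lambda_i^2\Bigr)\exp\Bigl(a_N\sum_{i=1}^N\lambda_i\Bigr)\prod_{1\le i<j\le N}(\lambda_i-\lambda_j)\prod_{i=1}^{N-1}\prod_{j=1}^N|\mu_i-\lambda_j|^{\beta/2-1}\,\mathbf{1}_{\boldsymbol{\lambda}\succ\boldsymbol{\mu}},$$ where the proportionality constant depends only on $\boldsymbol{\mu}$ and the parameters $a_i$ (for given $N$ and $\beta$).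
   Context: Normalization of $G$: $G=\frac{X+X^*}{2}$, where $X$ is an $N\times N$ matrix with independent identically distributed real ($\beta=1$), complex ($\beta=2$), or quaternionic ($\beta=4$) Gaussian entries (all $\beta$ real components of each entry being independent with the same law), normalized so that $\operatorname{Re}(X_{ij})\sim\mathcal{N}(0,1)$ for all $i,j$. Here $X^*$ is the transpose, conjugate transpose, or quaternionic conjugate transpose for $\beta=1,2,4$. For $\beta=4$, the eigenvalues of an $n\times n$ quaternionic self-adjoint matrix are its $n$ real eigenvalues (the roots of the reduced, or Moore, characteristic determinant). Interlacing $\boldsymbol{\mu}\prec\boldsymbol{\lambda}$ (equivalently $\boldsymbol{\lambda}\succ\boldsymbol{\mu}$) means $\lambda_1\ge\mu_1\ge\lambda_2\ge\cdots\ge\mu_{N-1}\ge\lambda_N$. The density is with respect to Lebesgue measure on ordered $N$-tuples. For $N=1$ the tuple $\boldsymbol{\mu}$ is empty. *)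

(* Defs.v *)
From HB Require Import structures.
From mathcomp Require Import all_boot all_order all_algebra.
From mathcomp Require Import all_classical all_reals all_analysis.
From mathcomp Require Import complex.

Set Implicit Arguments.
Unset Strict Implicit.
Unset Printing Implicit Defensive.

Import Order.TTheory GRing.Theory Num.Theory.
Import numFieldNormedType.Exports.

Local Open Scope classical_set_scope.
Local Open Scope ring_scope.

Definition tcons (T : Type) (n : nat) (p : T * n.-tuple T) : n.+1.-tuple T :=
  [tuple of p.1 :: p.2].

Section lebesgue_tuple_step.
Context (R : realType) (n : nat).
Variable nu : {sigma_finite_measure set (n.-tuple R) -> \bar R}.
Local Open Scope ereal_scope.

Definition lebesgue_cons : set (n.+1.-tuple R) -> \bar R :=
  pushforward (@lebesgue_measure R \x nu) (@tcons R n).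

Lemma measurable_tcons : measurable_fun [set: measurableTypeR R * n.-tuple R] (@tcons R n).
Proof.
exact: (@measurable_cons _ _ (measurableTypeR R * n.-tuple R)%type R
  fst n snd measurable_fst measurable_snd).
Qed.

Let preimage_tcons_measurable (A : set (n.+1.-tuple R)) :
  measurable A -> measurable (@tcons R n @^-1` A).
Proof. by move=> mA; rewrite -[X in measurable X]setTI; exact: measurable_tcons. Qed.

Let lebesgue_cons0 : lebesgue_cons set0 = 0.
Proof. by rewrite /lebesgue_cons /pushforward preimage_set0 measure0. Qed.

Let lebesgue_cons_ge0 A : 0 <= lebesgue_cons A.
Proof. exact: (measure_ge0 (@lebesgue_measure R \x nu)). Qed.

Let lebesgue_cons_sigma_additive : semi_sigma_additive lebesgue_cons.
Proof.
move=> F mF tF mUF; rewrite /lebesgue_cons /pushforward preimage_bigcup.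
apply: (@measure_semi_sigma_additive _ _ _ (@lebesgue_measure R \x nu)).
- by move=> k; exact: preimage_tcons_measurable.
- apply/trivIsetP => /= i j _ _ ij; rewrite -preimage_setI.
  by move/trivIsetP : tF => /(_ _ _ _ _ ij) ->//; rewrite preimage_set0.
- by rewrite -preimage_bigcup; exact: preimage_tcons_measurable.
Qed.

HB.instance Definition _ := isMeasure.Build _ _ _ lebesgue_cons
  lebesgue_cons0 lebesgue_cons_ge0 lebesgue_cons_sigma_additive.

Let tuncons (t : n.+1.-tuple R) : R * n.-tuple R := (thead t, [tuple of behead t]).

Let tunconsK (p : R * n.-tuple R) : tuncons (tcons p) = p.
Proof. by case: p => x t; congr pair; exact: val_inj. Qed.

Let measurable_tuncons : measurable_fun setT tuncons.
Proof.
apply/measurable_fun_pairP; split.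
- exact: (measurable_tnth ord0).
- exact: measurable_behead.
Qed.

Let lebesgue_cons_sigma_finite : sigma_finite setT lebesgue_cons.
Proof.
have /sigma_finiteP[F [TF ndF Foo]] := sigma_finiteT (@lebesgue_measure R).
have /sigma_finiteP[G [TG ndG Goo]] := sigma_finiteT nu.
exists (fun k => tuncons @^-1` (F k `*` G k)).
  rewrite -preimage_bigcup; apply/esym/seteqP; split=> // t _.
  have [i _ Fi] : (\bigcup_k F k) (tuncons t).1 by rewrite -TF.
  have [j _ Gj] : (\bigcup_k G k) (tuncons t).2 by rewrite -TG.
  exists (maxn i j) => //; split.
  - by move: Fi; exact/subsetPset/ndF/leq_maxl.
  - by move: Gj; exact/subsetPset/ndG/leq_maxr.
move=> k; have [mF Fk] := Foo k; have [mG Gk] := Goo k; split.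
  by rewrite -[X in measurable X]setTI; apply: measurable_tuncons => //; exact: measurableX.
rewrite /lebesgue_cons /pushforward -comp_preimage.
rewrite (_ : tuncons \o _ = id); last by apply/funext => p; exact: tunconsK.
rewrite preimage_id product_measure1E//.
by rewrite lte_mul_pinfty// ge0_fin_numE.
Qed.

HB.instance Definition _ := Measure_isSigmaFinite.Build _ _ _ lebesgue_cons
  lebesgue_cons_sigma_finite.

End lebesgue_tuple_step.

Fixpoint lebesgue_tuple (R : realType) (n : nat) :
    {sigma_finite_measure set (n.-tuple R) -> \bar R} :=
  match n with
  | 0 => \d_([tuple] : 0.-tuple R)
  | n'.+1 => lebesgue_cons (lebesgue_tuple R n')
  end.

Definition mutually_independent d (T : measurableType d) (R : realType)
    (P : probability T R) (I : finType) (X : I -> T -> R) : Prop :=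
  forall (J : {set I}) (B : I -> set R), (forall i, measurable (B i)) ->
    P (\bigcap_(i in [set` J]) (X i @^-1` B i)) =
    (\prod_(i in J) P (X i @^-1` B i))%E.

(* [h v u] is the density at [u], with respect to [nu], of [U] given [V = v]:
   P(U \in B | V) = \int_B h(V, u) nu(du) almost surely, for all measurable B. *)
Definition is_conditional_density d (T : measurableType d) (R : realType)
    (P : probability T R) d1 (E1 : measurableType d1) d2 (E2 : measurableType d2)
    (nu : {measure set E1 -> \bar R}) (U : T -> E1) (V : T -> E2)
    (h : E2 -> E1 -> R) : Prop :=
  [/\ measurable_fun setT U,
      measurable_fun setT V,
      forall v u, 0 <= h v u,
      measurable_fun setT (fun vu : E2 * E1 => h vu.1 vu.2) &
      forall (B : set E1) (D : set E2), measurable B -> measurable D ->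
        P (U @^-1` B `&` V @^-1` D) =
        (\int[P]_(w in V @^-1` D) \int[nu]_(u in B) (h (V w) u)%:E)%E].

(* For b = 1, 2, 4, a matrix over the reals, complex numbers or quaternions is
   given by its b real components in the basis 1, i, j, k. *)
Definition hmatrix (R : realType) (b n : nat) : Type := 'I_b -> 'M[R]_n.

Section hmatrix.
Context (R : realType) (b : nat).
Local Open Scope complex_scope.

Definition hmx_add n (M M' : hmatrix R b n) : hmatrix R b n :=
  fun k => M k + M' k.

(* (conjugate) transpose: the imaginary units change sign *)
Definition hmx_adj n (M : hmatrix R b n) : hmatrix R b n :=
  fun k => if k == 0%N :> nat then (M k)^T else - (M k)^T.

Definition hmx_diag n (a : 'I_n -> R) : hmatrix R b n :=
  fun k => if k == 0%N :> nat then diag_mx (\row_i a i) else 0.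

Definition hmx_self_adjoint_part n (M : hmatrix R b n) : hmatrix R b n :=
  fun k => 2^-1 *: hmx_add M (hmx_adj M) k.

Definition hmx_corner n (M : hmatrix R b n.+1) : hmatrix R b n :=
  fun k => mxsub (widen_ord (leqnSn n)) (widen_ord (leqnSn n)) (M k).

Definition hmx_comp n (M : hmatrix R b n) (k : nat) : 'M[R]_n :=
  oapp M 0 (insub k).

Definition hmx_cpart n (M : hmatrix R b n) (k : nat) : 'M[R[i]]_n :=
  \matrix_(i, j) (hmx_comp M k i j +i* hmx_comp M k.+1 i j).

(* A quaternionic matrix is Z + W j with Z, W complex; j z = z^* j gives its
   usual image among the complex matrices of twice the size. *)
Definition hmx_complex_image n (M : hmatrix R b n) : 'M[R[i]]_(n + n) :=
  let Z := hmx_cpart M 0 in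
  let W := hmx_cpart M 2 in
  block_mx Z W (- map_mx conjc W) (map_mx conjc Z).

(* For a self-adjoint quaternionic matrix, the characteristic polynomial of the
   complex image is a square, and the reduced characteristic polynomial (equal
   to the Moore determinant of 'X - M) is its monic square root, of degree n.
   Only b = 1, 2, 4 is meaningful. *)
Definition is_hmx_char_poly n (M : hmatrix R b n) (p : {poly R}) : Prop :=
  match b with
  | 1 => p = char_poly (hmx_comp M 0)
  | 2 => map_poly (real_complex R) p = char_poly (hmx_cpart M 0)
  | _ => p \is monic /\
         map_poly (real_complex R) (p ^+ 2) = char_poly (hmx_complex_image M)
  end.

Definition is_eigenvalues n (M : hmatrix R b n) (s : n.-tuple R) : Prop :=
  sorted >=%R s /\ is_hmx_char_poly M (\prod_(x <- s) ('X - x%:P)).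

End hmatrix.

Section density.
Context (R : realType) (n : nat).

Definition interlacing (m : n.-tuple R) (l : n.+1.-tuple R) : bool :=
  [forall i : 'I_n, (tnth m i <= tnth l (widen_ord (leqnSn n) i)) &&
                    (tnth l (lift ord0 i) <= tnth m i)].

(* For b = 1 the singular factor |x| `^ (-1/2) is 0 at x = 0 by the convention
   of powR; for fixed m with distinct entries this concerns a null set of l. *)
Definition corner_density (b : nat) (aN : R) (m : n.-tuple R)
    (l : n.+1.-tuple R) : R :=
  expR (- (2^-1 * \sum_(i < n.+1) tnth l i ^+ 2)) *
  expR (aN * \sum_(i < n.+1) tnth l i) *
  (\prod_(i < n.+1) \prod_(j < n.+1 | (i < j)%N) (tnth l i - tnth l j)) *
  (\prod_(i < n) \prod_(j < n.+1) `|tnth m i - tnth l j| `^ (b%:R / 2 - 1)) *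
  (interlacing m l)%:R.

End density.

(* Main.v *)
Require Import Defs.
From HB Require Import structures.
From mathcomp Require Import all_boot all_order all_algebra.
From mathcomp Require Import all_classical all_reals all_analysis.
From mathcomp Require Import perm measurable_realfun complex ring lra zify.

Set Implicit Arguments.
Unset Strict Implicit.
Unset Printing Implicit Defensive.

Import Order.TTheory GRing.Theory Num.Theory.
Import numFieldNormedType.Exports.

Local Open Scope classical_set_scope.
Local Open Scope ring_scope.

(** The matrix C is determined by its corner M, its last column v off the
    diagonal, and its last diagonal entry x. Expressing v in an orthonormal
    eigenbasis of M and taking a Schur complement, the characteristic polynomial
    of C is the arrow polynomial
      (z - x) prod_i (z - mu_i) - sum_i r_i prod_(k <> i) (z - mu_k),
    where r_i is the squared modulus of the i-th coordinate of v, a sum of b real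
    squares ([border_char_poly]). Hence lambda depends on M, v, x only through
    mu, x and r. Now v and x are independent of M, the law of v is invariant under
    orthogonal maps, and x is normal with mean a_N and variance 1; so, given M,
    the numbers r_i are independent with density proportional to
    r^(b/2-1) e^(-r), whatever the eigenbasis is. This identifies the conditional
    law of (x, r) given mu.

    It remains to change variables from (x, r) to lambda. For mu strictly
    decreasing and r positive, (x, r) is recovered from lambda by the partial
    fraction expansion of prod_j (z - lambda_j) / prod_i (z - mu_i), the range is
    the set of lambda interlacing with mu, and the Jacobian determinant of
    (x, r) with respect to lambda is the quotient V(lambda) / V(mu) of Vandermonde
    products ([integral_pole_resid]). The density in the statement appears on
    substituting ([corner_densityE])
      x = sum lambda - sum mu,
      x^2 / 2 + sum r = (sum lambda^2 - sum mu^2) / 2,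
      prod_i r_i = prod_(i, j) |mu_i - lambda_j| / V(mu)^2.

    The three values of b are treated together by using real matrices. A complex
    hermitian matrix of size m, and the complex image of a quaternionic one, act
    as real symmetric matrices of twice the size, so that the spectral theorem for
    real symmetric matrices suffices, and the r_i are sums of squares of b
    consecutive coordinates of a real orthogonal image of v.

    The probabilistic part is also reduced to integrals over a real vector space:
    the family of all entries of X has a Gaussian density ([law_rv_tuple]), and an
    explicit isometry replaces the two entries X_in, X_ni by the corresponding
    component of the last column of C and an independent complementary component
    ([integral_assemble]). The formula needs mu to be strictly decreasing, which
    holds almost surely by induction on the size: the density of lambda given mu
    vanishes when two eigenvalues coincide ([simple_spectrum]). Eigenvalues are
    measurable functions of the matrix because the ordered roots of a polynomial
    can be described through countably many of its values
    ([measurable_sorted_roots]). *)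

(** * Lebesgue measure on tuples and its invariance under isometries *)
(** The proofs that f is measurable and nonnegative are arguments so that the
    measure structure can be attached to the definition itself. *)
Definition density_measure d (T : measurableType d) (R : realType)
    (mu : {measure set T -> \bar R}) (f : T -> R)
    (mf : measurable_fun [set: T] f) (f0 : forall x, 0 <= f x) (A : set T) : \bar R :=
  (\int[mu]_(x in A) (f x)%:E)%E.

Section density.
Context d (T : measurableType d) (R : realType) (mu : {measure set T -> \bar R}).
Variables (f : T -> R) (mf : measurable_fun [set: T] f) (f0 : forall x, (0 <= f x)%R).
Local Open Scope ereal_scope.
Local Notation nu := (density_measure mu mf f0).
Import HBNNSimple.

Let nu0 : nu set0 = 0.
Proof. by rewrite /density_measure integral_set0. Qed.

Let nu_ge0 A : 0 <= nu A.
Proof. by apply: integral_ge0 => x _; rewrite lee_fin. Qed.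

Let nu_additive : semi_sigma_additive nu.
Proof.
move=> A mA tA mUA; rewrite /density_measure ge0_integral_bigcup//.
- by apply: is_cvg_ereal_nneg_natsum_cond => n _ _; exact: nu_ge0.
- exact/measurable_EFinP/measurable_funTS.
- by move=> x _; rewrite lee_fin.
Qed.

HB.instance Definition _ := isMeasure.Build _ _ _ nu nu0 nu_ge0 nu_additive.

(** By approximation with nonnegative simple functions and monotone convergence. *)
Lemma ge0_integral_density (g : T -> \bar R) : measurable_fun [set: T] g ->
  (forall x, 0 <= g x) -> \int[nu]_x g x = \int[mu]_x (g x * (f x)%:E).
Proof.
move=> mg g0.
pose g_ := nnsfun_approx measurableT mg.
transitivity (limn (fun n => \int[nu]_x (g_ n x)%:E)).
  rewrite -monotone_convergence//.
  - apply: eq_integral => y _; apply/esym/cvg_lim => //.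
    by apply: cvg_nnsfun_approx.
  - by move=> n; exact/measurable_EFinP/measurable_funP.
  - by move=> n y _; rewrite lee_fin.
  - by move=> y _ m n mn; rewrite lee_fin; exact/lefP/nd_nnsfun_approx.
transitivity (limn (fun n => \int[mu]_x ((g_ n x)%:E * (f x)%:E))); last first.
  rewrite -monotone_convergence//.
  - apply: eq_integral => y _; apply/cvg_lim => //.
    apply: cvgeZr => //; last exact: cvg_nnsfun_approx.
  - move=> n; apply: emeasurable_funM; exact/measurable_EFinP.
  - by move=> n y _; rewrite mule_ge0 ?lee_fin.
  - by move=> y _ m n mn; rewrite lee_wpmul2r ?lee_fin//; exact/lefP/nd_nnsfun_approx.
congr (limn _); apply/funext => n.
have mgn r : measurable (g_ n @^-1` [set r]) by [].
have gE x : (g_ n x)%:E =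
    \sum_(i \in range (g_ n)) (i * \1_(g_ n @^-1` [set i]) x)%:E.
  by rewrite {1}fimfunE fsumEFin.
rewrite (eq_integral _ _ (fun x _ => gE x)).
rewrite (eq_integral _ _ (fun x _ => congr1 (fun u => u * (f x)%:E) (gE x))).
rewrite ge0_integral_fsum//; last 2 first.
- by move=> r; exact/measurable_EFinP/measurableT_comp.
- by move=> r x _; exact: nnfun_muleindic_ge0.
rewrite [RHS](eq_integral (fun x => \sum_(i \in range (g_ n))
   (i * \1_(g_ n @^-1` [set i]) x)%:E * (f x)%:E)); last first.
  by move=> x _; rewrite ge0_mule_fsuml// => i; exact: nnfun_muleindic_ge0.
rewrite ge0_integral_fsum//; last 2 first.
- move=> r; apply: emeasurable_funM => //; exact/measurable_EFinP/measurableT_comp.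
- by move=> r x _; apply: mule_ge0; [exact: nnfun_muleindic_ge0|rewrite lee_fin].
apply: eq_fsbigr => r _.
have [r0|r0] := leP 0%R r.
  under eq_integral do rewrite EFinM.
  under [RHS]eq_integral do rewrite EFinM -muleA.
  rewrite ge0_integralZl_EFin//; last exact/measurable_EFinP.
  rewrite ge0_integralZl_EFin//; last 2 first.
  - by move=> x _; rewrite mule_ge0 ?lee_fin.
  - by apply: emeasurable_funM => //; exact/measurable_EFinP.
  rewrite integral_indic// setIT; congr (_ * _).
  transitivity (\int[mu]_(x in g_ n @^-1` [set r]) (f x)%:E) => //.
  rewrite integral_mkcond; apply: eq_integral => x _.
  by rewrite patchE indicE; case: ifPn; rewrite ?mul1e ?mul0e.
rewrite preimage_nnfun0//.
by rewrite !integral0_eq// => x _; rewrite indicE in_set0 mulr0 ?mul0e.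
Unshelve. all: end_near. Qed.

End density.

Arguments lebesgue_tuple : simpl never.

Section lebesgue_tuple_theory.
Variable R : realType.
Local Notation leb := (@lebesgue_measure R).
Local Open Scope ereal_scope.

Lemma tnth_tcons0 n (p : R * n.-tuple R) : tnth (tcons p) ord0 = p.1.
Proof. by rewrite (tnth_nth 0%R). Qed.

Lemma tnth_tconsS n (p : R * n.-tuple R) i : tnth (tcons p) (lift ord0 i) = tnth p.2 i.
Proof. by rewrite !(tnth_nth 0%R). Qed.

(** Tonelli, peeling off the first coordinate. *)
Lemma integral_lebesgue_tupleS n (f : n.+1.-tuple R -> \bar R) :
  measurable_fun [set: n.+1.-tuple R] f -> (forall t, 0 <= f t) ->
  \int[lebesgue_tuple R n.+1]_t f t =
  \int[leb]_x \int[lebesgue_tuple R n]_t f (tcons (x, t)).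
Proof.
move=> mf f0.
transitivity (\int[leb \x lebesgue_tuple R n]_x f (tcons x)).
  exact: (ge0_integral_pushforward (@measurable_tcons R n)
    (leb \x lebesgue_tuple R n) measurableT mf (fun t _ => f0 t)).
rewrite fubini_tonelli1//=.
by apply: measurableT_comp => //; exact: measurable_tcons.
Qed.

Lemma integral_lebesgue_tupleS_swap n (f : n.+1.-tuple R -> \bar R) :
  measurable_fun [set: n.+1.-tuple R] f -> (forall t, 0 <= f t) ->
  \int[lebesgue_tuple R n.+1]_t f t =
  \int[lebesgue_tuple R n]_t \int[leb]_x f (tcons (x, t)).
Proof.
move=> mf f0; rewrite integral_lebesgue_tupleS//.
apply: (fubini_tonelli (m1 := leb) (m2 := lebesgue_tuple R n) (fun p => f (tcons p))) => //=.
by apply: measurableT_comp => //; exact: measurable_tcons.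
Qed.

Lemma integral_lebesgue_tuple0 (f : 0.-tuple R -> \bar R) :
  measurable_fun [set: 0.-tuple R] f -> (forall t, 0 <= f t) ->
  \int[lebesgue_tuple R 0]_t f t = f [tuple].
Proof. by move=> mf f0; rewrite integral_dirac// diracT mul1e. Qed.

Lemma measurable_tcons_pair n d (T : measurableType d) (f : T -> R) (g : T -> n.-tuple R) :
  measurable_fun [set: T] f -> measurable_fun [set: T] g ->
  measurable_fun [set: T] (fun x => tcons (f x, g x)).
Proof.
move=> mf mg; apply: measurableT_comp; first exact: measurable_tcons.
exact: measurable_fun_pair.
Qed.

(** The image of Lebesgue measure under a translation agrees with it on half-open
    intervals, which characterizes it. *)
Lemma ge0_integral_shift (c : R) (f : R -> \bar R) :
  measurable_fun [set: R] f -> (forall r, 0 <= f r) ->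
  \int[leb]_x f (x + c)%R = \int[leb]_x f x.
Proof.
move=> mf f0.
have mc : measurable_fun [set: measurableTypeR R] (fun x : R => (x + c)%R : measurableTypeR R).
  exact: measurable_funD.
pose phi : {mfun measurableTypeR R >-> measurableTypeR R} :=
  HB.pack (fun x : R => (x + c)%R : measurableTypeR R) (isMeasurableFun.Build _ _ _ _ _ mc).
transitivity (\int[pushforward leb phi]_x f x).
  by rewrite (ge0_integral_pushforward mc leb measurableT mf (fun t _ => f0 t)).
apply: eq_measure_integral => A mA _.
apply/esym; apply: lebesgue_measure_unique mA => _ [[a b]] _ <-.
rewrite /= /pushforward/=.
rewrite (_ : _ @^-1` _ = `](a - c)%R, (b - c)%R]%classic).
  by rewrite !lebesgue_measure_itv/= !lte_fin ltrD2r -!EFinB; congr (if _ then _%:E else _); ring.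
by apply/seteqP; split=> x /=; rewrite !in_itv/= ltrBlDr lerBrDr.
Qed.

Lemma ge0_integral_reflect (f : R -> \bar R) :
  measurable_fun [set: R] f -> (forall r, 0 <= f r) ->
  \int[leb]_x f (- x)%R = \int[leb]_x f x.
Proof.
move=> mf f0.
have mo : measurable_fun [set: measurableTypeR R] (-%R : R -> measurableTypeR R) by [].
transitivity (\int[pushforward leb (-%R : R -> measurableTypeR R)]_x f x).
  by rewrite (ge0_integral_pushforward mo leb measurableT mf (fun t _ => f0 t)).
by apply: eq_measure_integral => A mA _; exact: lebesgue_measureN.
Qed.

Lemma ge0_integral_subl (c : R) (f : R -> \bar R) :
  measurable_fun [set: R] f -> (forall r, 0 <= f r) ->
  \int[leb]_x f (c - x)%R = \int[leb]_x f x.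
Proof.
move=> mf f0; rewrite -(ge0_integral_shift c mf f0).
rewrite -(@ge0_integral_reflect (fun x => f (x + c)%R))//.
  by apply: eq_integral => x _; rewrite addrC.
by apply: measurableT_comp => //; exact: measurable_funD.
Qed.

Definition tsub n (s t : n.-tuple R) : n.-tuple R := [tuple (tnth s i - tnth t i)%R | i < n].

Lemma tsub_tcons n p q : tsub (@tcons R n p) (tcons q) = tcons ((p.1 - q.1)%R, tsub p.2 q.2).
Proof.
apply: eq_from_tnth => i; rewrite tnth_mktuple; case: (unliftP ord0 i) => [j|] ->.
  by rewrite !tnth_tconsS/= tnth_mktuple.
by rewrite !tnth_tcons0.
Qed.

Lemma tcons_eta n (t : n.+1.-tuple R) : t = tcons (thead t, [tuple of behead t]).
Proof. by apply: val_inj; case: t => -[|x s]. Qed.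

Lemma measurable_tsub n d (T : measurableType d) (f g : T -> n.-tuple R) :
  measurable_fun [set: T] f -> measurable_fun [set: T] g ->
  measurable_fun [set: T] (fun x => tsub (f x) (g x)).
Proof.
move=> mf mg; apply/measurable_fun_tnthP => i.
rewrite (_ : _ \o _ = fun x => tnth (f x) i - tnth (g x) i)%R; last first.
  by apply/funext => x /=; rewrite tnth_mktuple.
by apply: measurable_funB; apply: (measurableT_comp (measurable_tnth i)).
Qed.

Lemma measurable_integral_tcons n (f : n.+1.-tuple R -> \bar R) :
  measurable_fun [set: n.+1.-tuple R] f -> (forall t, 0 <= f t) ->
  measurable_fun [set: R] (fun x => \int[lebesgue_tuple R n]_t f (tcons (x, t))).
Proof.
move=> mf f0.
apply: (@measurable_fun_fubini_tonelli_F _ _ _ _ _ (lebesgue_tuple R n)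
  (fun p : measurableTypeR R * n.-tuple R => f (tcons p))) => //.
by apply: measurableT_comp => //; exact: measurable_tcons.
Qed.

Lemma measurable_tcons_section n (f : n.+1.-tuple R -> \bar R) x :
  measurable_fun [set: n.+1.-tuple R] f ->
  measurable_fun [set: n.-tuple R] (fun t => f (tcons (x, t))).
Proof. by move=> mf; apply: measurableT_comp => //; exact: measurable_tcons_pair. Qed.

Lemma integral_tsub n (y : n.-tuple R) (f : n.-tuple R -> \bar R) :
  measurable_fun [set: n.-tuple R] f -> (forall t, 0 <= f t) ->
  \int[lebesgue_tuple R n]_t f (tsub y t) = \int[lebesgue_tuple R n]_t f t.
Proof.
elim: n y f => [|n IH] y f mf f0.
  by apply: eq_integral => t _; rewrite (tuple0 (tsub y t)) (tuple0 t).
rewrite (tcons_eta y); set y0 := thead y; set y' := [tuple of behead y].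
have mfy : measurable_fun [set: n.+1.-tuple R] (fun t => f (tsub (tcons (y0, y')) t)).
  by apply: measurableT_comp => //; exact: measurable_tsub.
rewrite (integral_lebesgue_tupleS mfy (fun t => f0 _)) (integral_lebesgue_tupleS mf f0).
under eq_integral do (under eq_integral do rewrite tsub_tcons).
transitivity (\int[leb]_x \int[lebesgue_tuple R n]_t f (tcons (y0 - x, t))%R).
  apply: eq_integral => x _ /=.
  by rewrite (IH y' (fun t => f (tcons (y0 - x, t))%R))//; exact: measurable_tcons_section.
pose h x := \int[lebesgue_tuple R n]_t f (tcons (x, t)).
have mh : measurable_fun [set: R] h by exact: measurable_integral_tcons.
have h0 x : 0 <= h x by apply: integral_ge0.
exact: (ge0_integral_subl y0 mh h0).
Qed.

Lemma integral_tsubl n (y : n.-tuple R) (f : n.-tuple R -> \bar R) :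
  measurable_fun [set: n.-tuple R] f -> (forall t, 0 <= f t) ->
  \int[lebesgue_tuple R n]_t f (tsub t y) = \int[lebesgue_tuple R n]_t f t.
Proof.
move=> mf f0; pose z : n.-tuple R := [tuple 0%R | i < n].
have mfz : measurable_fun [set: n.-tuple R] (fun t => f (tsub z t)).
  by apply: measurableT_comp => //; exact: measurable_tsub.
rewrite -(integral_tsub z mf f0) -[RHS](integral_tsub y mfz)//.
apply: eq_integral => t _; congr f; apply: eq_from_tnth => i.
by rewrite !tnth_mktuple sub0r opprB.
Qed.

Definition trow n (t : n.-tuple R) : 'rV[R]_n := \row_i tnth t i.
(** Tuples carry the measure and matrices the linear algebra; tmul lets a matrix
    act on a tuple regarded as a row vector. *)
Definition tmul n m (t : n.-tuple R) (Q : 'M[R]_(n, m)) : m.-tuple R :=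
  [tuple (trow t *m Q) ord0 j | j < m].
Definition tnorm2 n (t : n.-tuple R) : R := (\sum_(i < n) tnth t i ^+ 2)%R.

Lemma trow_tmul n m t (Q : 'M[R]_(n, m)) : trow (tmul t Q) = (trow t *m Q)%R.
Proof. by apply/rowP => j; rewrite mxE tnth_mktuple. Qed.

Lemma trow_inj n : injective (@trow n).
Proof. by move=> s t /rowP st; apply: eq_from_tnth => i; have := st i; rewrite !mxE. Qed.

Lemma trow_tsub n (s t : n.-tuple R) : trow (tsub s t) = (trow s - trow t)%R.
Proof. by apply/rowP => j; rewrite !mxE tnth_mktuple. Qed.

Lemma tnorm2E n (t : n.-tuple R) : tnorm2 t = ((trow t *m (trow t)^T) ord0 ord0)%R.
Proof. by rewrite mxE; apply: eq_bigr => i _; rewrite !mxE expr2. Qed.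

Lemma measurable_tmul n m (Q : 'M[R]_(n, m)) :
  measurable_fun [set: n.-tuple R] (fun t => tmul t Q).
Proof.
apply/measurable_fun_tnthP => j.
rewrite (_ : _ \o _ = fun t => \sum_i tnth t i * Q i j)%R; last first.
  by apply/funext => t /=; rewrite tnth_mktuple mxE; apply: eq_bigr => i _; rewrite mxE.
by apply: measurable_sum => i; apply: measurable_funM => //; exact: measurable_tnth.
Qed.

Lemma measurable_tnorm2 n : measurable_fun [set: n.-tuple R] (@tnorm2 n).
Proof.
by apply: measurable_sum => i; apply: measurable_funX; exact: measurable_tnth.
Qed.

Definition tgauss n (t : n.-tuple R) : R := expR (- tnorm2 t).

Lemma measurable_tgauss n : measurable_fun [set: n.-tuple R] (@tgauss n).
Proof.
apply: measurableT_comp; first exact: measurable_expR.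
by apply: measurableT_comp => //; exact: measurable_tnorm2.
Qed.

Lemma tgauss_tcons n (p : R * n.-tuple R) : tgauss (tcons p) = (gauss_fun p.1 * tgauss p.2)%R.
Proof.
rewrite /tgauss /gauss_fun -expRD -opprD; congr (expR (- _)).
rewrite /tnorm2 big_ord_recl tnth_tcons0; congr (_ + _)%R.
by apply: eq_bigr => i _; rewrite tnth_tconsS.
Qed.

Lemma integral_tgauss n : \int[lebesgue_tuple R n]_t (tgauss t)%:E = (Num.sqrt pi ^+ n)%:E.
Proof.
elim: n => [|n IH].
  rewrite integral_lebesgue_tuple0; first last.
  - by move=> t; rewrite lee_fin expR_ge0.
  - apply/measurable_EFinP. exact: measurable_tgauss.
  by rewrite /tgauss /tnorm2 big_ord0 oppr0 expR0 expr0.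
rewrite integral_lebesgue_tupleS; first last.
- by move=> t; rewrite lee_fin expR_ge0.
- apply/measurable_EFinP; exact: measurable_tgauss.
have mg : measurable_fun [set: n.-tuple R] (fun t => (tgauss t)%:E).
  apply/measurable_EFinP; exact: measurable_tgauss.
transitivity (\int[leb]_x ((gauss_fun x)%:E * (Num.sqrt pi ^+ n)%:E)).
  apply: eq_integral => x _; under eq_integral do rewrite tgauss_tcons EFinM.
  rewrite /= ge0_integralZl_EFin ?IH//; last exact: gauss_fun_ge0.
  by move=> t _; rewrite lee_fin expR_ge0.
rewrite ge0_integralZr//=; first by rewrite integralT_gauss -EFinM exprS.
- by apply/measurable_EFinP; exact: measurable_gauss_fun.
- by move=> x _; rewrite lee_fin gauss_fun_ge0.
Qed.

(** Invariance under orthogonal maps without a determinant formula: multiply by the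
    Gaussian integral g, which is invariant under Q, write the product of the two
    integrals as a double integral of f(tQ) g(y - tQ), exchange the order, and
    use invariance of Lebesgue measure under t |-> yQ^T - t. The roles of f and g
    are exchanged, so that f(tQ) and f(t) have the same integral up to the
    finite positive factor given by the integral of g. *)
Lemma integral_tmul n (Q : 'M[R]_n) (f : n.-tuple R -> \bar R) :
  (Q *m Q^T = 1%:M)%R -> measurable_fun [set: n.-tuple R] f -> (forall t, 0 <= f t) ->
  \int[lebesgue_tuple R n]_t f (tmul t Q) = \int[lebesgue_tuple R n]_t f t.
Proof.
move=> QQ mf f0; set L := lebesgue_tuple R n.
have QQ' : (Q^T *m Q = 1%:M)%R by apply: mulmx1C.
pose g (t : n.-tuple R) := (tgauss t)%:E : \bar R.
have mg : measurable_fun [set: n.-tuple R] g by apply/measurable_EFinP; exact: measurable_tgauss.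
have g0 t : 0 <= g t by rewrite lee_fin expR_ge0.
have gQ t : g (tmul t Q) = g t.
  congr (expR (- _))%:E; rewrite !tnorm2E trow_tmul trmx_mul mulmxA.
  by rewrite -(mulmxA _ Q) QQ mulmx1.
have mQ := measurable_tmul Q.
have Gfin : \int[L]_t g t = (Num.sqrt pi ^+ n)%:E by exact: integral_tgauss.
have Gpos : (0 < Num.sqrt pi ^+ n :> R)%R by rewrite exprn_gt0// sqrtr_gt0 pi_gt0.
(* the integrals of f may be infinite, but the Gaussian factor can be cancelled *)
suff : (\int[L]_t f (tmul t Q)) * (Num.sqrt pi ^+ n)%:E = (\int[L]_t f t) * (Num.sqrt pi ^+ n)%:E.
  move=> /(congr1 (fun u => u * ((Num.sqrt pi ^+ n)^-1)%:E)).
  by rewrite -!muleA -EFinM divff ?gt_eqF// !mule1.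
have mfQ : measurable_fun [set: n.-tuple R] (fun t => f (tmul t Q)) by exact: measurableT_comp.
have mp2 : measurable_fun [set: n.-tuple R * n.-tuple R] (fun p => tmul p.1 Q).
  exact: (measurableT_comp mQ measurable_fst).
have mp1 : measurable_fun [set: n.-tuple R * n.-tuple R] (fun p => tsub p.2 (tmul p.1 Q)).
  exact: measurable_tsub.
have sg (h : n.-tuple R -> \bar R) (mh : measurable_fun [set: n.-tuple R] h)
   (h0 : forall t, 0 <= h t) c : 0 <= c -> (\int[L]_t h t) * c = \int[L]_t (h t * c).
  by move=> c0; rewrite ge0_integralZr.
have eG c (y : n.-tuple R) :
  0 <= c -> \int[L]_t (c * g (tsub t y)) = c * (Num.sqrt pi ^+ n)%:E.
  move=> c0; rewrite ge0_integralZl//; last by apply: measurableT_comp => //; exact: measurable_tsub.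
  by rewrite integral_tsubl// Gfin.
rewrite sg//.
transitivity (\int[L]_t \int[L]_y (f (tmul t Q) * g (tsub y (tmul t Q)))).
  by apply: eq_integral => t _; rewrite eG.
rewrite (fubini_tonelli (m1 := L) (m2 := L)
  (fun p => f (tmul p.1 Q) * g (tsub p.2 (tmul p.1 Q)))); last 2 first.
- by apply: emeasurable_funM; exact: measurableT_comp.
- by move=> p; rewrite mule_ge0.
transitivity (\int[L]_y \int[L]_t (f (tsub y (tmul t Q)) * g t)).
  apply: eq_integral => y _ /=.
  rewrite -(integral_tsub (tmul y Q^T) (f := fun t => f (tmul t Q) * g (tsub y (tmul t Q)))); last 2 first.
  - by apply: emeasurable_funM => //; apply: measurableT_comp => //; exact: measurable_tsub.
  - by move=> t; rewrite mule_ge0.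
  apply: eq_integral => t _ /=.
  have -> : tmul (tsub (tmul y Q^T) t) Q = tsub y (tmul t Q).
    apply: trow_inj; rewrite trow_tmul !trow_tsub !trow_tmul mulmxBl -mulmxA QQ'.
    by rewrite mulmx1.
  have -> : tsub y (tsub y (tmul t Q)) = tmul t Q.
    by apply: trow_inj; rewrite !trow_tsub subKr.
  by rewrite gQ.
rewrite -(fubini_tonelli (m1 := L) (m2 := L)
  (fun p => f (tsub p.2 (tmul p.1 Q)) * g p.1)); last 2 first.
- by apply: emeasurable_funM; apply: measurableT_comp.
- by move=> p; rewrite mule_ge0.
rewrite -Gfin muleC sg//; last exact: integral_ge0.
apply: eq_integral => t _ /=.
rewrite ge0_integralZr//.
  by rewrite integral_tsubl// muleC.
by apply: measurableT_comp => //; exact: measurable_tsub.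
Qed.

End lebesgue_tuple_theory.

(** * Change of variable on an open interval *)
Section substitution_compact.
Variable R : realType.
Local Notation leb := (@lebesgue_measure R).
Variables (F f : R -> R) (a b : R).
Hypothesis ab : a < b.
Hypothesis dF : forall x, x \in `[a, b] -> is_derive x 1 F (f x).
Hypothesis cf : forall x, x \in `[a, b] -> {for x, continuous f}.
Hypothesis f_gt0 : forall x, x \in `[a, b] -> 0 < f x.

(** F and f are only controlled on the interval [a, b]; composing with this
    retraction makes them continuous on the whole line. *)
Let clamp (x : R) : R := Num.max a (Num.min x b).

Let clamp_id x : x \in `[a, b] -> clamp x = x.
Proof.
by rewrite in_itv/= => /andP[ax xb]; rewrite /clamp min_l// max_r.
Qed.

Let clamp_in x : clamp x \in `[a, b].
Proof. by rewrite in_itv/= /clamp le_max lexx/= ge_max ltW//= ge_min lexx orbT. Qed.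

Let clamp_cont : continuous clamp.
Proof.
move=> x; apply: (@continuous_max R R^o (cst a) (fun x => Num.min x b)); first exact: cvg_cst.
by apply: (@continuous_min R R^o id (cst b)); [exact: cvg_id|exact: cvg_cst].
Qed.

Let cF x : x \in `[a, b] -> {for x, continuous F}.
Proof.
move=> xab; apply: differentiable_continuous; apply/derivable1_diffP.
by have := dF xab => -[].
Qed.

Let Fc := F \o clamp.
Let fc := f \o clamp.

Let mFc : measurable_fun [set: measurableTypeR R] (Fc : R -> measurableTypeR R).
Proof.
apply: continuous_measurable_fun => x; apply: continuous_comp; first exact: clamp_cont.
exact: cF.
Qed.

Let mfc : measurable_fun [set: R] fc.
Proof.
apply: continuous_measurable_fun => x; apply: continuous_comp; first exact: clamp_cont.
exact: cf.
Qed.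

Let F_lt x y : x \in `[a, b] -> y \in `[a, b] -> x < y -> F x < F y.
Proof.
rewrite !in_itv/= => /andP[ax xb] /andP[ay yb] xy.
apply: (@gtr0_derive1_incr R F a b) => //.
- by move=> z /subset_itv_oo_cc zab; have := dF zab => -[].
- by move=> z /subset_itv_oo_cc zab; rewrite derive1E (@derive_val _ _ _ _ _ _ _ (dF zab)) f_gt0.
- by apply: continuous_in_subspaceT => z; rewrite inE => /cF.
Qed.

Let F_le x y : x \in `[a, b] -> y \in `[a, b] -> x <= y -> F x <= F y.
Proof.
by move=> xab yab; rewrite le_eqVlt => /predU1P[->//|xy]; apply/ltW/F_lt.
Qed.

Let aab : a \in `[a, b]. Proof. by rewrite in_itv/= lexx ltW. Qed.
Let bab : b \in `[a, b]. Proof. by rewrite in_itv/= lexx ltW. Qed.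

Local Open Scope ereal_scope.

Let FTC q : q \in `[a, b] -> \int[leb]_(x in `[a, q]) (f x)%:E = (F q - F a)%:E.
Proof.
move=> qab; have := qab; rewrite in_itv/= le_eqVlt => /andP[/predU1P[<- _|aq qb]].
  by rewrite set_itv1 integral_set1 subrr.
have sub z : z \in `[a, q] -> z \in `[a, b].
  by rewrite !in_itv/= => /andP[-> zq]; rewrite (le_trans zq qb).
rewrite (@continuous_FTC2 _ f F) ?EFinB//.
- by apply: continuous_in_subspaceT => z; rewrite inE => /sub/cf.
- split.
  + by move=> z /subset_itv_oo_cc/sub/dF[].
  + by apply: cvg_at_right_filter; exact: cF.
  + by apply: cvg_at_left_filter; exact: cF.
- by move=> z /subset_itv_oo_cc/sub zab; rewrite derive1E (@derive_val _ _ _ _ _ _ _ (dF zab)).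
Qed.

Let d1 (y : R) : R := \1_(`[F a, F b]%classic) y.
Let d2 (x : R) : R := (fc x * \1_(`[a, b]%classic) x)%R.

Let md1 : measurable_fun [set: R] d1. Proof. exact: measurable_indic. Qed.
Let md2 : measurable_fun [set: R] d2.
Proof. by apply: measurable_funM => //; exact: measurable_indic. Qed.
Let d10 y : (0 <= d1 y)%R. Proof. by []. Qed.
Let d20 y : (0 <= d2 y)%R.
Proof. by rewrite mulr_ge0// ltW// f_gt0//; exact: clamp_in. Qed.

Let m1 : {measure set (measurableTypeR R) -> \bar R} := density_measure leb md1 d10.
Let m2 : {measure set (measurableTypeR R) -> \bar R} :=
  measure_function_pushforward__canonical__measure_function_Measure
    (density_measure leb md2 d20) mFc.

Let m1E y : m1 `]-oo, y[%classic = leb (`]-oo, y[%classic `&` `[F a, F b]%classic).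
Proof.
rewrite /m1 /= /density_measure; under eq_integral do rewrite /d1.
by rewrite integral_indic// setIC.
Qed.

Let m2E y : m2 `]-oo, y[%classic =
  \int[leb]_(x in (`[a, b] `&` [set x | F x < y]%R)%classic) (f x)%:E.
Proof.
rewrite /m2 /= /pushforward /density_measure /=.
rewrite [LHS]integral_mkcond [RHS]integral_mkcond; apply: eq_integral => x _.
rewrite !patchE /d2 indicE /fc/=.
have [xab|xab] := boolP (x \in `[a, b]%classic); last first.
  rewrite mulr0 if_same ifF//; apply/negbTE; apply: contra xab.
  by rewrite !inE => -[].
rewrite mulr1 clamp_id; last by rewrite inE in xab.
have <- : (x \in Fc @^-1` `]-oo, y[%classic) =
       (x \in `[a, b]%classic `&` [set x | (F x < y)%R])%classic.
  rewrite in_setI xab/=; apply/idP/idP; rewrite !inE/= /Fc/= in_itv/= clamp_id//;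
  by rewrite inE in xab.
by [].
Qed.

(** Both measures vanish below F a, and for y = F q in the range they give
    F q - F a to the half-line below y, on one side by definition and on the other
    by the fundamental theorem of calculus. *)
Let m12 A : measurable A -> m1 A = m2 A.
Proof.
move=> mA; apply: (@measure_unique _ R (measurableTypeR R) (@RGenInftyO.G R)
  (fun n => `]-oo, (n%:R : R)%R[%classic) _ _ _ _ m1 m2 _ _ A mA) => //.
- exact: RGenInftyO.measurableE.
- move=> _ _ [x ->] [y ->]; exists (Num.min x y).
  by apply/seteqP; split => z /=; rewrite !in_itv/= lt_min => /andP.
- by move=> n; exists n%:R%R.
- apply/seteqP; split => // x _; exists (Num.truncn x).+1 => //=.
  by rewrite in_itv/= truncnS_gt.
- move=> _ [y ->]; rewrite m1E m2E.
  have [ya|ay] := leP y (F a).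
    rewrite (_ : _ `&` _ = set0) ?measure0; last first.
      apply/seteqP; split => // z []/=; rewrite !in_itv/= => zy /andP[az _].
      by have := lt_le_trans zy ya; rewrite ltNge az.
    rewrite (_ : _ `&` _ = set0) ?integral_set0//.
    apply/seteqP; split => // z []/= zab zy.
    have := lt_le_trans zy ya; rewrite ltNge F_le//.
    by move: zab; rewrite in_itv/= => /andP[].
  have [yb|by_] := leP y (F b).
    have [q qab Fq] : exists2 q, q \in `[a, b] & F q = y.
      apply: IVT; first exact: ltW.
        by apply: continuous_in_subspaceT => z; rewrite inE => /cF.
      have FF : (F a <= F b)%R by apply: F_le => //; exact: ltW.
      by rewrite (min_l FF) (max_r FF) yb andbT ltW.
    rewrite (_ : _ `&` _ = `[F a, y[%classic); last first.
      apply/seteqP; split => z /=; rewrite !in_itv/=; first by move=> [-> /andP[->]].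
      by move=> /andP[-> zy]; split=> //=; rewrite (le_trans (ltW zy) yb).
    rewrite (_ : _ `&` _ = `[a, q[%classic); last first.
      apply/seteqP; split => z /=.
        move=> [zab]; rewrite -Fq in_itv/= => Fzq; move: (zab); rewrite in_itv/= => /andP[-> _]/=.
        by rewrite ltNge; apply/negP => qz; move: Fzq; rewrite ltNge F_le.
      rewrite in_itv/= => /andP[az zq].
      have zab : z \in `[a, b].
        by rewrite in_itv/= az/= (le_trans (ltW zq))//; move: qab; rewrite in_itv => /andP[].
      by split => //; rewrite -Fq F_lt.
    rewrite lebesgue_measure_itv/= lte_fin ay -EFinB -Fq -FTC//.
    apply/esym; apply: integral_itv_bndo_bndc; apply/measurable_EFinP.
    apply: (eq_measurable_fun fc); last exact: measurable_funTS.
    move=> z; rewrite inE /= in_itv/= => /andP[az zq]; rewrite /fc /= clamp_id//.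
    by rewrite in_itv/= az/= (le_trans (ltW zq))//; move: qab; rewrite in_itv => /andP[].
  rewrite (_ : _ `&` _ = `[F a, F b]%classic); last first.
    apply/seteqP; split => z /=; first by case.
    move=> zab; split => //; move: zab; rewrite !in_itv/= => /andP[_ zb].
    exact: le_lt_trans zb by_.
  rewrite (_ : _ `&` _ = `[a, b]%classic); last first.
    apply/seteqP; split => z /=; first by case.
    move=> zab; split => //; apply: le_lt_trans by_; apply: F_le => //.
    by move: zab; rewrite in_itv => /andP[].
  by rewrite FTC// lebesgue_measure_itv/= lte_fin F_lt// EFinB.
- move=> k; rewrite m1E; apply: (@le_lt_trans _ _ (leb `[F a, F b]%classic)).
    by apply: le_measure; rewrite ?inE; [exact: measurableI|by []|exact: subIsetr].
  by rewrite lebesgue_measure_itv/=; case: ifP => _; rewrite ?ltry// -EFinB ltry.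
Qed.

(** For a nonnegative measurable integrand, with no continuity: the image of the
    measure with density f under F is Lebesgue measure on the interval from F a to
    F b. *)
Lemma ge0_integral_substitution_cc (phi : R -> \bar R) :
  measurable_fun [set: R] phi -> (forall y, 0 <= phi y) ->
  \int[leb]_(y in `[F a, F b]) phi y =
  \int[leb]_(x in `[a, b]) (phi (F x) * (f x)%:E).
Proof.
move=> mphi phi0.
transitivity (\int[m1]_y phi y).
  transitivity (\int[leb]_y (phi y * (d1 y)%:E)); last by rewrite ge0_integral_density.
  rewrite [LHS]integral_mkcond; apply: eq_integral => y _.
  by rewrite patchE /d1 indicE; case: ifPn; rewrite ?mule1 ?mule0.
transitivity (\int[m2]_y phi y).
  by apply: eq_measure_integral => A mA _; exact: m12.
rewrite /m2 (ge0_integral_pushforward mFc _ measurableT mphi (fun t _ => phi0 t)).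
transitivity (\int[leb]_x (phi (Fc x) * (d2 x)%:E)).
  have mcomp : measurable_fun [set: R] (phi \o Fc) by exact: measurableT_comp.
  exact: (ge0_integral_density leb md2 d20 mcomp (fun x => phi0 (Fc x))).
rewrite [RHS]integral_mkcond; apply: eq_integral => x _.
rewrite patchE /d2 indicE /fc/= /Fc/=; case: ifPn => xab; rewrite ?mulr0 ?mule0// mulr1.
by rewrite clamp_id//; rewrite inE in xab.
Qed.

End substitution_compact.

Definition open_itv (R : realType) (i : interval R) : bool :=
  let: Interval l u := i in
  (if l is BSide b _ then ~~ b else true) && (if u is BSide b _ then b else true).

Section substitution.
Variable R : realType.
Local Notation leb := (@lebesgue_measure R).

(** Together with [upper_exhaustion], an open interval is the increasing union of
    compact intervals. *)
Lemma lower_exhaustion (i : interval R) (x0 : R) : open_itv i -> x0 \in i ->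
  exists c : nat -> R, [/\ forall n, c n \in i /\ c n < x0,
    forall m n, (m <= n)%N -> c n <= c m & forall x, x \in i -> exists n, c n <= x].
Proof.
case: i => [l [[] u | []]] //; case: l => [[] l | []] //= _;
  rewrite in_itv/= ?andbT.
- move=> /andP[lx xu]; exists (fun n => l + (x0 - l) / n.+2%:R); split.
  + move=> n; have h : 0 < (x0 - l) / n.+2%:R by rewrite divr_gt0 ?subr_gt0.
    have h2 : (x0 - l) / n.+2%:R < x0 - l.
      by rewrite ltr_pdivrMr// ltr_pMr ?subr_gt0// ltr1n.
    move: (_ / _) h h2 => e h h2; split; last lra.
    by rewrite in_itv/= ?andbT; try (apply/andP; split); lra.
  + move=> m n mn; rewrite lerD2l ler_pM2l ?subr_gt0// lef_pV2 ?posrE// ler_nat.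
    by rewrite !ltnS.
  + move=> x; rewrite in_itv/= => /andP[lx' _].
    exists (Num.truncn ((x0 - l) / (x - l))).
    rewrite -lerBrDl ler_pdivrMr// mulrC -ler_pdivrMr ?subr_gt0//.
    by apply/ltW/(lt_le_trans (truncnS_gt _)); rewrite ler_nat.
- move=> xu; exists (fun n => x0 - n.+1%:R); split.
  + move=> n; have h : 0 < n.+1%:R :> R by [].
    split; last lra.
    by rewrite in_itv/=; lra.
  + by move=> m n mn; rewrite lerD2l lerN2 ler_nat.
  + move=> x _; exists (Num.truncn (x0 - x)); rewrite lerBlDr -lerBlDl.
    exact/ltW/truncnS_gt.
- by rewrite andbF.
- move=> lx; exists (fun n => l + (x0 - l) / n.+2%:R); split.
  + move=> n; have h : 0 < (x0 - l) / n.+2%:R by rewrite divr_gt0 ?subr_gt0.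
    have h2 : (x0 - l) / n.+2%:R < x0 - l.
      by rewrite ltr_pdivrMr// ltr_pMr ?subr_gt0// ltr1n.
    move: (_ / _) h h2 => e h h2; split; last lra.
    by rewrite in_itv/= ?andbT; try (apply/andP; split); lra.
  + move=> m n mn; rewrite lerD2l ler_pM2l ?subr_gt0// lef_pV2 ?posrE// ler_nat.
    by rewrite !ltnS.
  + move=> x; rewrite in_itv/= andbT => lx'.
    exists (Num.truncn ((x0 - l) / (x - l))).
    rewrite -lerBrDl ler_pdivrMr// mulrC -ler_pdivrMr ?subr_gt0//.
    by apply/ltW/(lt_le_trans (truncnS_gt _)); rewrite ler_nat.
- move=> _; exists (fun n => x0 - n.+1%:R); split.
  + move=> n; have h : 0 < n.+1%:R :> R by [].
    split; last lra.
    by rewrite in_itv/=; lra.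
  + by move=> m n mn; rewrite lerD2l lerN2 ler_nat.
  + move=> x _; exists (Num.truncn (x0 - x)); rewrite lerBlDr -lerBlDl.
    exact/ltW/truncnS_gt.
Qed.

Definition itv_opp (i : interval R) : interval R :=
  let: Interval l u := i in
  let neg b := match b with BSide c x => BSide (~~ c) (- x) | BInfty c => BInfty R (~~ c) end in
  Interval (neg u) (neg l).

Lemma mem_itv_opp i x : (x \in itv_opp i) = (- x \in i).
Proof.
case: i => [[[] l | []] [[] u | []]]; rewrite /= !in_itv/= ?andbT ?andbF //;
  (apply/idP/idP => [/andP[? ?]|/andP[? ?]]; apply/andP; split; lra) ||
  (apply/idP/idP => ?; lra).
Qed.

Lemma open_itv_opp i : open_itv i -> open_itv (itv_opp i).
Proof. by case: i => [[[] l | []] [[] u | []]]. Qed.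

Lemma upper_exhaustion (i : interval R) (x0 : R) : open_itv i -> x0 \in i ->
  exists d : nat -> R, [/\ forall n, d n \in i /\ x0 < d n,
    forall m n, (m <= n)%N -> d m <= d n & forall x, x \in i -> exists n, x <= d n].
Proof.
move=> oi xi; have [|c [c1 c2 c3]] := lower_exhaustion (open_itv_opp oi) (x0 := - x0).
  by rewrite mem_itv_opp opprK.
exists (fun n => - c n); split.
- by move=> n; have [+ cx] := c1 n; rewrite mem_itv_opp ltrNr.
- by move=> m n mn; rewrite lerN2; exact: c2.
- move=> x xi'; have [|n cn] := c3 (- x); first by rewrite mem_itv_opp opprK.
  by exists n; rewrite lerNr.
Qed.

Local Open Scope ereal_scope.

(** Monotone convergence along an exhaustion by compact intervals. *)
Lemma ge0_integral_substitution_incr (i : interval R) (J : set R) (F f : R -> R)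
    (phi : R -> \bar R) :
  open_itv i -> J = F @` [set` i] ->
  (forall x, x \in i -> is_derive x 1%R F (f x)) ->
  (forall x, x \in i -> {for x, continuous f}) ->
  (forall x, x \in i -> 0 < f x)%R ->
  measurable_fun [set: R] phi -> (forall y, 0 <= phi y) ->
  \int[leb]_(y in J) phi y = \int[leb]_(x in [set` i]) (phi (F x) * (f x)%:E).
Proof.
move=> oi JE dF cf f0 mphi phi0.
have [i0|/set0P[x0 /= xi]] := eqVneq [set` i] set0.
  by rewrite JE i0 image_set0 !integral_set0.
have [c [c1 c2 c3]] := lower_exhaustion oi xi.
have [d [d1 d2 d3]] := upper_exhaustion oi xi.
have sub n x : x \in `[c n, d n] -> x \in i.
  rewrite in_itv/= => /andP[cx xd]; have [ci _] := c1 n; have [di _] := d1 n.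
  have := @interval_is_interval R i (c n) (d n); apply => //.
  by rewrite cx.
have cd n : (c n < d n)%R by have [_ /lt_trans] := c1 n; apply; have [] := d1 n.
have cF x : x \in i -> {for x, continuous F}.
  move=> xi'; apply: differentiable_continuous; apply/derivable1_diffP.
  by have := dF _ xi' => -[].
have F_lt x y : x \in i -> y \in i -> (x < y)%R -> (F x < F y)%R.
  move=> xi' yi xy.
  have sub' z : z \in `[x, y] -> z \in i.
    rewrite in_itv/= => /andP[xz zy].
    by have := @interval_is_interval R i x y; apply => //; rewrite xz.
  apply: (@gtr0_derive1_incr R F x y) => //.
  - by move=> z /subset_itv_oo_cc/sub' zab; have := dF _ zab => -[].
  - by move=> z /subset_itv_oo_cc/sub' zab;
      rewrite derive1E (@derive_val _ _ _ _ _ _ _ (dF _ zab)) f0.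
  - by apply: continuous_in_subspaceT => z; rewrite inE => /sub'/cF.
have F_le x y : x \in i -> y \in i -> (x <= y)%R -> (F x <= F y)%R.
  by move=> xi' yi; rewrite le_eqVlt => /predU1P[->//|xy]; exact/ltW/F_lt.
have ci n : c n \in i by have [] := c1 n.
have di n : d n \in i by have [] := d1 n.
have iE : [set` i] = \bigcup_n `[c n, d n]%classic.
  apply/seteqP; split => x /=.
    move=> xi'; have [n cx] := c3 _ xi'; have [m xd] := d3 _ xi'.
    exists (maxn n m) => //=; rewrite in_itv/=; apply/andP; split.
      by apply: le_trans cx; apply: c2; exact: leq_maxl.
    by apply: (le_trans xd); apply: d2; exact: leq_maxr.
  by move=> [n _] /=; exact: sub.
have JE' : J = \bigcup_n `[F (c n), F (d n)]%classic.
  rewrite JE; apply/seteqP; split => y /=.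
    move=> [x /= xi' <-].
    have : [set` i] x by [].
    rewrite iE => -[n _ /= xcd]; exists n => //=; rewrite in_itv/=.
    have xin := sub _ _ xcd; move: xcd; rewrite in_itv/= => /andP[cx xd].
    by rewrite !F_le.
  move=> [n _] /= ycd.
  have [x xcd <-] : exists2 x, x \in `[c n, d n] & F x = y.
    apply: IVT; first exact: ltW.
      by apply: continuous_in_subspaceT => z; rewrite inE => /sub/cF.
    have FF : (F (c n) <= F (d n))%R by apply: F_le => //; exact: ltW.
    by rewrite (min_l FF) (max_r FF).
  by exists x => //; exact: sub xcd.
have mphiF : measurable_fun [set` i] (fun x => phi (F x) * (f x)%:E).
  have mi : measurable [set` i] by exact: measurable_itv.
  rewrite iE; apply/measurable_fun_bigcup => [n|n]; first exact: measurable_itv.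
  apply: emeasurable_funM.
    apply: measurableT_comp => //.
    apply: subspace_continuous_measurable_fun => //.
    by apply: continuous_in_subspaceT => z; rewrite inE => /sub/cF.
  apply/measurable_EFinP; apply: subspace_continuous_measurable_fun => //.
  by apply: continuous_in_subspaceT => z; rewrite inE => /sub/cf.
have phiF0 x : x \in i -> 0 <= phi (F x) * (f x)%:E.
  by move=> xi'; rewrite mule_ge0// lee_fin ltW// f0.
have step n : \int[leb]_(y in `[F (c n), F (d n)]) phi y =
   \int[leb]_(x in `[c n, d n]) (phi (F x) * (f x)%:E).
  exact: (@ge0_integral_substitution_cc R F f (c n) (d n) (cd n)
    (fun x h => dF _ (sub n x h)) (fun x h => cf _ (sub n x h))
    (fun x h => f0 _ (sub n x h)) phi mphi phi0).
have cvg1 : \int[leb]_(y in `[F (c n), F (d n)]) phi y @[n --> \oo] -->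
    \int[leb]_(y in J) phi y.
  rewrite JE'; apply: ge0_nondecreasing_set_cvg_integral => //.
  - move=> m n mn; apply/subsetPset => y /=; rewrite !in_itv/= => /andP[cy yd].
    rewrite (le_trans _ cy) ?(le_trans yd)// F_le//; [exact: d2|exact: c2].
  - by move=> n; exact: measurable_funTS.
have cvg2 : \int[leb]_(y in `[F (c n), F (d n)]) phi y @[n --> \oo] -->
    \int[leb]_(x in [set` i]) (phi (F x) * (f x)%:E).
  rewrite (_ : (fun n => _) = (fun n => \int[leb]_(x in `[c n, d n]) (phi (F x) * (f x)%:E))); last first.
    by apply/funext => n; exact: step.
  rewrite iE; apply: ge0_nondecreasing_set_cvg_integral => //.
  - move=> m n mn; apply/subsetPset => y /=; rewrite !in_itv/= => /andP[cy yd].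
    rewrite (le_trans _ cy) ?(le_trans yd)//; [exact: d2|exact: c2].
  - by move=> n; apply: measurable_funS mphiF => // x /sub.
  - by move=> n x /sub/phiF0.
by rewrite -(cvg_lim _ cvg1)// (cvg_lim _ cvg2).
Qed.

(** Compose the increasing case with a reflection. *)
Lemma ge0_integral_substitution_decr (i : interval R) (J : set R) (F f : R -> R)
    (phi : R -> \bar R) :
  open_itv i -> J = F @` [set` i] ->
  (forall x, x \in i -> is_derive x 1%R F (- f x)%R) ->
  (forall x, x \in i -> {for x, continuous f}) ->
  (forall x, x \in i -> 0 < f x)%R -> measurable J ->
  measurable_fun [set: R] phi -> (forall y, 0 <= phi y) ->
  \int[leb]_(y in J) phi y = \int[leb]_(x in [set` i]) (phi (F x) * (f x)%:E).
Proof.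
move=> oi JE dF cf f0 mJ mphi phi0.
have mphiN : measurable_fun [set: R] (fun y => phi (- y)%R) by exact: measurableT_comp.
transitivity (\int[leb]_(y in -%R @` J) phi (- y)%R).
  rewrite integral_mkcond [RHS]integral_mkcond.
  rewrite -ge0_integral_reflect//; last 2 first.
  - exact/(measurable_restrictT _ mJ)/measurable_funTS.
  - by move=> y; apply: erestrict_ge0.
  apply: eq_integral => y _; rewrite !patchE.
  congr (if _ then _ else _); apply/idP/idP; rewrite !inE.
    by move=> Jy; exists (- y)%R => //; rewrite opprK.
  by move=> [z Jz <-]; rewrite opprK.
have dFN x : x \in i -> is_derive x 1%R (fun x => - F x)%R (f x).
  by move=> xi; rewrite -[f x]opprK; apply: is_deriveN; exact: dF.
have JN : -%R @` J = (fun x => - F x)%R @` [set` i] by rewrite JE image_comp.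
rewrite (ge0_integral_substitution_incr oi JN dFN cf f0 mphiN (fun y => phi0 _)).
by apply: eq_integral => x _; rewrite opprK.
Qed.

End substitution.

(** * Tuples, and the change of variable in one pole or one residue *)
Section measurability_tools.
Context d (T : measurableType d) (R : realType).

(** Since 1/x = x (x^2)^(-1), with the value 0 at x = 0 on both sides, inversion is
    measurable because real powers are. *)
Lemma measurable_fun_inv (f : T -> R) :
  measurable_fun [set: T] f -> measurable_fun [set: T] (fun x => (f x)^-1).
Proof.
move=> mf; rewrite (_ : (fun x => _) = fun x => f x * ((f x ^+ 2) `^ (-1))).
  apply: measurable_funM => //; apply: (measurableT_comp (measurable_powR _)).
  exact: measurable_funX.
apply/funext => x; rewrite powR_inv1 ?sqr_ge0//.
by have [->|fx0] := eqVneq (f x) 0; rewrite ?invr0 ?mul0r// expr2 invfM mulrA divff// mul1r.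
Qed.

Lemma measurable_mktuple n (f : 'I_n -> T -> R) :
  (forall i, measurable_fun [set: T] (f i)) ->
  measurable_fun [set: T] (fun x => [tuple f i x | i < n]).
Proof.
move=> mf; apply/measurable_fun_tnthP => i.
by rewrite (_ : _ \o _ = f i)//; apply/funext => x /=; rewrite tnth_mktuple.
Qed.

Lemma measurable_fun_tnth n (g : T -> n.-tuple R) i :
  measurable_fun [set: T] g -> measurable_fun [set: T] (fun x => tnth (g x) i).
Proof. by move=> mg; apply: (measurableT_comp (measurable_tnth i)). Qed.

Lemma measurable_ler_indic (f g : T -> R) :
  measurable_fun [set: T] f -> measurable_fun [set: T] g ->
  measurable_fun [set: T] (fun x => (f x <= g x)%R%:R : R).
Proof.
move=> mf mg; rewrite (_ : (fun x => _) = fun x => if f x <= g x then 1 else 0).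
  by apply: measurable_fun_ifT => //; exact: measurable_fun_ler.
by apply/funext => x; case: ifP.
Qed.

Lemma measurable_ltr_indic (f g : T -> R) :
  measurable_fun [set: T] f -> measurable_fun [set: T] g ->
  measurable_fun [set: T] (fun x => (f x < g x)%R%:R : R).
Proof.
move=> mf mg; rewrite (_ : (fun x => _) = fun x => if f x < g x then 1 else 0).
  by apply: measurable_fun_ifT => //; exact: measurable_fun_ltr.
by apply/funext => x; case: ifP.
Qed.

End measurability_tools.

(** Turns the indicator of a finite conjunction into a product, hence into a
    measurable function when each conjunct is measurable. *)
Lemma forall_natmul (R : comNzRingType) (I : finType) (P : pred I) :
  [forall i, P i]%:R = \prod_(i : I) (P i)%:R :> R.
Proof.
case: (boolP [forall i, P i]) => [/forallP h|].
  by rewrite big1// => i _; rewrite h.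
rewrite negb_forall => /existsP[i /negbTE Pi].
by rewrite (bigD1 i)//= Pi mul0r.
Qed.

Section resolvent.
Variables (R : realType) (n : nat) (mu t : 'I_n -> R).

Lemma is_derive_resolvent (l : R) : (forall i, l != mu i) ->
  is_derive l 1 (fun x => \sum_(i < n) t i / (x - mu i))
    (- (\sum_(i < n) t i / (l - mu i) ^+ 2)).
Proof.
move=> lmu.
rewrite (_ : (fun x => _) = \sum_(i < n) (fun x => t i / (x - mu i))); last first.
  by apply/funext => x; rewrite fct_sumE.
rewrite -sumrN; apply: is_derive_sum => i.
have h : l - mu i != 0 by rewrite subr_eq0.
have d1 : is_derive l 1 (fun x => x - mu i) 1.
  by rewrite -[X in is_derive _ _ _ X]subr0; apply: is_deriveB.
have dV := is_deriveZ (t i) (is_deriveV (f := fun x : R => x - mu i) h d1).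
by apply: (is_derive_eq dV); rewrite /GRing.scale/= mulr1 mulrN.
Qed.

Lemma continuous_resolvent k (l : R) : (forall i, l != mu i) ->
  {for l, continuous (fun x => \sum_(i < n) t i / (x - mu i) ^+ k)}.
Proof.
move=> lmu.
rewrite (_ : (fun x => _) = \sum_(i < n) (fun x : R => t i / (x - mu i) ^+ k)); last first.
  by apply/funext => x; rewrite fct_sumE.
elim/big_ind: _ => [|f g cf cg|i _]; first exact: cvg_cst.
  exact: (continuousD cf cg).
apply: cvgM; first exact: cvg_cst.
apply: cvgV; first by rewrite expf_neq0// subr_eq0.
have cB : {for l, continuous (fun x : R => x - mu i)}.
  by apply: cvgB; [exact: cvg_id|exact: cvg_cst].
exact: (continuous_comp cB (@exprn_continuous R k (l - mu i))).
Qed.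

End resolvent.

Section tuple_helpers.
Variable R : realType.

Definition tbehead n (t : n.+1.-tuple R) : n.-tuple R := [tuple of behead t].

Lemma tbehead_tcons n (p : R * n.-tuple R) : tbehead (tcons p) = p.2.
Proof. exact: val_inj. Qed.

Lemma thead_tcons n (p : R * n.-tuple R) : thead (tcons p) = p.1.
Proof. by rewrite /thead tnth_tcons0. Qed.

Lemma tcons_head_behead n (t : n.+1.-tuple R) : t = tcons (thead t, tbehead t).
Proof. exact: tcons_eta. Qed.

Definition head_le n (mu : n.-tuple R) (x : R) : bool :=
  if tval mu is m :: _ then m <= x else true.
Definition head_lt n (mu : n.-tuple R) (x : R) : bool :=
  if tval mu is m :: _ then m < x else true.

Lemma head_lt_tcons n (p : R * n.-tuple R) x : head_lt (tcons p) x = (p.1 < x).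
Proof. by []. Qed.
Lemma head_le_tcons n (p : R * n.-tuple R) x : head_le (tcons p) x = (p.1 <= x).
Proof. by []. Qed.

Definition sdecr n (mu : n.-tuple R) : bool := sorted >%R mu.

Lemma sdecr_tcons n (p : R * n.-tuple R) : sdecr (tcons p) = head_lt p.2 p.1 && sdecr p.2.
Proof. by case: p => m; case=> -[|m' s] i //=. Qed.

Lemma head_lt_all n (mu : n.-tuple R) x : sdecr mu -> head_lt mu x -> forall i, tnth mu i < x.
Proof.
case: n mu => [mu _ _ []//|n mu].
rewrite (tcons_head_behead mu); move: (thead mu) (tbehead mu) => m mu'.
rewrite head_lt_tcons => /= so mx i; rewrite (tnth_nth 0) /=.
have : path >%R x (m :: mu') by rewrite /= mx.
move=> /order_path_min-/(_ _)/allP; apply; first by move=> a b c /= ab bc; exact: lt_trans bc ab.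
by apply: mem_nth => /=; rewrite size_tuple.
Qed.

Lemma head_lt_le n (mu : n.-tuple R) x y : head_lt mu x -> x <= y -> head_lt mu y.
Proof. by rewrite /head_lt; case: (tval mu) => // m _; exact: lt_le_trans. Qed.

Definition tpos n (t : n.-tuple R) : bool := [forall i, 0 < tnth t i].

Lemma tpos_tcons n (p : R * n.-tuple R) : tpos (tcons p) = (0 < p.1) && tpos p.2.
Proof.
apply/forallP/andP => [h|[h1 /forallP h2] i].
  split; first by have := h ord0; rewrite tnth_tcons0.
  by apply/forallP => i; have := h (lift ord0 i); rewrite tnth_tconsS.
by case: (unliftP ord0 i) => [j|] ->; rewrite ?tnth_tconsS ?tnth_tcons0.
Qed.

Lemma measurable_tpos n : measurable_fun [set: n.-tuple R] (fun t => (tpos t)%:R : R).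
Proof.
under eq_fun do rewrite forall_natmul.
apply: measurable_prod => i _; apply: measurable_ltr_indic => //.
exact: measurable_tnth.
Qed.

End tuple_helpers.

Section one_step.
Variables (R : realType) (n : nat) (mu t : n.-tuple R).
Hypothesis smu : sdecr mu.
Hypothesis tp : tpos t.
Local Notation leb := (@lebesgue_measure R).

Let lo : itv_bound R := if tval mu is m :: _ then BRight m else -oo%O.

Let mem_lo u x : (x \in Interval lo u) = head_lt mu x && (BRight x <= u)%O.
Proof. by rewrite /lo /head_lt; case: (tval mu). Qed.

Let t_gt0 i : 0 < tnth t i. Proof. exact: (forallP tp). Qed.

Let mu_neq x : head_lt mu x -> forall i, x != tnth mu i.
Proof. by move=> mx i; rewrite gt_eqF// head_lt_all. Qed.

(** The residue r at an additional pole m for which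
    1 + sum_i t_i / (z - mu_i) + r / (z - m) vanishes at z = l. *)
Definition residue_of_root (m l : R) : R :=
  (m - l) * (1 + \sum_i tnth t i / (l - tnth mu i)).

Definition residue_of_root_slope (m l : R) : R :=
  1 + \sum_i tnth t i * (m - tnth mu i) / (l - tnth mu i) ^+ 2.

(** The value of x for which z - x - sum_i t_i / (z - mu_i) vanishes at l. *)
Definition pole_of_root (l : R) : R := l - \sum_i tnth t i / (l - tnth mu i).

Definition pole_of_root_slope (l : R) : R := 1 + \sum_i tnth t i / (l - tnth mu i) ^+ 2.

Let derive_residue m l : head_lt mu l ->
  is_derive l 1 (residue_of_root m) (- residue_of_root_slope m l).
Proof.
move=> mul; have dr := @is_derive_resolvent _ _ _ (tnth t) _ (mu_neq mul).
have d1 : is_derive l 1 (fun x => m - x) (- 1).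
  by rewrite -[X in is_derive _ _ _ X]add0r; apply: is_deriveB.
have d2 : is_derive l 1 (fun x => 1 + \sum_(i < n) tnth t i / (x - tnth mu i))
   (0 + - (\sum_(i < n) tnth t i / (l - tnth mu i) ^+ 2)).
  exact: is_deriveD.
have d3 := is_deriveM d1 d2.
apply: (is_derive_eq d3); rewrite /GRing.scale/= add0r.
rewrite /residue_of_root_slope mulrN mulrN1 -opprD; congr (- _).
rewrite addrCA; congr (_ + _); rewrite mulr_sumr -big_split/=.
apply: eq_bigr => i _.
have h : l - tnth mu i != 0 by rewrite subr_eq0 mu_neq.
by field.
Qed.

Let derive_pole l : head_lt mu l ->
  is_derive l 1 pole_of_root (pole_of_root_slope l).
Proof.
move=> mul; have dr := @is_derive_resolvent _ _ _ (tnth t) _ (mu_neq mul).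
by apply: (is_derive_eq (is_deriveB (is_derive_id l 1) dr)); rewrite opprK.
Qed.

Let slope_pole_gt0 l : 0 < pole_of_root_slope l.
Proof.
by rewrite ltr_pwDl// sumr_ge0// => i _; rewrite divr_ge0 ?sqr_ge0// ltW.
Qed.

Let slope_residue_gt0 m l : head_lt mu m -> 0 < residue_of_root_slope m l.
Proof.
move=> mum; rewrite ltr_pwDl// sumr_ge0// => i _.
by rewrite divr_ge0 ?sqr_ge0// mulr_ge0 ?ltW// subr_gt0 head_lt_all.
Qed.

Let resolvent_ge0 l : head_lt mu l -> 0 <= \sum_i tnth t i / (l - tnth mu i).
Proof.
by move=> mul; apply: sumr_ge0 => i _; rewrite divr_ge0 ?ltW// subr_gt0 head_lt_all.
Qed.

Let cont_slope_pole l : head_lt mu l -> {for l, continuous pole_of_root_slope}.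
Proof.
move=> mul; have := @continuous_resolvent _ _ _ (tnth t) 2 _ (mu_neq mul).
exact: (continuousD (@cst_continuous _ _ (1 : R) _)).
Qed.

Let cont_slope_residue m l : head_lt mu l -> {for l, continuous (residue_of_root_slope m)}.
Proof.
move=> mul.
have := @continuous_resolvent _ _ _ (fun i => tnth t i * (m - tnth mu i)) 2 _ (mu_neq mul).
exact: (continuousD (@cst_continuous _ _ (1 : R) _)).
Qed.

Let cont_of_derive (F : R -> R) (df l : R) : is_derive l 1 F df -> {for l, continuous F}.
Proof.
by move=> [dF _]; apply: differentiable_continuous; apply/derivable1_diffP.
Qed.

(** On the interval from the largest mu_i to m the residue decreases from +oo to 0.
    When mu is empty the interval is unbounded below and the residue is m - l.
    Otherwise the explicit l0 close to the largest mu_i already makes the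
    term of that pole exceed r. *)
Let residue_image m : head_lt mu m ->
  `]0, +oo[%classic = residue_of_root m @` [set` Interval lo (BLeft m)].
Proof.
move=> mum; apply/seteqP; split => r /=; last first.
  move=> [l]; rewrite mem_lo => /andP[mul lm] <-; rewrite in_itv/= andbT.
  by rewrite mulr_gt0 ?subr_gt0// ltr_pwDl// resolvent_ge0.
rewrite in_itv/= andbT => r0.
suff [l0 [mul0 l0m l0r]] : exists l0, [/\ head_lt mu l0, l0 < m & r <= residue_of_root m l0].
  have sub z : z \in `[l0, m] -> head_lt mu z.
    by rewrite in_itv/= => /andP[lz _]; exact: head_lt_le mul0 lz.
  have Fm : residue_of_root m m = 0 by rewrite /residue_of_root subrr mul0r.
  have [z zl Fz] : exists2 z, z \in `[l0, m] & residue_of_root m z = r.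
    apply: IVT; first exact: ltW.
      apply: continuous_in_subspaceT => z; rewrite inE => /sub zmu.
      exact: cont_of_derive (derive_residue m zmu).
    by rewrite Fm ge_min le_max l0r (ltW r0) orbT.
  exists z => //; rewrite mem_lo (sub _ zl)/=.
  move: zl; rewrite in_itv/= => /andP[_]; rewrite le_eqVlt => /predU1P[zm|//].
  by move: r0; rewrite -Fz zm Fm ltxx.
rewrite /head_lt; case E : (tval mu) => [|m1 s].
  exists (m - r); split => //; first by rewrite ltrBlDr ltrDl.
  rewrite /residue_of_root opprB addrCA subrr addr0.
  by apply: ler_peMr; [exact: ltW|rewrite lerDl resolvent_ge0// /head_lt E].
have m1m : m1 < m by move: mum; rewrite /head_lt E.
have n0 : (0 < n)%N by rewrite -(size_tuple mu) E.
have mu0 : tnth mu (Ordinal n0) = m1 by rewrite (tnth_nth 0) E.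
set t1 := tnth t (Ordinal n0); have t10 : 0 < t1 by exact: t_gt0.
(* chosen so that the term of the first pole alone equals r at m1 + d *)
pose d := (m - m1) * t1 / (r + t1).
have rt : 0 < r + t1 by rewrite addr_gt0.
have d0 : 0 < d by rewrite divr_gt0// mulr_gt0// subr_gt0.
have dm : d < m - m1.
  by rewrite /d -mulrA gtr_pMr ?subr_gt0// ltr_pdivrMr// mul1r ltrDr.
exists (m1 + d); split; rewrite ?ltrDl//; first by rewrite -ltrBrDl.
have mul : head_lt mu (m1 + d) by rewrite /head_lt E ltrDl.
rewrite /residue_of_root (bigD1 (Ordinal n0))//= -/t1 mu0 addrAC subrr add0r.
have -> : r = (m - (m1 + d)) * (t1 / d).
  by rewrite /d; field; rewrite !gt_eqF ?subr_gt0.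
rewrite ler_pM2l; last by rewrite subr_gt0 -ltrBrDl.
rewrite addrCA lerDl addr_ge0// sumr_ge0// => i _.
by rewrite divr_ge0 ?ltW// subr_gt0 head_lt_all.
Qed.

(** To the right of the largest mu_i the pole increases from -oo to +oo; the two
    points a and b bracket any given value x. *)
Let pole_image : [set: R] = pole_of_root @` [set` Interval lo +oo%O].
Proof.
apply/seteqP; split => // x _ /=.
suff [a [b [mua ab ax xb]]] : exists a b, [/\ head_lt mu a, a <= b,
    pole_of_root a <= x & x <= pole_of_root b].
  have sub z : z \in `[a, b] -> head_lt mu z.
    by rewrite in_itv/= => /andP[lz _]; exact: head_lt_le mua lz.
  have [z zl Fz] : exists2 z, z \in `[a, b] & pole_of_root z = x.
    apply: IVT => //.
      apply: continuous_in_subspaceT => z; rewrite inE => /sub zmu.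
      exact: cont_of_derive (derive_pole zmu).
    by rewrite ge_min le_max ax xb orbT.
  by exists z => //; rewrite mem_lo (sub _ zl).
rewrite /head_lt; case E : (tval mu) => [|m1 s].
  have n0 : n = 0%N by rewrite -(size_tuple mu) E.
  exists x, x; split => //; rewrite /pole_of_root big1 ?subr0// => i _;
  by exfalso; have := ltn_ord i; rewrite [X in (_ < X)%N]n0.
have n0 : (0 < n)%N by rewrite -(size_tuple mu) E.
have mu0 : tnth mu (Ordinal n0) = m1 by rewrite (tnth_nth 0) E.
set t1 := tnth t (Ordinal n0); have t10 : 0 < t1 by exact: t_gt0.
set S := \sum_i tnth t i.
have S0 : 0 <= S by apply: sumr_ge0 => i _; exact/ltW.
have hx : 0 < 1 + `|x - m1| by rewrite ltr_pwDl.
(* the term of the first pole is at least 1 + |x - m1| at m1 + d *)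
pose d := Num.min 1 (t1 / (1 + `|x - m1|)).
have d0 : 0 < d by rewrite lt_min ltr01 divr_gt0.
have d1 : d <= 1 by rewrite ge_min lexx.
have d2 : 1 + `|x - m1| <= t1 / d.
  by rewrite ler_pdivlMr// mulrC -ler_pdivlMr// ge_min lexx orbT.
exists (m1 + d), (m1 + (1 + S + `|x - m1|)); split.
- by rewrite ltrDl.
- rewrite lerD2l; apply: (le_trans d1).
  by rewrite -addrA lerDl addr_ge0.
- have mul : head_lt mu (m1 + d) by rewrite /head_lt E ltrDl.
  rewrite /pole_of_root (bigD1 (Ordinal n0))//= -/t1 mu0.
  have -> : m1 + d - m1 = d by rewrite addrAC subrr add0r.
  have h : 0 <= \sum_(i < n | i != Ordinal n0) tnth t i / (m1 + d - tnth mu i).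
    by apply: sumr_ge0 => i _; rewrite divr_ge0 ?ltW// subr_gt0 head_lt_all.
  have := ler_norm (m1 - x); rewrite distrC => h2.
  move: (\sum_(i < n | _) _) h => s' h; move: (t1 / d) d2 => td d2; lra.
- set l := m1 + _.
  have lm1 : 1 <= l - m1 by rewrite /l addrAC subrr add0r -addrA lerDl addr_ge0.
  have h : \sum_i tnth t i / (l - tnth mu i) <= S.
    apply: ler_sum => i _; rewrite ler_pdivrMr; last first.
      rewrite subr_gt0 head_lt_all// /head_lt E -subr_gt0; exact: lt_le_trans lm1.
    apply: ler_peMr; first exact: ltW.
    apply: (le_trans lm1); rewrite lerD2l lerN2.
    have [<-|i0] := eqVneq (Ordinal n0) i; first by rewrite mu0.
    have mu_i : tval mu = m1 :: s by [].
    have : sorted >%R (m1 :: s) by move: smu; rewrite /sdecr E.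
    move=> /= /order_path_min-/(_ _)/allP h; apply/ltW.
    have -> : tnth mu i = nth 0 s i.-1.
      rewrite (tnth_nth 0) E; move: i0; rewrite -val_eqE/=.
      by case: (val i).
    apply: h; first by move=> u v w /= uv vw; exact: lt_trans vw uv.
    apply: mem_nth; have := ltn_ord i; rewrite -[X in (_ < X)%N](size_tuple mu) E/=.
    by move: i0; rewrite -val_eqE/=; case: (val i).
  have := ler_norm (x - m1).
  rewrite /pole_of_root; move: (\sum_i _ / _) h => s' h h2.
  rewrite /l; move: `|_| h2 => q h2; lra.
Qed.

Local Open Scope ereal_scope.

Lemma integral_residue_of_root m (phi : R -> \bar R) : head_lt mu m ->
  measurable_fun [set: R] phi -> (forall y, 0 <= phi y) ->
  \int[leb]_r ((0 < r)%R%:R%:E * phi r) =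
  \int[leb]_l ((head_lt mu l && (l < m)%R)%:R%:E *
     (phi (residue_of_root m l) * (residue_of_root_slope m l)%:E)).
Proof.
move=> mum mphi phi0.
have oi : open_itv (Interval lo (BLeft m)) by rewrite /lo; case: (tval mu).
have hd l : l \in Interval lo (BLeft m) -> head_lt mu l.
  by rewrite mem_lo => /andP[].
have := @ge0_integral_substitution_decr R _ _ (residue_of_root m)
  (residue_of_root_slope m) phi oi (residue_image mum)
  (fun l h => derive_residue m (hd l h)) (fun l h => @cont_slope_residue m l (hd l h))
  (fun l h => @slope_residue_gt0 m l mum) (measurable_itv _) mphi phi0.
rewrite integral_mkcond [X in _ = X -> _]integral_mkcond => E.
transitivity (\int[leb]_x (phi \_ `]0%R, +oo[) x).
  apply: eq_integral => r _; rewrite patchE.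
  have -> : (r \in `]0%R, +oo[%classic) = (0 < r)%R.
    by apply/idP/idP; rewrite inE /= in_itv/= andbT.
  by case: ifP; rewrite ?mul1e ?mul0e.
rewrite E; apply: eq_integral => l _; rewrite patchE.
have -> : (l \in [set` Interval lo (BLeft m)]) = head_lt mu l && (l < m)%R.
  by apply/idP/idP; rewrite inE /= mem_lo.
by case: ifP; rewrite ?mul1e ?mul0e.
Qed.

Lemma integral_pole_of_root (phi : R -> \bar R) :
  measurable_fun [set: R] phi -> (forall y, 0 <= phi y) ->
  \int[leb]_x phi x =
  \int[leb]_l ((head_lt mu l)%:R%:E * (phi (pole_of_root l) * (pole_of_root_slope l)%:E)).
Proof.
move=> mphi phi0.
have oi : open_itv (Interval lo +oo%O) by rewrite /lo; case: (tval mu).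
have hd l : l \in Interval lo +oo%O -> head_lt mu l.
  by rewrite mem_lo => /andP[].
have E := @ge0_integral_substitution_incr R _ _ pole_of_root
  pole_of_root_slope phi oi pole_image
  (fun l h => derive_pole (hd l h)) (fun l h => cont_slope_pole (hd l h))
  (fun l h => slope_pole_gt0 l) mphi phi0.
rewrite E integral_mkcond; apply: eq_integral => l _; rewrite patchE.
have -> : (l \in [set` Interval lo +oo%O]) = head_lt mu l.
  by apply/idP/idP; rewrite inE /= mem_lo ?andbT//; move=> /andP[].
by case: ifP; rewrite ?mul1e ?mul0e.
Qed.

End one_step.

(** * From residues to interlacing roots *)
Section scaling.
Variable R : realType.
Local Notation leb := (@lebesgue_measure R).
Local Open Scope ereal_scope.

(** Used to pass between strict and weak inequalities, which differ at no more than
    two points in a single variable. *)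
Lemma eq_integral_off_pair (a b : R) (f g : R -> \bar R) :
  measurable_fun [set: R] f -> measurable_fun [set: R] g ->
  (forall x, 0 <= f x) -> (forall x, 0 <= g x) ->
  (forall x, x != a -> x != b -> f x = g x) ->
  \int[leb]_x f x = \int[leb]_x g x.
Proof.
move=> mf mg f0 g0 fg; apply: ge0_ae_eq_integral => //.
exists ([set a] `|` [set b]); split.
- by apply: measurableU; exact: measurable_set1.
- apply: countable_lebesgue_measure0.
  by apply: finite_set_countable; rewrite finite_setU; split; exact: finite_set1.
- move=> x /= h; have [->|xa] := eqVneq x a; first by left.
  have [->|xb] := eqVneq x b; first by right.
  by exfalso; apply: h => _; exact: fg.
Qed.

Lemma ge0_integral_scale (k : R) (f : R -> \bar R) : (0 < k)%R ->
  measurable_fun [set: R] f -> (forall r, 0 <= f r) ->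
  \int[leb]_x f x = k%:E * \int[leb]_x f (k * x)%R.
Proof.
move=> k0 mf f0.
have JE : [set: R] = (fun x => k * x)%R @` [set` (`]-oo, +oo[ : interval R)].
  apply/seteqP; split => // x _; exists (k^-1 * x)%R; first by rewrite /= in_itv.
  by rewrite mulrA divff ?mul1r// gt_eqF.
have dF x : x \in (`]-oo, +oo[ : interval R) -> is_derive x 1%R (fun x => k * x)%R k.
  move=> _; apply: (is_derive_eq (is_deriveZ k (is_derive_id x 1%R))).
  by rewrite /GRing.scale/= mulr1.
have oi : open_itv (`]-oo, +oo[ : interval R) by [].
rewrite (ge0_integral_substitution_incr oi JE dF (f := cst k) (fun x _ => @cst_continuous _ _ k x)
  (fun _ _ => k0) mf f0) set_itvE.
transitivity (\int[leb]_x (f (k * x)%R * k%:E)); first by [].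
rewrite ge0_integralZr//.
- by rewrite muleC.
- by apply: measurableT_comp => //; exact: measurable_funM.
- by rewrite lee_fin ltW.
Qed.

Definition tscale n (k s : n.-tuple R) : n.-tuple R := [tuple (tnth k i * tnth s i)%R | i < n].

Lemma tscale_tcons n p q : tscale (@tcons R n p) (tcons q) = tcons ((p.1 * q.1)%R, tscale p.2 q.2).
Proof.
apply: eq_from_tnth => i; rewrite tnth_mktuple; case: (unliftP ord0 i) => [j|] ->.
  by rewrite !tnth_tconsS/= tnth_mktuple.
by rewrite !tnth_tcons0.
Qed.

Lemma measurable_tscale n d (T : measurableType d) (f g : T -> n.-tuple R) :
  measurable_fun [set: T] f -> measurable_fun [set: T] g ->
  measurable_fun [set: T] (fun x => tscale (f x) (g x)).
Proof.
move=> mf mg; apply: measurable_mktuple => i.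
by apply: measurable_funM; exact: measurable_fun_tnth.
Qed.

Lemma integral_tscale n (k : n.-tuple R) (f : n.-tuple R -> \bar R) : tpos k ->
  measurable_fun [set: n.-tuple R] f -> (forall t, 0 <= f t) ->
  \int[lebesgue_tuple R n]_t f t =
  (\prod_i tnth k i)%:E * \int[lebesgue_tuple R n]_t f (tscale k t).
Proof.
elim: n k f => [|n IH] k f kp mf f0.
  rewrite big_ord0 mul1e; apply: eq_integral => t _.
  by rewrite (tuple0 (tscale k t)) (tuple0 t).
move: kp; rewrite (tcons_head_behead k); move: (thead k) (tbehead k) => k0 k'.
rewrite tpos_tcons => /andP[/= k0p kp'].
have mfk : measurable_fun [set: n.+1.-tuple R] (fun t => f (tscale (tcons (k0, k')) t)).
  by apply: measurableT_comp => //; exact: measurable_tscale.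
rewrite (integral_lebesgue_tupleS mfk (fun t => f0 _)) (integral_lebesgue_tupleS mf f0).
have mh : measurable_fun [set: R] (fun x => \int[lebesgue_tuple R n]_t f (tcons (x, t))).
  exact: measurable_integral_tcons.
have h0 x : 0 <= \int[lebesgue_tuple R n]_t f (tcons (x, t)) by apply: integral_ge0.
rewrite (ge0_integral_scale k0p mh h0) big_ord_recl tnth_tcons0/= EFinM -muleA.
congr (_ * _).
under [in RHS]eq_integral do (under eq_integral do rewrite tscale_tcons/=).
under [in RHS]eq_bigr do rewrite tnth_tconsS/=.
have kprod : (0 <= \prod_i tnth k' i)%R.
  by apply: prodr_ge0 => i _; apply/ltW; exact: (forallP kp').
rewrite -ge0_integralZl_EFin//.
- apply: eq_integral => x _.
  rewrite (IH k' (fun t => f (tcons ((k0 * x)%R, t))) kp')//.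
  exact: measurable_tcons_section.
- by move=> x _; apply: integral_ge0.
- have := @measurable_integral_tcons R n _ mfk (fun t => f0 _).
  by under eq_fun do (under eq_integral do rewrite tscale_tcons/=).
Qed.

End scaling.

Section interlacing_change_of_variables.
Variable R : realType.

Lemma sum_tcons2 n (f : R -> R -> R) (p q : R * n.-tuple R) :
  \sum_i f (tnth (tcons p) i) (tnth (tcons q) i) =
  f p.1 q.1 + \sum_i f (tnth p.2 i) (tnth q.2 i).
Proof.
rewrite big_ord_recl !tnth_tcons0; congr (_ + _).
by apply: eq_bigr => i _; rewrite !tnth_tconsS.
Qed.

Lemma sum_tcons n (f : R -> R) (p : R * n.-tuple R) :
  \sum_i f (tnth (tcons p) i) = f p.1 + \sum_i f (tnth p.2 i).
Proof. exact: (sum_tcons2 (fun x _ => f x)). Qed.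

Lemma prod_tcons n (f : R -> R) (p : R * n.-tuple R) :
  \prod_i f (tnth (tcons p) i) = f p.1 * \prod_i f (tnth p.2 i).
Proof.
rewrite big_ord_recl tnth_tcons0; congr (_ * _).
by apply: eq_bigr => i _; rewrite tnth_tconsS.
Qed.
Local Notation leb := (@lebesgue_measure R).

(** The residues r_i of prod_j (z - l_j) / prod_i (z - mu_i) at the poles mu_i, for
    sequences of equal length listed in decreasing order. They are computed by
    inserting the first pole and the first root into the function attached to the
    remaining ones, which is the form suited to integrating one variable at a
    time; [resid_partial_fractions] identifies them. *)
Fixpoint resid n : n.-tuple R -> n.-tuple R -> n.-tuple R :=
  match n with
  | 0 => fun _ _ => [tuple]
  | n'.+1 => fun mu l =>
    let r' := resid (tbehead mu) (tbehead l) in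
    tcons ((thead mu - thead l) * (1 + \sum_i tnth r' i / (thead mu - tnth (tbehead mu) i)),
      [tuple tnth r' i * ((thead l - tnth (tbehead mu) i) / (thead mu - tnth (tbehead mu) i))
         | i < n'])
  end.

(** Interlacing m_1 >= l_1 >= m_2 >= l_2 >= ... of sequences of equal length. *)
Fixpoint ilace n : n.-tuple R -> n.-tuple R -> bool :=
  match n with
  | 0 => fun _ _ => true
  | n'.+1 => fun mu l =>
    [&& thead l <= thead mu, head_le (tbehead mu) (thead l) & ilace (tbehead mu) (tbehead l)]
  end.

(** The quotient of the absolute Vandermonde products of l and mu ([jac_vdm]), in the
    recursive form that arises from the successive substitutions. *)
Fixpoint jac n : n.-tuple R -> n.-tuple R -> R :=
  match n with
  | 0 => fun _ _ => 1
  | n'.+1 => fun mu l =>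
    `|\prod_i (thead l - tnth (tbehead l) i)| / `|\prod_i (thead mu - tnth (tbehead mu) i)| *
    jac (tbehead mu) (tbehead l)
  end.

Lemma residS n m l0 (mu l : n.-tuple R) : resid (tcons (m, mu)) (tcons (l0, l)) =
  tcons ((m - l0) * (1 + \sum_i tnth (resid mu l) i / (m - tnth mu i)),
    tscale [tuple (l0 - tnth mu i) / (m - tnth mu i) | i < n] (resid mu l)).
Proof.
rewrite /= !thead_tcons !tbehead_tcons/=; congr (tcons (_, _)).
by apply: eq_from_tnth => i; rewrite !tnth_mktuple mulrC.
Qed.

Lemma ilaceS n m l0 (mu l : n.-tuple R) : ilace (tcons (m, mu)) (tcons (l0, l)) =
  [&& l0 <= m, head_le mu l0 & ilace mu l].
Proof. by rewrite /= !thead_tcons !tbehead_tcons/=. Qed.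

Lemma jacS n m l0 (mu l : n.-tuple R) : jac (tcons (m, mu)) (tcons (l0, l)) =
  `|\prod_i (l0 - tnth l i)| / `|\prod_i (m - tnth mu i)| * jac mu l.
Proof. by rewrite /= !thead_tcons !tbehead_tcons/=. Qed.

Lemma jac_ge0 n (mu l : n.-tuple R) : 0 <= jac mu l.
Proof. by elim: n mu l => [|n IH] mu l //=; rewrite mulr_ge0 ?divr_ge0. Qed.

Arguments resid : simpl never.
Arguments ilace : simpl never.
Arguments jac : simpl never.

(** Multiplying the expansion for the tails by (z - l0) / (z - m) changes the residue
    at mu_i by the factor (mu_i - l0) / (mu_i - m) and creates a residue at m; this
    is how resid is defined. *)
Lemma resid_partial_fractions n (mu l : n.-tuple R) z : sdecr mu ->
  (forall i, z != tnth mu i) ->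
  1 + \sum_i tnth (resid mu l) i / (z - tnth mu i) =
  \prod_i (z - tnth l i) / \prod_i (z - tnth mu i).
Proof.
elim: n mu l z => [|n IH] mu l z; first by rewrite !big_ord0 addr0 divr1.
rewrite (tcons_head_behead mu) (tcons_head_behead l).
move: (thead mu) (tbehead mu) (thead l) (tbehead l) => m mu' l0 l'.
rewrite sdecr_tcons => /andP[/= mum smu] zmu.
have zm : z - m != 0 by have := zmu ord0; rewrite tnth_tcons0 subr_eq0.
have zmu' i : z - tnth mu' i != 0.
  by have := zmu (lift ord0 i); rewrite tnth_tconsS subr_eq0.
have mmu i : m - tnth mu' i != 0 by rewrite subr_eq0 gt_eqF// head_lt_all.
rewrite residS (sum_tcons2 (fun x y => x / (z - y))) !(prod_tcons (fun x => z - x))/=.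
under [X in 1 + (_ + X)]eq_bigr do rewrite tnth_mktuple tnth_mktuple.
have E := IH mu' l' z smu (fun i => _ : z != tnth mu' i).
rewrite -mulf_div -E; last by move=> i; rewrite -subr_eq0.
rewrite mulrDr mulr1 mulr_sumr mulrDl mulr_suml.
rewrite -(addrA ((m - l0) / (z - m))) (addrA 1) -big_split/=.
rewrite [RHS]mulrDr mulr1 mulr_sumr; congr (_ + _); first by field.
apply: eq_bigr => i _.
by have := zmu' i; have := mmu i; move=> h1 h2; field; rewrite zm h1 h2.
Qed.

Lemma measurable_residue_of_root n d (T : measurableType d) (mu : n.-tuple R) m
    (f : T -> R) (g : T -> n.-tuple R) :
  measurable_fun [set: T] f -> measurable_fun [set: T] g ->
  measurable_fun [set: T] (fun x => residue_of_root mu (g x) m (f x)).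
Proof.
move=> mf mg; apply: measurable_funM; first exact: measurable_funB.
apply: measurable_funD => //; apply: measurable_sum => i.
apply: measurable_funM; first exact: measurable_fun_tnth.
by apply: measurable_fun_inv; exact: measurable_funB.
Qed.

Lemma measurable_residue_of_root_slope n d (T : measurableType d) (mu : n.-tuple R) m
    (f : T -> R) (g : T -> n.-tuple R) :
  measurable_fun [set: T] f -> measurable_fun [set: T] g ->
  measurable_fun [set: T] (fun x => residue_of_root_slope mu (g x) m (f x)).
Proof.
move=> mf mg; apply: measurable_funD => //; apply: measurable_sum => i.
apply: measurable_funM; first by apply: measurable_funM => //; exact: measurable_fun_tnth.
by apply: measurable_fun_inv; apply: measurable_funX; exact: measurable_funB.
Qed.

Lemma measurable_head_le_indic n d (T : measurableType d) (mu : n.-tuple R) (f : T -> R) :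
  measurable_fun [set: T] f -> measurable_fun [set: T] (fun x => (head_le mu (f x))%:R : R).
Proof.
by move=> mf; rewrite /head_le; case: (tval mu) => // m _; exact: measurable_ler_indic.
Qed.

Lemma measurable_head_lt_indic n d (T : measurableType d) (mu : n.-tuple R) (f : T -> R) :
  measurable_fun [set: T] f -> measurable_fun [set: T] (fun x => (head_lt mu (f x))%:R : R).
Proof.
by move=> mf; rewrite /head_lt; case: (tval mu) => // m _; exact: measurable_ltr_indic.
Qed.

Lemma measurable_thead n : measurable_fun [set: n.+1.-tuple R] (@thead n R).
Proof. exact: measurable_tnth. Qed.

Lemma measurable_tbehead n : measurable_fun [set: n.+1.-tuple R] (@tbehead R n).
Proof. exact: measurable_behead. Qed.

Lemma measurable_resid n (mu : n.-tuple R) : measurable_fun [set: n.-tuple R] (resid mu).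
Proof.
elim: n mu => [|n IH] mu; first exact: measurable_cst.
have m0 := @measurable_thead n.
have mr : measurable_fun [set: n.+1.-tuple R] (fun l => resid (tbehead mu) (tbehead l)).
  exact: (measurableT_comp (IH _) (@measurable_tbehead n)).
apply: measurable_tcons_pair.
  apply: measurable_funM; first exact: measurable_funB.
  apply: measurable_funD => //; apply: measurable_sum => i.
  by apply: measurable_funM => //; exact: measurable_fun_tnth.
apply: measurable_mktuple => i; apply: measurable_funM; first exact: measurable_fun_tnth.
by apply: measurable_funM => //; exact: measurable_funB.
Qed.

Lemma measurable_jac n (mu : n.-tuple R) : measurable_fun [set: n.-tuple R] (jac mu).
Proof.
elim: n mu => [|n IH] mu; first exact: measurable_cst.
have m0 := @measurable_thead n; have mb := @measurable_tbehead n.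
apply: measurable_funM; last exact: (measurableT_comp (IH _) mb).
apply: measurable_funM => //; apply: measurableT_comp => //.
apply: measurable_prod => i _; apply: measurable_funB => //.
exact: measurable_fun_tnth.
Qed.

Lemma measurable_ilace n (mu : n.-tuple R) :
  measurable_fun [set: n.-tuple R] (fun l => (ilace mu l)%:R : R).
Proof.
elim: n mu => [|n IH] mu; first exact: measurable_cst.
have m0 := @measurable_thead n; have mb := @measurable_tbehead n.
rewrite (_ : (fun l => _) = fun l : n.+1.-tuple R =>
  (thead l <= thead mu)%R%:R *
  ((head_le (tbehead mu) (thead l))%:R * (ilace (tbehead mu) (tbehead l))%:R)).
  apply: measurable_funM; first exact: measurable_ler_indic.
  apply: measurable_funM; first exact: measurable_head_le_indic.
  exact: (measurableT_comp (IH _) mb).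
apply/funext => l; rewrite {1}(tcons_head_behead mu) {1}(tcons_head_behead l) ilaceS.
by rewrite -!natrM !mulnb.
Qed.

Lemma prod_sub_gt0 n (mu : n.-tuple R) m : sdecr mu -> head_lt mu m ->
  0 < \prod_i (m - tnth mu i).
Proof. by move=> smu mum; apply: prodr_gt0 => i _; rewrite subr_gt0 head_lt_all. Qed.

Local Open Scope ereal_scope.

(** Positive residues correspond to interlacing roots. For fixed other residues t, the
    first one is exchanged for the first root l ([integral_residue_of_root]); for
    fixed l, dividing t_i by (l - mu_i) / (m - mu_i) turns t into the residues of
    the tail, to which the induction hypothesis applies. The slope of the first
    substitution becomes 1 + sum_i s_i / (l - mu_i), which the partial fraction
    expansion evaluates as a quotient of products. *)
Theorem integral_resid n (mu : n.-tuple R) (phi : n.-tuple R -> \bar R) : sdecr mu ->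
  measurable_fun [set: n.-tuple R] phi -> (forall t, 0 <= phi t) ->
  \int[lebesgue_tuple R n]_t ((tpos t)%:R%:E * phi t) =
  \int[lebesgue_tuple R n]_l ((ilace mu l)%:R%:E * (phi (resid mu l) * (jac mu l)%:E)).
Proof.
elim: n mu phi => [|n IH] mu phi smu mphi phi0.
  apply: eq_integral => t _; rewrite (tuple0 (resid mu t)) (tuple0 t).
  by rewrite /ilace /jac mule1 (_ : tpos _ = true)//; apply/forallP => -[].
have mpt k : measurable_fun [set: k.-tuple R] (fun t => (tpos t)%:R%:E : \bar R).
  by apply/measurable_EFinP; exact: measurable_tpos.
have mil k (nu : k.-tuple R) : measurable_fun [set: k.-tuple R] (fun l => (ilace nu l)%:R%:E : \bar R).
  by apply/measurable_EFinP; exact: measurable_ilace.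
have mja k (nu : k.-tuple R) : measurable_fun [set: k.-tuple R] (fun l => (jac nu l)%:E : \bar R).
  by apply/measurable_EFinP; exact: measurable_jac.
have mlhs : measurable_fun [set: n.+1.-tuple R] (fun t => (tpos t)%:R%:E * phi t).
  by apply: emeasurable_funM => //; exact: mpt.
have mrhs : measurable_fun [set: n.+1.-tuple R]
    (fun l => (ilace mu l)%:R%:E * (phi (resid mu l) * (jac mu l)%:E)).
  apply: emeasurable_funM; first exact: mil.
  apply: emeasurable_funM; last exact: mja.
  exact: (measurableT_comp mphi (@measurable_resid _ mu)).
have prhs l : 0 <= (ilace mu l)%:R%:E * (phi (resid mu l) * (jac mu l)%:E).
  by rewrite mule_ge0 ?lee_fin// mule_ge0// lee_fin jac_ge0.
rewrite (integral_lebesgue_tupleS mrhs prhs) (integral_lebesgue_tupleS_swap mlhs); last first.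
  by move=> t; rewrite mule_ge0 ?lee_fin.
move: smu {mrhs prhs}; rewrite (tcons_head_behead mu); move: (thead mu) (tbehead mu) => m mu'.
rewrite sdecr_tcons/= => /andP[mum smu].
(* the integrand after the substitution of the first coordinate; the absolute
   value of the slope makes it nonnegative everywhere *)
pose ind (l : R) := (head_lt mu' l && (l < m)%R).
pose H (p : R * n.-tuple R) : \bar R := (tpos p.2)%:R%:E * ((ind p.1)%:R%:E *
  (phi (tcons (residue_of_root mu' p.2 m p.1, p.2)) *
   `|residue_of_root_slope mu' p.2 m p.1|%:E)).
have H0 p : 0 <= H p by rewrite !mule_ge0 ?lee_fin.
have mind d (T : measurableType d) (f : T -> R) : measurable_fun [set: T] f ->
    measurable_fun [set: T] (fun x => (ind (f x))%:R : R).
  move=> mf; rewrite (_ : (fun x => _) = fun x => ((head_lt mu' (f x))%:R * (f x < m)%R%:R)%R).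
    by apply: measurable_funM; [exact: measurable_head_lt_indic|exact: measurable_ltr_indic].
  by apply/funext => x; rewrite -natrM mulnb.
have mH : measurable_fun [set: measurableTypeR R * n.-tuple R] H.
  have m1 : measurable_fun [set: measurableTypeR R * n.-tuple R] (fst : _ -> R) by exact: measurable_fst.
  have m2 : measurable_fun [set: measurableTypeR R * n.-tuple R] snd by exact: measurable_snd.
  apply: emeasurable_funM; first exact: (measurableT_comp (mpt n) m2).
  apply: emeasurable_funM; first by apply/measurable_EFinP; exact: mind.
  apply: emeasurable_funM.
    apply: (measurableT_comp mphi); apply: measurable_tcons_pair => //.
    exact: measurable_residue_of_root.
  apply/measurable_EFinP; apply: measurableT_comp => //.
  exact: measurable_residue_of_root_slope.
transitivity (\int[lebesgue_tuple R n]_t \int[leb]_l H (l, t)).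
  apply: eq_integral => t' _.
  have mphit : measurable_fun [set: R] (fun x => phi (tcons (x, t'))).
    by apply: (measurableT_comp mphi); exact: measurable_tcons_pair.
  transitivity ((tpos t')%:R%:E * \int[leb]_x ((0 < x)%R%:R%:E * phi (tcons (x, t')))).
    rewrite -ge0_integralZl//.
    - by apply: eq_integral => x _; rewrite tpos_tcons/= andbC -mulnb natrM EFinM muleA.
    - apply: emeasurable_funM => //; apply/measurable_EFinP; exact: measurable_ltr_indic.
    - by move=> x _; rewrite mule_ge0 ?lee_fin.
  rewrite /H/=; have [tp|] := boolP (tpos t'); last first.
    by rewrite mul0e integral0_eq// => l _; rewrite mul0e.
  rewrite mul1e (integral_residue_of_root smu tp mum mphit)//.
  apply: eq_integral => l _; rewrite mul1e -/(ind l).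
  congr (_ * (_ * _%:E)); rewrite ger0_norm//.
  rewrite /residue_of_root_slope addr_ge0// sumr_ge0// => i _.
  by rewrite divr_ge0 ?sqr_ge0// mulr_ge0 ?ltW ?(forallP tp)// subr_gt0 head_lt_all.
rewrite -(fubini_tonelli (m1 := leb) (m2 := lebesgue_tuple R n) H mH H0).
pose K (l : R) := \int[lebesgue_tuple R n]_l' ((ilace mu' l')%:R%:E *
   (phi (resid (tcons (m, mu')) (tcons (l, l'))) * (jac (tcons (m, mu')) (tcons (l, l')))%:E)).
have K0 l : 0 <= K l.
  apply: integral_ge0 => l' _; rewrite mule_ge0 ?lee_fin// mule_ge0// lee_fin; exact: jac_ge0.
have mK : measurable_fun [set: R] K.
  pose k (l : n.+1.-tuple R) := (ilace mu' (tbehead l))%:R%:E *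
   (phi (resid (tcons (m, mu')) l) * (jac (tcons (m, mu')) l)%:E).
  have mk : measurable_fun [set: n.+1.-tuple R] k.
    apply: emeasurable_funM; first exact: (measurableT_comp (mil _ _) (@measurable_tbehead n)).
    apply: emeasurable_funM; last exact: mja.
    exact: (measurableT_comp mphi (@measurable_resid _ _)).
  have k0 l : 0 <= k l by rewrite mule_ge0 ?lee_fin// mule_ge0// lee_fin; exact: jac_ge0.
  have := measurable_integral_tcons mk k0.
  rewrite /k; under eq_fun do (under eq_integral do rewrite tbehead_tcons).
  by [].
transitivity (\int[leb]_l ((ind l)%:R%:E * K l)).
  apply: eq_integral => l _; have [|] := boolP (ind l); last first.
    move=> /negbTE il; rewrite mul0e integral0_eq// => t _.
    by rewrite /H/= il mul0e mule0.
  move=> il; have /andP[mul lm] := il; rewrite mul1e.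
  pose k := [tuple ((l - tnth mu' i) / (m - tnth mu' i))%R | i < n].
  have kp : tpos k.
    by apply/forallP => i; rewrite tnth_mktuple divr_gt0// subr_gt0 head_lt_all.
  have mHl : measurable_fun [set: n.-tuple R] (fun t => H (l, t)).
    exact: (measurableT_comp mH (measurable_pair1 l)).
  rewrite (integral_tscale kp mHl)//.
  pose psi (s : n.-tuple R) : \bar R := phi (tcons (((m - l) * (1 + \sum_i tnth s i / (m - tnth mu' i)))%R, tscale k s)) *
    `|1 + \sum_i tnth s i / (l - tnth mu' i)|%R%:E.
  have psi0 s : 0 <= psi s by rewrite mule_ge0.
  have mpsi : measurable_fun [set: n.-tuple R] psi.
    apply: emeasurable_funM.
      apply: (measurableT_comp mphi); apply: measurable_tcons_pair.
        apply: measurable_funM => //; apply: measurable_funD => //; apply: measurable_sum => i.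
        by apply: measurable_funM => //; exact: measurable_fun_tnth.
      exact: measurable_tscale.
    apply/measurable_EFinP; apply: measurableT_comp => //.
    apply: measurable_funD => //; apply: measurable_sum => i.
    by apply: measurable_funM => //; exact: measurable_fun_tnth.
  have lmu i : (l - tnth mu' i != 0)%R by rewrite subr_eq0 gt_eqF// head_lt_all.
  have mmu i : (m - tnth mu' i != 0)%R by rewrite subr_eq0 gt_eqF// head_lt_all.
  transitivity ((\prod_i tnth k i)%:E * \int[lebesgue_tuple R n]_s ((tpos s)%:R%:E * psi s)).
    congr (_ * _); apply: eq_integral => s _; rewrite /H/= il mul1e.
    have -> : tpos (tscale k s) = tpos s.
      apply/eq_forallb => i; rewrite tnth_mktuple pmulr_rgt0//; exact: (forallP kp).
    have -> : residue_of_root mu' (tscale k s) m l =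
        ((m - l) * (1 + \sum_i tnth s i / (m - tnth mu' i)))%R.
      rewrite /residue_of_root; congr (_ * (_ + _))%R; apply: eq_bigr => i _.
      by rewrite !tnth_mktuple; have := lmu i; have := mmu i => h1 h2; field; rewrite h1 h2.
    have -> // : residue_of_root_slope mu' (tscale k s) m l =
        (1 + \sum_i tnth s i / (l - tnth mu' i))%R.
    rewrite /residue_of_root_slope; congr (_ + _)%R; apply: eq_bigr => i _.
    by rewrite !tnth_mktuple; have := lmu i; have := mmu i => h1 h2; field; rewrite h1 h2.
  rewrite (IH mu' psi smu mpsi psi0) -ge0_integralZl_EFin//; first last.
  - by apply: prodr_ge0 => i _; apply/ltW; exact: (forallP kp).
  - apply: emeasurable_funM; first exact: mil.
    apply: emeasurable_funM; last exact: mja.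
    exact: (measurableT_comp mpsi (@measurable_resid _ _)).
  - by move=> l' _; rewrite mule_ge0 ?lee_fin// mule_ge0// lee_fin jac_ge0.
  apply: eq_integral => l' _.
  rewrite muleCA; congr (_ * _).
  rewrite /psi residS jacS -/k muleCA -!muleA; congr (_ * _).
  rewrite -!EFinM; congr EFin.
  rewrite resid_partial_fractions//; last by move=> i; rewrite -subr_eq0.
  rewrite normrM normfV (gtr0_norm (prod_sub_gt0 smu mul)) (gtr0_norm (prod_sub_gt0 smu mum)).
  have -> : (\prod_i tnth k i = \prod_i (l - tnth mu' i) / \prod_i (m - tnth mu' i))%R.
    by rewrite -prodf_div; apply: eq_bigr => i _; rewrite tnth_mktuple.
  have h1 := prod_sub_gt0 smu mul; have h2 := prod_sub_gt0 smu mum.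
  by field; rewrite !gt_eqF.
transitivity (\int[leb]_l (((l <= m)%R && head_le mu' l)%:R%:E * K l)).
  apply: (@eq_integral_off_pair _ m (head 0%R mu')).
  - by apply: emeasurable_funM => //; apply/measurable_EFinP; exact: mind.
  - apply: emeasurable_funM => //; apply/measurable_EFinP.
    rewrite (_ : (fun x => _) = fun x : R => ((x <= m)%R%:R * (head_le mu' x)%:R)%R).
      by apply: measurable_funM; [exact: measurable_ler_indic|exact: measurable_head_le_indic].
    by apply/funext => x; rewrite -natrM mulnb.
  - by move=> x; rewrite mule_ge0 ?lee_fin.
  - by move=> x; rewrite mule_ge0 ?lee_fin.
  - move=> x xm xh; congr (_%:R%:E * _); congr nat_of_bool; rewrite andbC /ind.
    rewrite lt_neqAle xm/=; congr (_ && _); move: xh; rewrite /head_lt /head_le.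
    by case: (tval mu') => //= a s xa; rewrite lt_neqAle eq_sym xa.
apply: eq_integral => l _; rewrite /K -ge0_integralZl//.
- by apply: eq_integral => l' _; rewrite ilaceS muleA -EFinM -natrM mulnb andbA.
- apply: emeasurable_funM; first exact: mil.
  apply: emeasurable_funM.
    by apply: (measurableT_comp mphi); apply: (measurableT_comp (@measurable_resid _ _)); exact: measurable_tcons_pair.
  by apply: (measurableT_comp (mja _ _)); exact: measurable_tcons_pair.
- by move=> l' _; rewrite mule_ge0 ?lee_fin// mule_ge0// lee_fin; exact: jac_ge0.
Qed.

End interlacing_change_of_variables.

(** * From a pole and residues to interlacing roots *)
Section pole_and_residues.
Variable R : realType.
Local Notation leb := (@lebesgue_measure R).

(** The pair (x, r) for which z - x - sum_i r_i / (z - mu_i) is equal to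
    prod_j (z - l_j) / prod_i (z - mu_i), l having one more entry than mu. It comes
    from the residues of the tail of l by inserting the root l_1
    ([arrow_poly_pole_resid]). *)
Definition pole_resid n (mu : n.-tuple R) (l : n.+1.-tuple R) : n.+1.-tuple R :=
  tcons (thead l - \sum_i tnth (resid mu (tbehead l)) i,
    tscale [tuple thead l - tnth mu i | i < n] (resid mu (tbehead l))).

(** Interlacing l_1 >= m_1 >= l_2 >= ... with one more l than m, in recursive form; see
    [pole_ilaceE]. *)
Definition pole_ilace n (mu : n.-tuple R) (l : n.+1.-tuple R) : bool :=
  head_le mu (thead l) && ilace mu (tbehead l).

Definition pole_jac n (mu : n.-tuple R) (l : n.+1.-tuple R) : R :=
  `|\prod_i (thead l - tnth (tbehead l) i)| * jac mu (tbehead l).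

Lemma measurable_pole_of_root n d (T : measurableType d) (mu : n.-tuple R)
    (f : T -> R) (g : T -> n.-tuple R) :
  measurable_fun [set: T] f -> measurable_fun [set: T] g ->
  measurable_fun [set: T] (fun x => pole_of_root mu (g x) (f x)).
Proof.
move=> mf mg; apply: measurable_funB => //; apply: measurable_sum => i.
apply: measurable_funM; first exact: measurable_fun_tnth.
by apply: measurable_fun_inv; exact: measurable_funB.
Qed.

Lemma measurable_pole_of_root_slope n d (T : measurableType d) (mu : n.-tuple R)
    (f : T -> R) (g : T -> n.-tuple R) :
  measurable_fun [set: T] f -> measurable_fun [set: T] g ->
  measurable_fun [set: T] (fun x => pole_of_root_slope mu (g x) (f x)).
Proof.
move=> mf mg; apply: measurable_funD => //; apply: measurable_sum => i.
apply: measurable_funM; first exact: measurable_fun_tnth.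
by apply: measurable_fun_inv; apply: measurable_funX; exact: measurable_funB.
Qed.

Lemma measurable_pole_resid n (mu : n.-tuple R) :
  measurable_fun [set: n.+1.-tuple R] (pole_resid mu).
Proof.
have m0 := @measurable_thead R n; have mb := @measurable_tbehead R n.
have mr := measurableT_comp (@measurable_resid R n mu) mb.
apply: measurable_tcons_pair.
  apply: measurable_funB => //; apply: measurable_sum => i.
  exact: (measurable_fun_tnth i mr).
apply: measurable_tscale => //; apply: measurable_mktuple => i.
exact: measurable_funB.
Qed.

Lemma measurable_pole_jac n (mu : n.-tuple R) :
  measurable_fun [set: n.+1.-tuple R] (pole_jac mu).
Proof.
have m0 := @measurable_thead R n; have mb := @measurable_tbehead R n.
apply: measurable_funM; last exact: (measurableT_comp (@measurable_jac R n mu) mb).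
apply: measurableT_comp => //; apply: measurable_prod => i _.
by apply: measurable_funB => //; exact: measurable_fun_tnth.
Qed.

Lemma measurable_pole_ilace n (mu : n.-tuple R) :
  measurable_fun [set: n.+1.-tuple R] (fun l => (pole_ilace mu l)%:R : R).
Proof.
have m0 := @measurable_thead R n; have mb := @measurable_tbehead R n.
rewrite (_ : (fun l => _) = fun l : n.+1.-tuple R =>
  (head_le mu (thead l))%:R * (ilace mu (tbehead l))%:R).
  apply: measurable_funM; first exact: measurable_head_le_indic.
  exact: (measurableT_comp (@measurable_ilace R n mu) mb).
by apply/funext => l; rewrite -natrM mulnb.
Qed.

Lemma pole_jac_ge0 n (mu : n.-tuple R) l : 0 <= pole_jac mu l.
Proof. by rewrite mulr_ge0// jac_ge0. Qed.

Local Open Scope ereal_scope.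

(** The first root is exchanged for the pole x ([integral_pole_of_root]), and after
    scaling, the remaining variables are the residues of the tail, treated by
    [integral_resid]. *)
Theorem integral_pole_resid n (mu : n.-tuple R) (phi : n.+1.-tuple R -> \bar R) : sdecr mu ->
  measurable_fun [set: n.+1.-tuple R] phi -> (forall t, 0 <= phi t) ->
  \int[lebesgue_tuple R n.+1]_u ((tpos (tbehead u))%:R%:E * phi u) =
  \int[lebesgue_tuple R n.+1]_l
    ((pole_ilace mu l)%:R%:E * (phi (pole_resid mu l) * (pole_jac mu l)%:E)).
Proof.
move=> smu mphi phi0.
have mpt : measurable_fun [set: n.-tuple R] (fun t => (tpos t)%:R%:E : \bar R).
  by apply/measurable_EFinP; exact: measurable_tpos.
have mil k (nu : k.-tuple R) : measurable_fun [set: k.-tuple R] (fun l => (ilace nu l)%:R%:E : \bar R).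
  by apply/measurable_EFinP; exact: measurable_ilace.
have mja k (nu : k.-tuple R) : measurable_fun [set: k.-tuple R] (fun l => (jac nu l)%:E : \bar R).
  by apply/measurable_EFinP; exact: measurable_jac.
have mlhs : measurable_fun [set: n.+1.-tuple R] (fun u => (tpos (tbehead u))%:R%:E * phi u).
  by apply: emeasurable_funM => //; exact: (measurableT_comp mpt (@measurable_tbehead R n)).
have mpj : measurable_fun [set: n.+1.-tuple R] (fun l => phi (pole_resid mu l) * (pole_jac mu l)%:E).
  apply: emeasurable_funM; first exact: (measurableT_comp mphi (@measurable_pole_resid _ mu)).
  by apply/measurable_EFinP; exact: measurable_pole_jac.
have ppj l : 0 <= phi (pole_resid mu l) * (pole_jac mu l)%:E.
  by rewrite mule_ge0// lee_fin pole_jac_ge0.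
have mrhs : measurable_fun [set: n.+1.-tuple R]
    (fun l => (pole_ilace mu l)%:R%:E * (phi (pole_resid mu l) * (pole_jac mu l)%:E)).
  by apply: emeasurable_funM => //; apply/measurable_EFinP; exact: measurable_pole_ilace.
rewrite (integral_lebesgue_tupleS mrhs); last first.
  by move=> l; rewrite mule_ge0 ?lee_fin.
rewrite (integral_lebesgue_tupleS_swap mlhs); last first.
  by move=> t; rewrite mule_ge0 ?lee_fin.
pose H (p : R * n.-tuple R) : \bar R := (tpos p.2)%:R%:E * ((head_lt mu p.1)%:R%:E *
  (phi (tcons (pole_of_root mu p.2 p.1, p.2)) *
   `|pole_of_root_slope mu p.2 p.1|%:E)).
have H0 p : 0 <= H p by rewrite !mule_ge0 ?lee_fin.
have mH : measurable_fun [set: measurableTypeR R * n.-tuple R] H.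
  have m1 : measurable_fun [set: measurableTypeR R * n.-tuple R] (fst : _ -> R) by exact: measurable_fst.
  have m2 : measurable_fun [set: measurableTypeR R * n.-tuple R] snd by exact: measurable_snd.
  apply: emeasurable_funM; first exact: (measurableT_comp mpt m2).
  apply: emeasurable_funM; first by apply/measurable_EFinP; exact: measurable_head_lt_indic.
  apply: emeasurable_funM.
    apply: (measurableT_comp mphi); apply: measurable_tcons_pair => //.
    exact: measurable_pole_of_root.
  apply/measurable_EFinP; apply: measurableT_comp => //.
  exact: measurable_pole_of_root_slope.
transitivity (\int[lebesgue_tuple R n]_t \int[leb]_l H (l, t)).
  apply: eq_integral => t' _.
  have mphit : measurable_fun [set: R] (fun x => phi (tcons (x, t'))).
    by apply: (measurableT_comp mphi); exact: measurable_tcons_pair.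
  transitivity ((tpos t')%:R%:E * \int[leb]_x phi (tcons (x, t'))).
    rewrite -ge0_integralZl//.
    by apply: eq_integral => x _; rewrite tbehead_tcons.
  rewrite /H/=; have [tp|] := boolP (tpos t'); last first.
    by rewrite mul0e integral0_eq// => l _; rewrite mul0e.
  rewrite mul1e (integral_pole_of_root smu tp mphit)//.
  apply: eq_integral => l _; rewrite mul1e.
  congr (_ * (_ * _%:E)); rewrite ger0_norm//.
  rewrite /pole_of_root_slope addr_ge0// sumr_ge0// => i _.
  by rewrite divr_ge0 ?sqr_ge0// ltW// (forallP tp).
rewrite -(fubini_tonelli (m1 := leb) (m2 := lebesgue_tuple R n) H mH H0).
pose K (l : R) := \int[lebesgue_tuple R n]_l' ((ilace mu l')%:R%:E *
   (phi (pole_resid mu (tcons (l, l'))) * (pole_jac mu (tcons (l, l')))%:E)).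
pose k0 (l : n.+1.-tuple R) := (ilace mu (tbehead l))%:R%:E *
   (phi (pole_resid mu l) * (pole_jac mu l)%:E).
have mk0 : measurable_fun [set: n.+1.-tuple R] k0.
  by apply: emeasurable_funM => //; exact: (measurableT_comp (mil _ _) (@measurable_tbehead R n)).
have k00 l : 0 <= k0 l by rewrite mule_ge0 ?lee_fin.
have K0 l : 0 <= K l.
  by apply: integral_ge0 => l' _; rewrite mule_ge0 ?lee_fin.
have mK : measurable_fun [set: R] K.
  have := measurable_integral_tcons mk0 k00.
  rewrite /k0; under eq_fun do (under eq_integral do rewrite tbehead_tcons).
  by [].
transitivity (\int[leb]_l ((head_lt mu l)%:R%:E * K l)).
  apply: eq_integral => l _; have [mul|] := boolP (head_lt mu l); last first.
    move=> /negbTE il; rewrite mul0e integral0_eq// => t _.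
    by rewrite /H/= il mul0e mule0.
  rewrite mul1e.
  pose k := [tuple (l - tnth mu i)%R | i < n].
  have kp : tpos k.
    by apply/forallP => i; rewrite tnth_mktuple subr_gt0 head_lt_all.
  have mHl : measurable_fun [set: n.-tuple R] (fun t => H (l, t)).
    exact: (measurableT_comp mH (measurable_pair1 l)).
  rewrite (integral_tscale kp mHl)//.
  pose psi (s : n.-tuple R) : \bar R := phi (tcons ((l - \sum_i tnth s i)%R, tscale k s)) *
    `|1 + \sum_i tnth s i / (l - tnth mu i)|%R%:E.
  have psi0 s : 0 <= psi s by rewrite mule_ge0.
  have mpsi : measurable_fun [set: n.-tuple R] psi.
    apply: emeasurable_funM.
      apply: (measurableT_comp mphi); apply: measurable_tcons_pair.
        apply: measurable_funB => //; apply: measurable_sum => i.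
        exact: measurable_fun_tnth.
      exact: measurable_tscale.
    apply/measurable_EFinP; apply: measurableT_comp => //.
    apply: measurable_funD => //; apply: measurable_sum => i.
    by apply: measurable_funM => //; exact: measurable_fun_tnth.
  have lmu i : (l - tnth mu i != 0)%R by rewrite subr_eq0 gt_eqF// head_lt_all.
  transitivity ((\prod_i tnth k i)%:E * \int[lebesgue_tuple R n]_s ((tpos s)%:R%:E * psi s)).
    congr (_ * _); apply: eq_integral => s _; rewrite /H/= mul mul1e.
    have -> : tpos (tscale k s) = tpos s.
      apply/eq_forallb => i; rewrite tnth_mktuple pmulr_rgt0//; exact: (forallP kp).
    have -> : pole_of_root mu (tscale k s) l = (l - \sum_i tnth s i)%R.
      rewrite /pole_of_root; congr (_ - _)%R; apply: eq_bigr => i _.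
      by rewrite !tnth_mktuple; have := lmu i => h1; field.
    have -> // : pole_of_root_slope mu (tscale k s) l =
        (1 + \sum_i tnth s i / (l - tnth mu i))%R.
    rewrite /pole_of_root_slope; congr (_ + _)%R; apply: eq_bigr => i _.
    by rewrite !tnth_mktuple; have := lmu i => h1; field.
  rewrite (integral_resid smu mpsi psi0) -ge0_integralZl_EFin//; first last.
  - by apply: prodr_ge0 => i _; apply/ltW; exact: (forallP kp).
  - apply: emeasurable_funM; first exact: mil.
    apply: emeasurable_funM; last exact: mja.
    exact: (measurableT_comp mpsi (@measurable_resid _ _ _)).
  - by move=> l' _; rewrite mule_ge0 ?lee_fin// mule_ge0// lee_fin jac_ge0.
  apply: eq_integral => l' _.
  rewrite muleCA; congr (_ * _).
  rewrite /psi /pole_resid /pole_jac thead_tcons tbehead_tcons/= -/k muleCA -!muleA; congr (_ * _).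
  rewrite -!EFinM; congr EFin.
  rewrite resid_partial_fractions//; last by move=> i; rewrite -subr_eq0.
  rewrite normrM normfV (gtr0_norm (prod_sub_gt0 smu mul)).
  have -> : (\prod_i tnth k i = \prod_i (l - tnth mu i))%R.
    by apply: eq_bigr => i _; rewrite tnth_mktuple.
  have h1 := prod_sub_gt0 smu mul.
  by field; rewrite !gt_eqF.
transitivity (\int[leb]_l ((head_le mu l)%:R%:E * K l)).
  apply: (@eq_integral_off_pair _ 0%R (head 0%R mu)).
  - by apply: emeasurable_funM => //; apply/measurable_EFinP; exact: measurable_head_lt_indic.
  - by apply: emeasurable_funM => //; apply/measurable_EFinP; exact: measurable_head_le_indic.
  - by move=> x; rewrite mule_ge0 ?lee_fin.
  - by move=> x; rewrite mule_ge0 ?lee_fin.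
  - move=> x _ xh; congr (_%:R%:E * _); congr nat_of_bool.
    move: xh; rewrite /head_lt /head_le.
    by case: (tval mu) => //= a s xa; rewrite lt_neqAle eq_sym xa.
apply: eq_integral => l _; rewrite /K -ge0_integralZl//.
- apply: eq_integral => l' _.
  by rewrite /pole_ilace thead_tcons tbehead_tcons/= muleA -EFinM -natrM mulnb.
- apply: emeasurable_funM; first exact: mil.
  by apply: (measurableT_comp mpj); exact: measurable_tcons_pair.
- by move=> l' _; rewrite mule_ge0 ?lee_fin.
Qed.

End pole_and_residues.

(** * Closed forms, and the density of the roots *)
Section closed_forms.
Variable R : realType.

Definition vdm n (t : n.-tuple R) : R :=
  \prod_(i < n) \prod_(j < n | (i < j)%N) (tnth t i - tnth t j).

Lemma vdm_tcons n (p : R * n.-tuple R) :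
  vdm (tcons p) = \prod_i (p.1 - tnth p.2 i) * vdm p.2.
Proof.
rewrite /vdm big_ord_recl; congr (_ * _).
  rewrite big_mkcond big_ord_recl/= mul1r.
  by apply: eq_bigr => i _; rewrite tnth_tcons0 tnth_tconsS.
apply: eq_bigr => i _; rewrite big_mkcond big_ord_recl/= mul1r [RHS]big_mkcond.
by apply: eq_bigr => j _; rewrite !tnth_tconsS/= /bump !leq0n !add1n ltnS.
Qed.

Lemma vdm_gt0 n (mu : n.-tuple R) : sdecr mu -> 0 < vdm mu.
Proof.
elim: n mu => [|n IH] mu; first by rewrite /vdm big_ord0.
rewrite (tcons_head_behead mu) sdecr_tcons => /andP[mum smu].
by rewrite vdm_tcons mulr_gt0 ?prod_sub_gt0 ?IH.
Qed.

Lemma ilace_le n (mu l : n.-tuple R) x : ilace mu l -> head_le mu x ->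
  forall i, tnth l i <= x.
Proof.
elim: n mu l x => [|n IH] mu l x; first by move=> _ _ [].
rewrite (tcons_head_behead mu) (tcons_head_behead l).
move: (thead mu) (tbehead mu) (thead l) (tbehead l) => m mu' l0 l'.
rewrite ilaceS head_le_tcons/= => /and3P[l0m ml0 il] mx i.
case: (unliftP ord0 i) => [j|] ->; last by rewrite tnth_tcons0 (le_trans l0m).
by rewrite tnth_tconsS (le_trans (IH _ _ _ il ml0 j))// (le_trans l0m).
Qed.

Lemma head_le_all n (mu : n.-tuple R) x : sdecr mu -> head_le mu x ->
  forall i, tnth mu i <= x.
Proof.
case: n mu => [mu _ _ []//|n mu].
rewrite (tcons_head_behead mu) sdecr_tcons head_le_tcons/= => /andP[mum smu] mx i.
case: (unliftP ord0 i) => [j|] ->; rewrite ?tnth_tcons0// tnth_tconsS.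
by rewrite ltW// (lt_le_trans _ mx)// head_lt_all.
Qed.

Lemma vdm_ge0 n (mu l : n.-tuple R) : ilace mu l -> 0 <= vdm l.
Proof.
elim: n mu l => [|n IH] mu l; first by rewrite /vdm big_ord0.
rewrite (tcons_head_behead mu) (tcons_head_behead l).
move: (thead mu) (tbehead mu) (thead l) (tbehead l) => m mu' l0 l'.
rewrite ilaceS/= => /and3P[l0m ml0 il]; rewrite vdm_tcons mulr_ge0//; last exact: IH il.
by apply: prodr_ge0 => i _; rewrite subr_ge0/= (ilace_le il ml0).
Qed.

Lemma jac_vdm n (mu l : n.-tuple R) : jac mu l = `|vdm l| / `|vdm mu|.
Proof.
elim: n mu l => [|n IH] mu l; first by rewrite /vdm !big_ord0 normr1 divr1.
rewrite (tcons_head_behead mu) (tcons_head_behead l) jacS !vdm_tcons/= !normrM IH.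
by rewrite mulf_div.
Qed.

Lemma resid_ge0 n (mu l : n.-tuple R) : sdecr mu -> ilace mu l ->
  forall i, 0 <= tnth (resid mu l) i.
Proof.
elim: n mu l => [|n IH] mu l; first by move=> _ _ [].
rewrite (tcons_head_behead mu) (tcons_head_behead l).
move: (thead mu) (tbehead mu) (thead l) (tbehead l) => m mu' l0 l'.
rewrite sdecr_tcons ilaceS residS/= => /andP[mum smu] /and3P[l0m ml0 il] i.
have r0 := IH _ _ smu il.
have mmu j : 0 < m - tnth mu' j by rewrite subr_gt0 head_lt_all.
case: (unliftP ord0 i) => [j|] ->; rewrite ?tnth_tcons0 ?tnth_tconsS/=.
  by rewrite !tnth_mktuple mulr_ge0// divr_ge0//;
    [rewrite subr_ge0 head_le_all|exact: ltW].
rewrite mulr_ge0 ?subr_ge0// addr_ge0// sumr_ge0// => j _.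
by rewrite divr_ge0// ltW.
Qed.

(** Compare the coefficients of 1/z in the partial fraction expansion; the proof
    follows the recursion. *)
Lemma sum_resid n (mu l : n.-tuple R) : sdecr mu ->
  \sum_i tnth (resid mu l) i = \sum_i tnth mu i - \sum_i tnth l i.
Proof.
elim: n mu l => [|n IH] mu l; first by rewrite !big_ord0 subr0.
rewrite (tcons_head_behead mu) (tcons_head_behead l).
move: (thead mu) (tbehead mu) (thead l) (tbehead l) => m mu' l0 l'.
rewrite sdecr_tcons residS/= => /andP[mum smu].
rewrite !(sum_tcons (fun x => x))/=.
have mmu j : m - tnth mu' j != 0 by rewrite subr_eq0 gt_eqF// head_lt_all.
have -> : m + \sum_i tnth mu' i - (l0 + \sum_i tnth l' i) =
  (m - l0) + (\sum_i tnth mu' i - \sum_i tnth l' i) by ring.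
rewrite -IH// mulrDr mulr1 -addrA; congr (_ + _).
rewrite mulr_sumr -big_split/=; apply: eq_bigr => i _.
by rewrite !tnth_mktuple; have := mmu i => h; field.
Qed.

(** Compare the coefficients of 1/z^2 in the partial fraction expansion. *)
Lemma sum_resid_mul n (mu l : n.-tuple R) : sdecr mu ->
  \sum_i tnth (resid mu l) i * tnth mu i =
  2^-1 * (\sum_i tnth mu i ^+ 2 - \sum_i tnth l i ^+ 2 +
          (\sum_i tnth mu i - \sum_i tnth l i) ^+ 2).
Proof.
elim: n mu l => [|n IH] mu l.
  by rewrite !big_ord0 subr0 expr0n addr0 mulr0.
rewrite (tcons_head_behead mu) (tcons_head_behead l).
move: (thead mu) (tbehead mu) (thead l) (tbehead l) => m mu' l0 l'.
rewrite sdecr_tcons residS/= => /andP[mum smu].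
rewrite (sum_tcons2 (fun x y => x * y)) !(sum_tcons (fun x => x)) !(sum_tcons (fun x => x ^+ 2))/=.
have mmu j : m - tnth mu' j != 0 by rewrite subr_eq0 gt_eqF// head_lt_all.
have E := sum_resid l' smu; have IH' := IH mu' l' smu.
transitivity (m * (m - l0) + (m - l0) * (\sum_i tnth (resid mu' l') i) +
  \sum_i tnth (resid mu' l') i * tnth mu' i).
  set S := \sum_(i < n) _ / (m - _).
  have -> : (m - l0) * (1 + S) * m = m * (m - l0) + (m - l0) * m * S by ring.
  rewrite -!addrA; congr (_ + _); rewrite /S.
  rewrite !mulr_sumr -!big_split/=; apply: eq_bigr => i _.
  by rewrite !tnth_mktuple; have := mmu i => h; field.
rewrite IH' E.
move: (\sum_i _) (\sum_i _) (\sum_i _) (\sum_i _) => A B C D.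
by field.
Qed.

(** The residue at mu_i is prod_j (mu_i - l_j) / prod_(k <> i) (mu_i - mu_k) up to
    sign, and each pair of poles occurs in two of the denominators. *)
Lemma prod_resid n (mu l : n.-tuple R) : sdecr mu ->
  `|\prod_i tnth (resid mu l) i| =
  \prod_i \prod_j `|tnth mu i - tnth l j| / (vdm mu) ^+ 2.
Proof.
elim: n mu l => [|n IH] mu l.
  by rewrite /vdm !big_ord0 normr1 expr1n divr1.
rewrite (tcons_head_behead mu) (tcons_head_behead l).
move: (thead mu) (tbehead mu) (thead l) (tbehead l) => m mu' l0 l'.
rewrite sdecr_tcons residS/= => /andP[mum smu].
have mmu j : m - tnth mu' j != 0 by rewrite subr_eq0 gt_eqF// head_lt_all.
rewrite resid_partial_fractions//; last by move=> i; rewrite -subr_eq0.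
rewrite (prod_tcons (fun x => x))/= vdm_tcons/=.
rewrite (prod_tcons (fun x => \prod_j `|x - tnth (tcons (l0, l')) j|))/=.
rewrite (prod_tcons (fun x => `|m - x|))/=.
under [X in _ = _ * X / _]eq_bigr => i _ do rewrite (prod_tcons (fun x => `|tnth mu' i - x|))/=.
rewrite big_split/=.
have -> : \prod_i tnth (tscale [tuple (l0 - tnth mu' i) / (m - tnth mu' i) | i < n] (resid mu' l')) i
  = \prod_i (l0 - tnth mu' i) / \prod_i (m - tnth mu' i) * \prod_i tnth (resid mu' l') i.
  by rewrite -prodf_div -big_split/=; apply: eq_bigr => i _; rewrite !tnth_mktuple.
rewrite !normrM !normfV IH// !normr_prod.
have -> : \prod_i `|l0 - tnth mu' i| = \prod_i `|tnth mu' i - l0|.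
  by apply: eq_bigr => i _; rewrite distrC.
have h1 : vdm mu' != 0 by rewrite gt_eqF// vdm_gt0.
have h2 : \prod_i (m - tnth mu' i) != 0 by rewrite gt_eqF// prod_sub_gt0.
rewrite -(normr_prod _ _ (fun i => m - tnth mu' i)) (gtr0_norm (prod_sub_gt0 smu mum)).
by field; rewrite h1 h2.
Qed.

Lemma pole_ilaceE n (mu : n.-tuple R) (l : n.+1.-tuple R) : pole_ilace mu l = interlacing mu l.
Proof.
elim: n mu l => [|n IH] mu l.
  rewrite /pole_ilace (_ : interlacing _ _ = true); last by apply/forallP => -[].
  by rewrite (tuple0 mu) /head_le/= /ilace.
rewrite (tcons_head_behead mu) (tcons_head_behead l).
move: (thead mu) (tbehead mu) (thead l) (tbehead l) => m mu' l0 l'.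
have -> : pole_ilace (tcons (m, mu')) (tcons (l0, l')) =
   [&& m <= l0, thead l' <= m & pole_ilace mu' l'].
  rewrite /pole_ilace thead_tcons tbehead_tcons/= head_le_tcons/=; congr (_ && _).
  by rewrite /= thead_tcons tbehead_tcons.
rewrite IH; apply/and3P/forallP => [[h1 h2 /forallP h3] i|h].
  case: (unliftP ord0 i) => [j|] ->.
    have := h3 j; rewrite !tnth_tconsS/=.
    by rewrite (_ : widen_ord _ _ = lift ord0 (widen_ord (leqnSn n) j)) ?tnth_tconsS//; exact: val_inj.
  rewrite tnth_tcons0 (_ : widen_ord _ _ = ord0); last exact: val_inj.
  by rewrite tnth_tcons0 tnth_tconsS/= h1; exact: h2.
have := h ord0; rewrite tnth_tcons0 (_ : widen_ord _ _ = ord0); last exact: val_inj.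
rewrite tnth_tcons0 tnth_tconsS/= => /andP[h1 h2]; split => //.
apply/forallP => j; have := h (lift ord0 j); rewrite !tnth_tconsS/=.
by rewrite (_ : widen_ord _ _ = lift ord0 (widen_ord (leqnSn n) j)) ?tnth_tconsS//; exact: val_inj.
Qed.

Lemma powR_prod (p : R) (I : Type) (r : seq I) (P : pred I) (F : I -> R) :
  (forall i, P i -> 0 <= F i) ->
  (\prod_(i <- r | P i) F i) `^ p = \prod_(i <- r | P i) F i `^ p.
Proof.
move=> F0; elim: r => [|i r IH]; first by rewrite !big_nil powR1.
rewrite !big_cons; case: ifP => // Pi.
by rewrite powRM ?IH ?F0// prodr_ge0.
Qed.

Section density_formula.
Variables (n b : nat) (aN : R) (mu : n.-tuple R) (l : n.+1.-tuple R).
Hypothesis smu : sdecr mu.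

Let x := thead (pole_resid mu l).
Let r := tbehead (pole_resid mu l).

Lemma thead_pole_resid : x = \sum_i tnth l i - \sum_i tnth mu i.
Proof.
rewrite /x /pole_resid thead_tcons/= sum_resid//.
by rewrite [in RHS](tcons_head_behead l) (sum_tcons (fun x => x))/=; ring.
Qed.

(** The identity tr C^2 = tr M^2 + 2 sum r + x^2 in terms of eigenvalues: this is what
    turns the Gaussian weights of x and r into that of l. *)
Lemma pole_resid_energy :
  2^-1 * x ^+ 2 + \sum_i tnth r i = 2^-1 * (\sum_i tnth l i ^+ 2 - \sum_i tnth mu i ^+ 2).
Proof.
rewrite thead_pole_resid /r /pole_resid tbehead_tcons/=.
have -> : \sum_i tnth (tscale [tuple thead l - tnth mu i | i < n] (resid mu (tbehead l))) i =
    thead l * (\sum_i tnth (resid mu (tbehead l)) i) -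
    \sum_i tnth (resid mu (tbehead l)) i * tnth mu i.
  rewrite mulr_sumr -sumrB; apply: eq_bigr => i _.
  by rewrite !tnth_mktuple; ring.
rewrite sum_resid// sum_resid_mul//.
rewrite [in LHS](tcons_head_behead l) [in RHS](tcons_head_behead l) thead_tcons tbehead_tcons.
rewrite (sum_tcons (fun x => x)) (sum_tcons (fun x => x ^+ 2))/=.
move: (\sum_i _) (\sum_i _) (\sum_i _) (\sum_i _) => A B C D.
by field.
Qed.

Lemma pole_resid_ge0 : pole_ilace mu l -> forall i, 0 <= tnth r i.
Proof.
move=> /andP[h1 h2] i; rewrite /r /pole_resid tbehead_tcons/= !tnth_mktuple.
by rewrite mulr_ge0 ?resid_ge0// subr_ge0 head_le_all.
Qed.

Lemma prod_pole_resid :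
  `|\prod_i tnth r i| = \prod_i \prod_j `|tnth mu i - tnth l j| * (vdm mu ^+ 2)^-1.
Proof.
rewrite /r /pole_resid tbehead_tcons/=.
have -> : \prod_i tnth (tscale [tuple thead l - tnth mu i | i < n] (resid mu (tbehead l))) i =
    \prod_i (thead l - tnth mu i) * \prod_i tnth (resid mu (tbehead l)) i.
  by rewrite -big_split; apply: eq_bigr => i _; rewrite !tnth_mktuple.
rewrite normrM prod_resid// mulrA; congr (_ * _).
rewrite normr_prod -big_split; apply: eq_bigr => i _ /=.
by rewrite [in RHS](tcons_head_behead l) (prod_tcons (fun x => `|tnth mu i - x|))/= distrC.
Qed.

Lemma pole_jac_vdm : pole_ilace mu l -> pole_jac mu l = vdm l / vdm mu.
Proof.
move=> /andP[h1 h2]; rewrite /pole_jac jac_vdm mulrA -normrM.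
rewrite -(vdm_tcons (thead l, tbehead l)) -tcons_head_behead.
rewrite (gtr0_norm (vdm_gt0 smu)) ger0_norm//.
rewrite (tcons_head_behead l) vdm_tcons/= mulr_ge0 ?(vdm_ge0 h2)//.
by apply: prodr_ge0 => i _; rewrite subr_ge0 (ilace_le h2 h1).
Qed.

(** The factors of the density of l that involve mu only. *)
Definition corner_constant : R :=
  expR (2^-1 * \sum_i tnth mu i ^+ 2) * expR (- aN * \sum_i tnth mu i) * (vdm mu)^-1 *
  (vdm mu ^+ 2)^-1 `^ (b%:R / 2 - 1).

(** The weight of (x, r) times the Jacobian is the density of the statement, up to
    corner_constant. *)
Lemma corner_densityE :
  (pole_ilace mu l)%:R *
   (expR (- (2^-1 * x ^+ 2)) * expR (aN * x) *
    \prod_i (expR (- tnth r i) * tnth r i `^ (b%:R / 2 - 1)) * pole_jac mu l) =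
  corner_constant * corner_density b aN mu l.
Proof.
rewrite /corner_density -pole_ilaceE; have [il|] := boolP (pole_ilace mu l); last first.
  by rewrite mul0r !mulr0.
rewrite mul1r mulr1 pole_jac_vdm// big_split/= -powR_prod; last first.
  by move=> i _; exact: pole_resid_ge0.
have P0 : 0 <= \prod_i tnth r i by apply: prodr_ge0 => i _; exact: pole_resid_ge0.
rewrite -(ger0_norm P0) prod_pole_resid powRM; last 2 first.
- by apply: prodr_ge0 => i _; apply: prodr_ge0.
- by rewrite invr_ge0 sqr_ge0.
rewrite powR_prod; last by move=> i _; apply: prodr_ge0.
under [X in _ * (_ * (X * _))]eq_bigr do rewrite powR_prod//.
rewrite -/(vdm l) -expR_sum /corner_constant.
set W := \prod_i _; set V := _ `^ _.
transitivity ((expR (- (2^-1 * x ^+ 2)) * expR (\sum_i - tnth r i) * expR (aN * x)) *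
  (W * V * (vdm l / vdm mu))); first by ring.
transitivity ((expR (2^-1 * \sum_i tnth mu i ^+ 2) * expR (- aN * \sum_i tnth mu i) *
  expR (- (2^-1 * \sum_(i < n.+1) tnth l i ^+ 2)) * expR (aN * \sum_(i < n.+1) tnth l i)) *
  (W * V * (vdm l / vdm mu))); last by ring.
congr (_ * _); rewrite -!expRD; congr expR.
rewrite sumrN -opprD pole_resid_energy thead_pole_resid.
by ring.
Qed.

Lemma corner_constant_gt0 : 0 < corner_constant.
Proof.
by rewrite !mulr_gt0 ?expR_gt0 ?invr_gt0 ?vdm_gt0// powR_gt0// invr_gt0 exprn_gt0// vdm_gt0.
Qed.

End density_formula.

End closed_forms.

(** * Squared norms of blocks of Gaussian coordinates *)
Section gamma_blocks.
Variable R : realType.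
Local Notation leb := (@lebesgue_measure R).
Local Open Scope ereal_scope.

Definition tcat m n (s : m.-tuple R) (t : n.-tuple R) : (m + n).-tuple R := [tuple of s ++ t].

Lemma tcat_tcons m n x (s : m.-tuple R) (t : n.-tuple R) :
  tcat (tcons (x, s)) t = tcons (x, tcat s t) :> (m + n).+1.-tuple R.
Proof. exact: val_inj. Qed.

Lemma tnth_tcat_lshift m n (s : m.-tuple R) (t : n.-tuple R) i :
  tnth (tcat s t) (lshift n i) = tnth s i.
Proof. by rewrite !(tnth_nth 0%R) /= nth_cat size_tuple ltn_ord. Qed.

Lemma tnth_tcat_rshift m n (s : m.-tuple R) (t : n.-tuple R) i :
  tnth (tcat s t) (rshift m i) = tnth t i.
Proof. by rewrite !(tnth_nth 0%R) /= nth_cat size_tuple ltnNge leq_addr/= addKn. Qed.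

Lemma measurable_tcat m n d (T : measurableType d) (f : T -> m.-tuple R) (g : T -> n.-tuple R) :
  measurable_fun [set: T] f -> measurable_fun [set: T] g ->
  measurable_fun [set: T] (fun x => tcat (f x) (g x)).
Proof.
move=> mf mg; apply/measurable_fun_tnthP => i.
case: (split_ordP i) => j ->.
  rewrite (_ : _ \o _ = fun x => tnth (f x) j); first exact: measurable_fun_tnth.
  by apply/funext => x /=; rewrite tnth_tcat_lshift.
rewrite (_ : _ \o _ = fun x => tnth (g x) j); first exact: measurable_fun_tnth.
by apply/funext => x /=; rewrite tnth_tcat_rshift.
Qed.

Lemma integral_tcat m n (f : (m + n).-tuple R -> \bar R) :
  measurable_fun [set: (m + n).-tuple R] f -> (forall t, 0 <= f t) ->
  \int[lebesgue_tuple R (m + n)]_t f t =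
  \int[lebesgue_tuple R m]_s \int[lebesgue_tuple R n]_t f (tcat s t).
Proof.
elim: m f => [|m IH] f mf f0.
  have mg : measurable_fun [set: 0.-tuple R]
      (fun s : 0.-tuple R => \int[lebesgue_tuple R n]_t f (tcat s t)).
    rewrite (_ : (fun s => _) = cst (\int[lebesgue_tuple R n]_t f (tcat [tuple] t))) //.
    by apply/funext => s; rewrite (tuple0 s).
  rewrite integral_lebesgue_tuple0//; last by move=> s; apply: integral_ge0.
  by apply: eq_integral => t _; congr f; exact: val_inj.
have mg : measurable_fun [set: m.+1.-tuple R * n.-tuple R] (fun p => f (tcat p.1 p.2)).
  by apply: (measurableT_comp mf); exact: measurable_tcat.
have mh : measurable_fun [set: m.+1.-tuple R]
    (fun s => \int[lebesgue_tuple R n]_t f (tcat s t)).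
  exact: (@measurable_fun_fubini_tonelli_F _ _ _ _ _ (lebesgue_tuple R n) _ mg (fun p => f0 _)).
rewrite (integral_lebesgue_tupleS mh); last by move=> s; apply: integral_ge0.
rewrite (@integral_lebesgue_tupleS R (m + n) f mf f0).
apply: eq_integral => x _.
rewrite (IH (fun t => f (tcons (x, t))))//; last exact: measurable_tcons_section.
by apply: eq_integral => s _; apply: eq_integral => t _; rewrite tcat_tcons.
Qed.

Lemma tnorm2_tcat m n (s : m.-tuple R) (t : n.-tuple R) :
  tnorm2 (tcat s t) = (tnorm2 s + tnorm2 t)%R.
Proof.
rewrite /tnorm2 big_split_ord/=; congr (_ + _)%R; apply: eq_bigr => i _.
  by rewrite tnth_tcat_lshift.
by rewrite tnth_tcat_rshift.
Qed.

Lemma tnorm2_tcons n (p : R * n.-tuple R) : tnorm2 (tcons p) = (p.1 ^+ 2 + tnorm2 p.2)%R.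
Proof. exact: (sum_tcons (fun x => x ^+ 2)%R). Qed.

Local Notation ind x := ((0 < x)%R%:R%:E : \bar R).

Lemma measurable_ind : measurable_fun [set: R] (fun x : R => ind x).
Proof. by apply/measurable_EFinP; exact: measurable_ltr_indic. Qed.

Lemma integral_even (f : R -> \bar R) : measurable_fun [set: R] f -> (forall x, 0 <= f x) ->
  (forall x, f (- x)%R = f x) ->
  \int[leb]_x f x = 2%:E * \int[leb]_x (ind x * f x).
Proof.
move=> mf f0 fN.
have mif : measurable_fun [set: R] (fun x => ind x * f x).
  by apply: emeasurable_funM => //; exact: measurable_ind.
have mif' : measurable_fun [set: R] (fun x => ind (- x)%R * f (- x)%R).
  by apply: (measurableT_comp mif).
transitivity (\int[leb]_x (ind x * f x + ind (- x)%R * f (- x)%R)).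
  apply: (@eq_integral_off_pair _ 0%R 0%R) => //.
  - exact: emeasurable_funD.
  - by move=> x; rewrite adde_ge0// mule_ge0 ?lee_fin.
  - move=> x x0 _; rewrite fN oppr_gt0; have [h|h|h] := ltrgtP 0%R x.
    + by rewrite mul1e mul0e adde0.
    + by rewrite mul1e mul0e add0e.
    + by rewrite -h eqxx in x0.
rewrite ge0_integralD//.
- rewrite (@ge0_integral_reflect R (fun x => ind x * f x) mif).
    by rewrite mule_natl mule2n.
  by move=> x; rewrite mule_ge0 ?lee_fin.
- by move=> x _; rewrite mule_ge0 ?lee_fin.
- by move=> x _; rewrite mule_ge0 ?lee_fin.
Qed.

Lemma integral_square (f : R -> \bar R) : measurable_fun [set: R] f -> (forall x, 0 <= f x) ->
  \int[leb]_r (ind r * f r) = \int[leb]_x (ind x * (f (x ^+ 2)%R * (2 * x)%:E)).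
Proof.
move=> mf f0.
have oi : open_itv (`]0%R, +oo[ : interval R) by [].
have JE : `]0%R, +oo[%classic = (fun x : R => x ^+ 2)%R @` `]0%R, +oo[%classic.
  apply/seteqP; split => [r|r [x]] /=; rewrite !in_itv/= !andbT => h.
    exists (Num.sqrt r); first by rewrite in_itv/= andbT sqrtr_gt0.
    by rewrite sqr_sqrtr// ltW.
  by move=> <-; rewrite exprn_gt0.
have dF x : x \in (`]0%R, +oo[ : interval R) -> is_derive x 1%R (fun x => x ^+ 2)%R (2 * x)%R.
  move=> _; rewrite (_ : (fun x => _) = ((id : R -> R) * (id : R -> R))%R); last first.
    by apply/funext => y; rewrite expr2.
  apply: (is_derive_eq (is_deriveM (is_derive_id x 1%R) (is_derive_id x 1%R))).
  by rewrite /GRing.scale/= mulr1 mulr_natl mulr2n.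
have cf x : x \in (`]0%R, +oo[ : interval R) -> {for x, continuous (fun x : R => 2 * x : R)%R}.
  by move=> _; apply: mulrl_continuous.
have f20 x : x \in (`]0%R, +oo[ : interval R) -> (0 < 2 * x)%R.
  by rewrite in_itv/= andbT => x0; rewrite mulr_gt0.
have := ge0_integral_substitution_incr oi JE dF cf f20 mf f0.
rewrite integral_mkcond [X in _ = X -> _]integral_mkcond => E.
have mi (x : R) : (x \in `]0%R, +oo[%classic) = (0 < x)%R.
  by apply/idP/idP; rewrite inE /= in_itv/= andbT.
transitivity (\int[leb]_r (f \_ `]0%R, +oo[) r).
  by apply: eq_integral => r _; rewrite patchE mi; case: ifP; rewrite ?mul1e ?mul0e.
rewrite E; apply: eq_integral => r _; rewrite patchE mi.
by case: ifP; rewrite ?mul1e ?mul0e.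
Qed.

(** The squared norm of a vector with b coordinates has density k r^(b/2-1) on the
    positive half-line with respect to Lebesgue measure on both sides; k is half the
    area of the unit sphere. *)
Definition gamma_block (b : nat) (k : \bar R) : Prop :=
  forall phi : R -> \bar R, measurable_fun [set: R] phi -> (forall x, 0 <= phi x) ->
  \int[lebesgue_tuple R b]_w phi (tnorm2 w) =
  k * \int[leb]_r (ind r * (phi r * (r `^ (b%:R / 2 - 1))%:E)).

Lemma measurable_tnorm2_comp n (phi : R -> \bar R) : measurable_fun [set: R] phi ->
  measurable_fun [set: n.-tuple R] (fun w => phi (tnorm2 w)).
Proof. by move=> mphi; apply: (measurableT_comp mphi); exact: measurable_tnorm2. Qed.

Lemma gamma_block1 : gamma_block 1 1.
Proof.
move=> phi mphi phi0; rewrite mul1e.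
rewrite integral_lebesgue_tupleS//; last exact: measurable_tnorm2_comp.
have mphi2 : measurable_fun [set: R] (fun x : R => phi (x ^+ 2)%R).
  by apply: (measurableT_comp mphi); exact: measurable_funX.
transitivity (\int[leb]_x phi (x ^+ 2)%R).
  apply: eq_integral => x _; rewrite integral_lebesgue_tuple0//.
    by rewrite tnorm2_tcons/= /tnorm2 big_ord0 addr0.
  apply: (measurable_tcons_section (f := fun t => phi (tnorm2 t))).
  exact: measurable_tnorm2_comp.
rewrite (integral_even mphi2)//; last by move=> x; rewrite sqrrN.
rewrite (@integral_square (fun r => phi r * (r `^ (1%:R / 2 - 1))%:E)); last 2 first.
- by apply: emeasurable_funM => //; apply/measurable_EFinP; exact: measurable_powR.
- by move=> r; rewrite mule_ge0// lee_fin powR_ge0.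
rewrite -ge0_integralZl_EFin//; first last.
- by apply: emeasurable_funM => //; exact: measurable_ind.
- by move=> x _; rewrite mule_ge0 ?lee_fin.
apply: eq_integral => x _; have [x0|] := ltP 0%R x; last by rewrite !mul0e mule0.
rewrite !mul1e muleC -muleA -EFinM; congr (_ * _%:E).
rewrite -powR_mulrn ?ltW// -powRrM.
have -> : (2%:R * (1%:R / 2 - 1) = - 1 :> R)%R by field.
by rewrite powR_inv1 ?ltW//; field; rewrite gt_eqF.
Qed.

(** A substitute for polar coordinates: for fixed x > 0 put y = x t, then exchange the
    integrals and put r = x^2 (1 + t^2) for fixed t. *)
Lemma gamma_block2 : gamma_block 2 (\int[leb]_t ((1 + t ^+ 2)^-1)%:E).
Proof.
move=> phi mphi phi0.
have mp2 : measurable_fun [set: measurableTypeR R * measurableTypeR R]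
    (fun p : R * R => (p.1 ^+ 2 + p.2 ^+ 2)%R).
  by apply: measurable_funD; apply: measurable_funX; [exact: measurable_fst|exact: measurable_snd].
have mphi2 : measurable_fun [set: measurableTypeR R * measurableTypeR R]
    (fun p : R * R => phi (p.1 ^+ 2 + p.2 ^+ 2)%R).
  exact: (measurableT_comp mphi mp2).
rewrite integral_lebesgue_tupleS//; last exact: measurable_tnorm2_comp.
transitivity (\int[leb]_x \int[leb]_y phi (x ^+ 2 + y ^+ 2)%R).
  apply: eq_integral => x _; rewrite integral_lebesgue_tupleS//; last first.
    apply: (measurable_tcons_section (f := fun t => phi (tnorm2 t))).
    exact: measurable_tnorm2_comp.
  apply: eq_integral => y _; rewrite integral_lebesgue_tuple0//.
    by rewrite !tnorm2_tcons/= /tnorm2 big_ord0 addr0.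
  apply: (measurable_tcons_section (f := fun t => phi (tnorm2 (tcons (x, t))))).
  apply: (measurable_tcons_section (f := fun t => phi (tnorm2 t))).
  exact: measurable_tnorm2_comp.
have mF : measurable_fun [set: R] (fun x => \int[leb]_y phi (x ^+ 2 + y ^+ 2)%R).
  exact: (@measurable_fun_fubini_tonelli_F _ _ _ _ _ leb _ mphi2 (fun p => phi0 _)).
rewrite (integral_even mF); last 2 first.
- by move=> x; apply: integral_ge0.
- by move=> x; under eq_integral do rewrite sqrrN.
have my (x : R) : measurable_fun [set: R] (fun y => phi (x ^+ 2 + y ^+ 2)%R).
  exact: (measurableT_comp mphi2 (measurable_pair1 (x : measurableTypeR R))).
pose G (p : R * R) := ind p.1 * ((2 * p.1)%:E * phi (p.1 ^+ 2 * (1 + p.2 ^+ 2))%R).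
have mG : measurable_fun [set: measurableTypeR R * measurableTypeR R] G.
  have m1 : measurable_fun [set: measurableTypeR R * measurableTypeR R] (fst : _ -> R).
    exact: measurable_fst.
  have m2 : measurable_fun [set: measurableTypeR R * measurableTypeR R] (snd : _ -> R).
    exact: measurable_snd.
  apply: emeasurable_funM; first exact: (measurableT_comp measurable_ind m1).
  apply: emeasurable_funM; first by apply/measurable_EFinP; exact: measurable_funM.
  apply: (measurableT_comp mphi); apply: measurable_funM; first exact: measurable_funX.
  by apply: measurable_funD => //; exact: measurable_funX.
have G0 p : 0 <= G p.
  rewrite /G; have [h|h] := ltP 0%R p.1; last by rewrite mul0e.
  by rewrite mul1e mule_ge0// lee_fin mulr_ge0// ltW.
rewrite -ge0_integralZl_EFin//; last 2 first.
- by move=> x _; rewrite mule_ge0 ?lee_fin//; apply: integral_ge0.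
- by apply: emeasurable_funM => //; exact: measurable_ind.
transitivity (\int[leb]_x \int[leb]_t G (x, t)).
  apply: eq_integral => x _; rewrite /G/=; have [x0|] := ltP 0%R x; last first.
    by rewrite mul0e mule0 integral0_eq// => t _; rewrite mul0e.
  rewrite mul1e (ge0_integral_scale x0 (my x))// muleA -EFinM.
  rewrite -ge0_integralZl_EFin//; last 2 first.
  - exact: (measurableT_comp (my x) (measurable_funM _ _)).
  - by rewrite mulr_ge0// ltW.
  apply: eq_integral => t _; rewrite mul1e; congr (_ * phi _).
  by rewrite exprMn mulrDr mulr1.
rewrite (fubini_tonelli (m1 := leb) (m2 := leb) G mG G0).
pose C := \int[leb]_r (ind r * (phi r * (r `^ (2%:R / 2 - 1))%:E)).
transitivity (\int[leb]_t (((1 + t ^+ 2)^-1)%:E * C)); last first.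
  rewrite ge0_integralZr//.
  - by apply/measurable_EFinP; apply: measurable_fun_inv; apply: measurable_funD => //; exact: measurable_funX.
  - by move=> t _; rewrite lee_fin invr_ge0 addr_ge0// sqr_ge0.
  - apply: integral_ge0 => r _; rewrite mule_ge0 ?lee_fin// mule_ge0// lee_fin; exact: powR_ge0.
have p0 : (2%:R / 2 - 1 = 0 :> R)%R by field.
have CE : C = \int[leb]_r (ind r * phi r).
  by apply: eq_integral => r _; rewrite p0 powRr0 mule1.
apply: eq_integral => t _; rewrite /G/=.
have t0 : (0 < 1 + t ^+ 2)%R by rewrite ltr_pwDl// sqr_ge0.
have mpt : measurable_fun [set: R] (fun r => phi (r * (1 + t ^+ 2))%R).
  by apply: (measurableT_comp mphi); exact: measurable_funM.
transitivity (\int[leb]_r (ind r * phi (r * (1 + t ^+ 2))%R)).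
  rewrite (integral_square mpt)//.
  by apply: eq_integral => x _; rewrite [phi _ * _]muleC.
have mi : measurable_fun [set: R] (fun r => ind r * phi r).
  by apply: emeasurable_funM => //; exact: measurable_ind.
rewrite CE (ge0_integral_scale t0 mi); last by move=> r; rewrite mule_ge0 ?lee_fin.
rewrite muleA -EFinM mulVf ?gt_eqF// mul1e.
by apply: eq_integral => r _; rewrite pmulr_rgt0// mulrC.
Qed.

(** The sum of two independent squared norms with constant density has a density
    proportional to its value, the length of an interval. *)
Lemma gamma_block4 k : 0 <= k -> gamma_block 2 k -> gamma_block 4 (k * k).
Proof.
move=> k0 g2 phi mphi phi0.
have mt := @measurable_tnorm2_comp 4 phi mphi.
have p0 : (2%:R / 2 - 1 = 0 :> R)%R by field.
have g2' (psi : R -> \bar R) : measurable_fun [set: R] psi -> (forall x, 0 <= psi x) ->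
  \int[lebesgue_tuple R 2]_w psi (tnorm2 w) = k * \int[leb]_r (ind r * psi r).
  move=> mpsi psi0; rewrite (g2 _ mpsi psi0); congr (_ * _).
  by apply: eq_integral => r _; rewrite p0 powRr0 mule1.
rewrite (@integral_tcat 2 2 (fun w => phi (tnorm2 w)) mt)//.
have mshift (r : R) : measurable_fun [set: R] (fun s : R => phi (r + s)%R).
  by apply: (measurableT_comp mphi); exact: measurable_funD.
pose F (p : R * R) := ind p.2 * phi (p.1 + p.2)%R.
have m1 : measurable_fun [set: measurableTypeR R * measurableTypeR R] (fst : _ -> R).
  exact: measurable_fst.
have m2 : measurable_fun [set: measurableTypeR R * measurableTypeR R] (snd : _ -> R).
  exact: measurable_snd.
have mF : measurable_fun [set: measurableTypeR R * measurableTypeR R] F.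
  apply: emeasurable_funM; first exact: (measurableT_comp measurable_ind m2).
  by apply: (measurableT_comp mphi); exact: measurable_funD.
have F0 p : 0 <= F p by rewrite mule_ge0 ?lee_fin.
pose g r := \int[leb]_s F (r, s).
have mg : measurable_fun [set: R] g.
  exact: (@measurable_fun_fubini_tonelli_F _ _ _ _ _ leb _ mF F0).
have g0 r : 0 <= g r by apply: integral_ge0.
transitivity (\int[lebesgue_tuple R 2]_w (k * g (tnorm2 w))).
  apply: eq_integral => u _; under eq_integral do rewrite tnorm2_tcat.
  by rewrite (g2' (fun s => phi (tnorm2 u + s)%R)).
rewrite ge0_integralZl//; last first.
  by apply: (measurableT_comp mg); exact: measurable_tnorm2.
rewrite (g2' _ mg g0) muleA; congr (_ * _).
pose H (p : R * R) := ind p.1 * (ind (p.2 - p.1)%R * phi p.2).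
have mH : measurable_fun [set: measurableTypeR R * measurableTypeR R] H.
  apply: emeasurable_funM; first exact: (measurableT_comp measurable_ind m1).
  apply: emeasurable_funM; last exact: (measurableT_comp mphi m2).
  by apply: (measurableT_comp measurable_ind); exact: measurable_funB.
have H0 p : 0 <= H p by rewrite !mule_ge0 ?lee_fin.
transitivity (\int[leb]_r \int[leb]_q H (r, q)).
  apply: eq_integral => r _; rewrite /H/= ge0_integralZl//; last first.
  - by move=> q _; rewrite mule_ge0 ?lee_fin.
  - apply: emeasurable_funM => //.
    by apply: (measurableT_comp measurable_ind); exact: measurable_funB.
  congr (_ * _); rewrite /g /F/=.
  rewrite -(@ge0_integral_shift R r (fun q => ind (q - r)%R * phi q)).
  - by apply: eq_integral => s _; rewrite addrK addrC.
  - apply: emeasurable_funM => //.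
    by apply: (measurableT_comp measurable_ind); exact: measurable_funB.
  - by move=> q; rewrite mule_ge0 ?lee_fin.
rewrite (fubini_tonelli (m1 := leb) (m2 := leb) H mH H0).
apply: eq_integral => q _; rewrite /H/=.
have p1 : (4%:R / 2 - 1 = 1 :> R)%R by field.
rewrite p1; have [q0|q0] := ltP 0%R q; last first.
  rewrite mul0e integral0_eq// => r _; have [r0|] := ltP 0%R r; last by rewrite mul0e.
  by rewrite subr_gt0 ltNge (le_trans q0 (ltW r0))/= mul0e mule0.
rewrite mul1e powRr1 ?ltW//.
transitivity (\int[leb]_(r in `]0%R, q[) (phi q)).
  rewrite [RHS]integral_mkcond; apply: eq_integral => r _; rewrite patchE.
  have -> : (r \in `]0%R, q[%classic) = (0 < r)%R && (r < q)%R.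
    by apply/idP/idP; rewrite inE /= in_itv/=.
  by rewrite subr_gt0; case: (0 < r)%R; case: (r < q)%R; rewrite ?mul1e ?mul0e.
transitivity (phi q * leb `]0%R, q[%classic); first exact: integral_cst.
by rewrite lebesgue_measure_itv/= lte_fin q0 sube0.
Qed.

(** The total Gaussian mass sqrt(pi)^b is finite and positive, hence so is k. *)
Lemma gamma_block_constant b k : 0 <= k -> gamma_block b k -> exists2 c : R, (0 < c)%R & k = c%:E.
Proof.
move=> k0 /(_ (fun r => (expR (- r))%:E)) g.
have E : (Num.sqrt pi ^+ b)%:E = k * \int[leb]_r (ind r * ((expR (- r))%:E * (r `^ (b%:R / 2 - 1))%:E)).
  rewrite -g; first by rewrite integral_tgauss.
    2: by move=> x; rewrite lee_fin expR_ge0.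
  apply/measurable_EFinP; apply: measurableT_comp => //; exact: measurable_expR.
have P : 0 < k * \int[leb]_r (ind r * ((expR (- r))%:E * (r `^ (b%:R / 2 - 1))%:E)).
  by rewrite -E lte_fin exprn_gt0// sqrtr_gt0 pi_gt0.
move: E P; set I := (\int[leb]_r _) => E P.
have I0 : 0 <= I.
  by apply: integral_ge0 => r _; rewrite !mule_ge0 ?lee_fin// ?expR_ge0 ?powR_ge0.
have {}I0 : 0 < I.
  by rewrite lt0e I0 andbT; apply/eqP => I0'; move: P; rewrite I0' mule0 ltxx.
move: k0 E P {g}; case: k => [c| |] c0 E P //; last by move: E; rewrite gt0_mulye.
exists c => //; rewrite lt0r -lee_fin c0 andbT; apply/eqP => c0'.
by move: P; rewrite c0' mul0e ltxx.
Qed.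

Lemma gamma_block_exists b : b \in [:: 1; 2; 4]%N ->
  exists2 c : R, (0 < c)%R & gamma_block b c%:E.
Proof.
have k0 : 0 <= \int[leb]_t ((1 + t ^+ 2)^-1)%:E.
  by apply: integral_ge0 => t _; rewrite lee_fin invr_ge0 addr_ge0// sqr_ge0.
rewrite !inE => /or3P[] /eqP ->.
- by exists 1%R => //; exact: gamma_block1.
- have [c c0 E] := gamma_block_constant k0 gamma_block2.
  by exists c => //; rewrite -E; exact: gamma_block2.
- have g4 := gamma_block4 k0 gamma_block2.
  have [c c0 E] := gamma_block_constant (mule_ge0 k0 k0) g4.
  by exists c => //; rewrite -E.
Qed.

(** The index i * b + k is always less than n * b, so the default value of nth is never
    reached. *)
Definition bnorm (n b : nat) (w : (n * b).-tuple R) : n.-tuple R :=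
  [tuple (\sum_(k < b) (nth 0 w (i * b + k)) ^+ 2)%R | i < n].

Lemma bnorm_tcat n b (u : b.-tuple R) (v : (n * b).-tuple R) :
  bnorm (n := n.+1) (tcat u v) = tcons (tnorm2 u, bnorm v).
Proof.
apply: eq_from_tnth => i; rewrite tnth_mktuple; case: (unliftP ord0 i) => [j|] ->.
  rewrite tnth_tconsS tnth_mktuple; apply: eq_bigr => k _.
  by rewrite /= nth_cat size_tuple /bump/= add1n mulSn -addnA ltnNge leq_addr/= addKn.
rewrite tnth_tcons0; apply: eq_bigr => k _.
by rewrite /= nth_cat size_tuple mul0n add0n ltn_ord (tnth_nth 0%R).
Qed.

Lemma measurable_bnorm n b : measurable_fun [set: (n * b).-tuple R] (@bnorm n b).
Proof.
apply: measurable_mktuple => i; apply: measurable_sum => k; apply: measurable_funX.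
have [ik|ik] := ltnP (i * b + k) (n * b).
  rewrite (_ : (fun _ => _) = fun t : (n * b).-tuple R => tnth t (Ordinal ik)).
    exact: measurable_tnth.
  by apply/funext => t; rewrite (tnth_nth 0%R).
rewrite (_ : (fun _ => _) = cst 0%R) //.
by apply/funext => t; rewrite nth_default// size_tuple.
Qed.

(** Blockwise application of the definition of gamma_block. *)
Theorem integral_bnorm n b c (phi : n.-tuple R -> \bar R) : (0 < c)%R -> gamma_block b c%:E ->
  measurable_fun [set: n.-tuple R] phi -> (forall t, 0 <= phi t) ->
  \int[lebesgue_tuple R (n * b)]_w phi (bnorm w) =
  (c ^+ n)%:E * \int[lebesgue_tuple R n]_t
    ((tpos t)%:R%:E * (phi t * (\prod_i tnth t i `^ (b%:R / 2 - 1))%:E)).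
Proof.
move=> c0 gb; elim: n phi => [|n IH] phi mphi phi0.
  rewrite expr0 mul1e; apply: eq_integral => t _.
  rewrite (tuple0 (bnorm _)) (tuple0 t) big_ord0 mule1.
  by rewrite (_ : tpos _ = true) ?mul1e//; apply/forallP => -[].
have mprod k : measurable_fun [set: k.-tuple R]
    (fun t => (\prod_i tnth t i `^ (b%:R / 2 - 1))%:E : \bar R).
  apply/measurable_EFinP; apply: measurable_prod => i _.
  by apply: (measurableT_comp (measurable_powR _)); exact: measurable_tnth.
have prod0 k (t : k.-tuple R) : (0 <= \prod_i tnth t i `^ (b%:R / 2 - 1))%R.
  by apply: prodr_ge0 => i _; exact: powR_ge0.
have mpt k : measurable_fun [set: k.-tuple R] (fun t => (tpos t)%:R%:E : \bar R).
  by apply/measurable_EFinP; exact: measurable_tpos.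
have mb : measurable_fun [set: (b + n * b).-tuple R] (fun w => phi (bnorm (n := n.+1) w)).
  exact: (measurableT_comp mphi (@measurable_bnorm n.+1 b)).
rewrite (@integral_tcat b (n * b) (fun w => phi (bnorm (n := n.+1) w)) mb)//.
have msec (x : R) : measurable_fun [set: n.-tuple R] (fun t => phi (tcons (x, t))).
  exact: measurable_tcons_section.
transitivity (\int[lebesgue_tuple R b]_u ((c ^+ n)%:E * \int[lebesgue_tuple R n]_t
   ((tpos t)%:R%:E * (phi (tcons (tnorm2 u, t)) * (\prod_i tnth t i `^ (b%:R / 2 - 1))%:E)))).
  apply: eq_integral => u _; under eq_integral do rewrite bnorm_tcat.
  by rewrite (IH (fun t => phi (tcons (tnorm2 u, t)))).
pose F (p : R * n.-tuple R) := (tpos p.2)%:R%:E *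
   (phi (tcons (p.1, p.2)) * (\prod_i tnth p.2 i `^ (b%:R / 2 - 1))%:E).
have F0 p : 0 <= F p by rewrite !mule_ge0 ?lee_fin.
have m2 : measurable_fun [set: measurableTypeR R * n.-tuple R] snd by exact: measurable_snd.
have m1 : measurable_fun [set: measurableTypeR R * n.-tuple R] (fst : _ -> R) by exact: measurable_fst.
have mF : measurable_fun [set: measurableTypeR R * n.-tuple R] F.
  apply: emeasurable_funM; first exact: (measurableT_comp (mpt n) m2).
  apply: emeasurable_funM; last exact: (measurableT_comp (mprod n) m2).
  by apply: (measurableT_comp mphi); exact: measurable_tcons_pair.
pose h (r : R) := \int[lebesgue_tuple R n]_t F (r, t).
have h0 r : 0 <= h r by apply: integral_ge0.
have mh : measurable_fun [set: R] h.
  exact: (@measurable_fun_fubini_tonelli_F _ _ _ _ _ (lebesgue_tuple R n) _ mF F0).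
transitivity ((c ^+ n)%:E * \int[lebesgue_tuple R b]_u h (tnorm2 u)).
  rewrite -ge0_integralZl_EFin//; last 2 first.
  - exact: measurable_tnorm2_comp.
  - by rewrite exprn_ge0// ltW.
rewrite (gb h mh h0) muleA -EFinM -exprSr; congr (_ * _).
pose g (t : n.+1.-tuple R) := (tpos t)%:R%:E * (phi t * (\prod_i tnth t i `^ (b%:R / 2 - 1))%:E).
have mg : measurable_fun [set: n.+1.-tuple R] g.
  apply: emeasurable_funM; first exact: mpt.
  by apply: emeasurable_funM; [exact: mphi|exact: mprod].
have g0 t : 0 <= g t by rewrite !mule_ge0 ?lee_fin.
rewrite -/g (integral_lebesgue_tupleS mg g0).
apply: eq_integral => r _.
have [r0|r0] := ltP 0%R r; last first.
  rewrite mul0e integral0_eq// => t _; rewrite /g tpos_tcons/=.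
  by rewrite ltNge r0 mul0e.
rewrite mul1e /h -ge0_integralZr//; last 2 first.
- exact: (measurableT_comp mF (measurable_pair1 (r : measurableTypeR R))).
- by rewrite lee_fin powR_ge0.
apply: eq_integral => t _; rewrite /F /g/= tpos_tcons r0/= (prod_tcons (fun x : R => x `^ (b%:R / 2 - 1))%R)/=.
by rewrite -!muleA -EFinM [(_ * r `^ _)%R]mulrC.
Qed.

End gamma_blocks.

(** * Arrow polynomials *)
Section polynomial_tools.

(** Rational identities need to be checked away from the poles only: there remain
    infinitely many natural numbers. *)
Lemma poly_eq_nat (F : numFieldType) (p q : {poly F}) (s : seq F) :
  (forall k : nat, k%:R \notin s -> p.[k%:R] = q.[k%:R]) -> p = q.
Proof.
move=> pq; apply/eqP; rewrite -subr_eq0; apply/negP => /negP d0.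
pose r := (p - q) * \prod_(a <- s) ('X - a%:P).
have r0 : r != 0 by rewrite mulf_neq0// monic_neq0// monic_prod_XsubC.
pose t := [seq k%:R : F | k <- iota 0 (size r)].
have ut : uniq t by rewrite map_inj_uniq ?iota_uniq//; exact: mulrIn (oner_neq0 F).
have rt : all (root r) t.
  apply/allP => _ /mapP[k _ ->]; rewrite /root /r hornerM.
  have [ks|ks] := boolP (k%:R \in s).
    by rewrite mulf_eq0 -[X in _ || X]/(root _ _) root_prod_XsubC ks orbT.
  by rewrite !hornerE pq// subrr mul0r.
by have := max_poly_roots r0 rt ut; rewrite size_map size_iota ltnn.
Qed.

Lemma horner_char_poly (R : comNzRingType) n (A : 'M[R]_n) z :
  (char_poly A).[z] = \det (z%:M - A).
Proof.
rewrite /char_poly -[LHS]/(horner_eval z _) -det_map_mx; congr (\det _).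
apply/matrixP => i j; rewrite !mxE /= /horner_eval !hornerE.
by rewrite hornerMn hornerX.
Qed.

(** An injective reindexing is a permutation of rows and columns; it may change the
    index type, so that n + 1 is written as n.+1. *)
Lemma det_mxsub_inj (R : comNzRingType) m m' (f : 'I_m -> 'I_m') (A : 'M[R]_m') :
  m = m' -> injective f -> \det (mxsub f f A) = \det A.
Proof.
move=> e; move: f A; rewrite -e => f A fi.
pose s := perm fi.
rewrite (_ : mxsub f f A = row_perm s (col_perm s A)); last first.
  by apply/matrixP => i j; rewrite !mxE /s !permE.
rewrite row_permE col_permE !det_mulmx !det_perm odd_permV.
by rewrite mulrCA -signr_addb addbb mulr1.
Qed.

Lemma det_schur (F : fieldType) n k (A : 'M[F]_n) (u : 'M[F]_(n, k)) (v : 'M[F]_(k, n)) (d : 'M[F]_k) :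
  A \in unitmx -> \det (block_mx A u v d) = \det A * \det (d - v *m invmx A *m u).
Proof.
move=> uA.
have -> : block_mx A u v d = block_mx 1%:M 0 (v *m invmx A) 1%:M *m
    block_mx A u 0 (d - v *m invmx A *m u).
  rewrite mulmx_block !mul1mx !mul0mx !addr0 mulmxKV//.
  by congr block_mx; rewrite addrC subrK.
by rewrite det_mulmx det_lblock det_ublock !det1 !mul1r.
Qed.

End polynomial_tools.

Section arrow_polynomial.
Variable F : fieldType.

(** The characteristic polynomial of a matrix with diagonal mu_1, ..., mu_n, x whose
    only other nonzero entries are in the last row and column, r_i being the
    product of the two entries in row i and column i. *)
Definition arrow_poly n (mu : 'I_n -> F) (x : F) (r : 'I_n -> F) : {poly F} :=
  ('X - x%:P) * \prod_(i < n) ('X - (mu i)%:P) -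
  \sum_(i < n) (r i)%:P * \prod_(k < n | k != i) ('X - (mu k)%:P).

Lemma horner_arrow_poly n (mu : 'I_n -> F) x r z : (forall i, z != mu i) ->
  (arrow_poly mu x r).[z] =
  \prod_i (z - mu i) * (z - x - \sum_i r i / (z - mu i)).
Proof.
move=> zmu; rewrite /arrow_poly !hornerE horner_prod.
under eq_bigr do rewrite hornerXsubC.
rewrite mulrBr mulrC; congr (_ - _).
rewrite horner_sum mulr_sumr; apply: eq_bigr => i _.
rewrite hornerM hornerC horner_prod; under eq_bigr do rewrite hornerXsubC.
rewrite [in RHS](bigD1 i)//=.
have h : z - mu i != 0 by rewrite subr_eq0.
by field.
Qed.

Lemma size_prod_XsubC_ord n (mu : 'I_n -> F) :
  size (\prod_(i < n) ('X - (mu i)%:P)) = n.+1.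
Proof. by rewrite size_prod_XsubC -[RHS]/(n.+1) /index_enum -enumT size_enum_ord. Qed.

Lemma arrow_poly_monic_size n (mu : 'I_n -> F) x r :
  arrow_poly mu x r \is monic /\ size (arrow_poly mu x r) = n.+2.
Proof.
have m0 : \prod_(i < n) ('X - (mu i)%:P) \is monic by exact: monic_prod_XsubC.
have m1 : ('X - x%:P) * \prod_(i < n) ('X - (mu i)%:P) \is monic.
  by rewrite monicMl// monicXsubC.
have s1 : size (('X - x%:P) * \prod_(i < n) ('X - (mu i)%:P)) = n.+2.
  by rewrite size_monicM ?monicXsubC ?monic_neq0// size_XsubC size_prod_XsubC_ord.
have s2 : (size (- \sum_(i < n) (r i)%:P * \prod_(k < n | k != i) ('X - (mu k)%:P)) < n.+2)%N.
  rewrite size_polyN ltnS; apply: (leq_trans (size_sum _ _ _)); apply/bigmax_leqP => i _.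
  rewrite mul_polyC; apply: (leq_trans (size_scale_leq _ _)).
  rewrite size_prod; last by move=> k _; rewrite polyXsubC_eq0.
  under eq_bigr do rewrite size_XsubC.
  rewrite sum_nat_const muln2 -addnn -addSn addnK.
  by rewrite -[X in (_ <= X.+1)%N]card_ord ltnS max_card.
rewrite -[X in (_ < X)%N]s1 in s2.
by rewrite /arrow_poly monicE lead_coefDl// size_polyDl// s1 -monicE.
Qed.

End arrow_polynomial.

Lemma map_arrow_poly (F K : fieldType) (f : {rmorphism F -> K}) n (mu r : 'I_n -> F) x :
  map_poly f (arrow_poly mu x r) = arrow_poly (f \o mu) (f x) (f \o r).
Proof.
rewrite /arrow_poly rmorphB rmorphM rmorph_sum/= rmorphB/= map_polyX map_polyC rmorph_prod/=.
congr (_ * _ - _); first by apply: eq_bigr => i _; rewrite rmorphB/= map_polyX map_polyC.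
apply: eq_bigr => i _; rewrite rmorphM/= map_polyC rmorph_prod/=; congr (_ * _).
by apply: eq_bigr => k _; rewrite rmorphB/= map_polyX map_polyC.
Qed.

Section real_roots.
Variable R : realType.
Local Open Scope complex_scope.
Local Notation C := R[i].

Lemma ImD (x y : C) : complex.Im (x + y) = complex.Im x + complex.Im y.
Proof. by case: x y => [a b] [c d]. Qed.

Lemma ImB (x y : C) : complex.Im (x - y) = complex.Im x - complex.Im y.
Proof. by case: x y => [a b] [c d]. Qed.

Lemma Im_sum (I : Type) (s : seq I) (P : pred I) (G : I -> C) :
  complex.Im (\sum_(i <- s | P i) G i) = \sum_(i <- s | P i) complex.Im (G i).
Proof. exact: (big_morph _ ImD). Qed.

Lemma ReD (x y : C) : complex.Re (x + y) = complex.Re x + complex.Re y.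
Proof. by case: x y => [a b] [c d]. Qed.

Lemma Re_sum (I : Type) (s : seq I) (P : pred I) (G : I -> C) :
  complex.Re (\sum_(i <- s | P i) G i) = \sum_(i <- s | P i) complex.Re (G i).
Proof. exact: (big_morph _ ReD). Qed.

(** At a nonreal z the imaginary part of z - x - sum_i r_i / (z - mu_i) is Im z times
    1 + sum_i r_i / |z - mu_i|^2, so it does not vanish. *)
Lemma arrow_poly_root_real n (mu r : 'I_n -> R) x (z : C) : (forall i, 0 <= r i) ->
  root (map_poly (real_complex R) (arrow_poly mu x r)) z -> complex.Im z = 0.
Proof.
case: z => a b r0; rewrite map_arrow_poly /root => rz /=.
apply/eqP/negPn/negP => b0.
have zmu i : a +i* b != (mu i)%:C by rewrite eq_complex/= (negbTE b0) andbF.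
move: rz; rewrite horner_arrow_poly//= mulf_eq0 => /orP[|].
  by rewrite prodf_seq_eq0 => /hasP[i _]/=; rewrite subr_eq0 (negbTE (zmu i)).
move=> /eqP/(congr1 (@complex.Im R)).
rewrite !ImB Im_sum/= subr0.
rewrite (eq_bigr (fun i => - (b * (r i / ((a - mu i) ^+ 2 + b ^+ 2))))); last first.
  by move=> i _; rewrite /= ?subr0 mul0r addr0 mulrN mulrCA.
rewrite sumrN opprK -mulr_sumr -{1}[b]mulr1 -mulrDr => /eqP.
rewrite mulf_eq0 (negbTE b0)/= gt_eqF// ltr_pwDl// sumr_ge0// => i _.
by rewrite divr_ge0// addr_ge0// sqr_ge0.
Qed.

Lemma sorted_roots_unique n (s t : n.-tuple R) : sorted >=%R s -> sorted >=%R t ->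
  \prod_(x <- s) ('X - x%:P) = \prod_(x <- t) ('X - x%:P) -> s = t.
Proof.
move=> ss st /prod_XsubC_eq pst; apply: val_inj.
apply: (sorted_eq _ _ ss st pst); last first.
  by move=> a b /andP[ab ba]; apply/eqP; rewrite eq_le; apply/andP; split.
by move=> a b c /= ba cb; exact: le_trans cb ba.
Qed.

(** This provides the eigenvalues of every self-adjoint matrix, by induction on the
    size, for the three values of b at once. *)
Lemma arrow_poly_split n (mu r : 'I_n -> R) x : (forall i, 0 <= r i) ->
  exists s : n.+1.-tuple R, sorted >=%R s /\
    arrow_poly mu x r = \prod_(a <- s) ('X - a%:P).
Proof.
move=> r0; have [mp sp] := arrow_poly_monic_size mu x r.
set p := arrow_poly mu x r in mp sp *.
have [zs pE] := closed_field_poly_normal (map_poly (real_complex R) p).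
have mpC : map_poly (real_complex R) p \is monic by rewrite map_monic.
rewrite (monicP mpC) scale1r in pE.
have zE : zs = map (real_complex R) (map (@complex.Re R) zs).
  rewrite -map_comp -[LHS]map_id; apply/eq_in_map => z zzs /=.
  have : complex.Im z = 0.
    by apply: (arrow_poly_root_real (mu := mu) (r := r) (x := x)) => //; rewrite -/p pE root_prod_XsubC.
  by case: z {zzs} => a b /= ->.
have pE' : p = \prod_(a <- map (@complex.Re R) zs) ('X - a%:P).
  apply: (map_poly_inj (real_complex R)); rewrite pE {1}zE rmorph_prod/= [LHS]big_map.
  by apply: eq_bigr => a _; rewrite rmorphB/= map_polyX map_polyC.
have sz : size (sort >=%R (map (@complex.Re R) zs)) == n.+1.
  rewrite size_sort; apply/eqP; apply: succn_inj.
  by rewrite -sp pE' size_prod_XsubC.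
exists (Tuple sz); split => /=.
  by apply: sort_sorted => a b; exact: le_total.
rewrite pE'; apply: perm_big; rewrite perm_sym; exact/permPl/perm_sort.
Qed.

End real_roots.

(** * The spectral theorem for real symmetric matrices *)
Section spectral.
Variable R : realType.

Lemma mulmx_row_norm n (u : 'rV[R]_n) : (u *m u^T) 0 0 = \sum_i u 0 i ^+ 2.
Proof. by rewrite mxE; apply: eq_bigr => i _; rewrite mxE expr2. Qed.

Lemma row_norm_eq0 n (u : 'rV[R]_n) : ((u *m u^T) 0 0 == 0) = (u == 0).
Proof.
apply/idP/eqP => [|->]; last by rewrite mul0mx mxE.
rewrite mulmx_row_norm psumr_eq0 => [/allP h|i _]; last exact: sqr_ge0.
apply/rowP => i; rewrite mxE; apply/eqP; rewrite -sqrf_eq0.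
by apply: h; rewrite mem_index_enum.
Qed.

(** The reflection that exchanges the first basis vector and u. *)
Lemma orthogonal_with_first_row n (u : 'rV[R]_n.+1) : (u *m u^T) 0 0 = 1 ->
  exists Q : 'M[R]_n.+1, Q *m Q^T = 1%:M /\ delta_mx 0 0 *m Q = u.
Proof.
move=> u1; pose e : 'rV[R]_n.+1 := delta_mx 0 0.
have [eu|ne] := eqVneq e u.
  by exists 1%:M; rewrite trmx1 !mulmx1.
pose w := e - u; pose s := (w *m w^T) 0 0.
have s0 : s != 0 by rewrite row_norm_eq0 subr_eq0.
pose W := w^T *m w; pose P := 1%:M - (2 / s) *: W.
have ww : w *m w^T = s%:M by rewrite [LHS]mx11_scalar.
have Psym : P^T = P by rewrite /P linearB/= linearZ/= trmx_mul trmxK trmx1.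
have WW : W *m W = s *: W.
  by rewrite /W mulmxA -(mulmxA _ w) ww mul_mx_scalar -scalemxAl.
have PP : P *m P = 1%:M.
  rewrite /P mulmxBl mul1mx mulmxBr mulmx1 -scalemxAl -scalemxAr WW !scalerA.
  by apply/matrixP => i j; rewrite !mxE; field.
exists P; split; first by rewrite Psym.
have eu11 : e *m u^T = ((e *m u^T) 0 0)%:M by rewrite [LHS]mx11_scalar.
set t := (e *m u^T) 0 0 in eu11.
have ue11 : u *m e^T = t%:M by rewrite -[LHS]trmxK trmx_mul trmxK eu11 tr_scalar_mx.
have ee : e *m e^T = 1%:M by rewrite /e trmx_delta mul_delta_mx; apply/matrixP => i j; rewrite !mxE !ord1 !eqxx.
have uu : u *m u^T = 1%:M by rewrite [LHS]mx11_scalar u1.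
have sE : s = 2 - 2 * t.
  by rewrite /s /w linearB/= mulmxBl !mulmxBr eu11 ue11 ee uu !mxE !eqxx /= !mulr1n; ring.
have ew : e *m w^T = (1 - t)%:M.
  by rewrite /w linearB/= mulmxBr ee eu11; apply/matrixP => i j; rewrite !mxE !ord1 !mulr1n.
rewrite -/e /P mulmxBr mulmx1 -scalemxAr mulmxA ew mul_scalar_mx scalerA.
have -> : 2 / s * (1 - t) = 1 by move: s0; rewrite sE => s0; field.
by rewrite scale1r opprB addrC subrK.
Qed.

Lemma char_poly_conj m (A Q : 'M[R]_m) : Q *m Q^T = 1%:M ->
  char_poly (Q *m A *m Q^T) = char_poly A.
Proof.
move=> QQ; apply: (@poly_eq_nat _ _ _ [::]) => k _; rewrite !horner_char_poly.
have -> : k%:R%:M - Q *m A *m Q^T = Q *m (k%:R%:M - A) *m Q^T.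
  rewrite mulmxBr mulmxBl; congr (_ - _).
  by rewrite -mulmxA mul_scalar_mx -scalemxAr QQ scale_scalar_mx mulr1.
by rewrite !det_mulmx mulrAC -det_mulmx QQ det1 mul1r.
Qed.

(** The eigenvalues may be listed in any order, which makes it possible to group
    repeated ones into consecutive blocks. By induction: a unit eigenvector is taken
    as the first row of an orthogonal matrix, which splits off a block of size 1. *)
Lemma spectral_sym m (A : 'M[R]_m) (nu : 'I_m -> R) : A^T = A ->
  char_poly A = \prod_i ('X - (nu i)%:P) ->
  exists Q : 'M[R]_m, Q *m Q^T = 1%:M /\ Q *m A *m Q^T = diag_mx (\row_i nu i).
Proof.
elim: m A nu => [|m IH] A nu sA cA.
  by exists 1%:M; split; apply/matrixP; case.
have : eigenvalue A (nu 0).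
  by rewrite eigenvalue_root_char cA /root horner_prod (bigD1 0)//= hornerXsubC subrr mul0r.
case/eigenvalueP => v0 vA v0n0.
pose s := (v0 *m v0^T) 0 0.
have sp : 0 < s.
  rewrite lt_neqAle eq_sym row_norm_eq0 v0n0/= /s mulmx_row_norm sumr_ge0// => i _; exact: sqr_ge0.
pose v := (Num.sqrt s)^-1 *: v0.
have v1 : (v *m v^T) 0 0 = 1.
  rewrite /v linearZ/= -scalemxAl -scalemxAr scalerA mxE -/s -invfM -expr2 sqr_sqrtr ?ltW//.
  by rewrite mulVf ?gt_eqF.
have vAv : v *m A = nu 0 *: v by rewrite /v -scalemxAl vA !scalerA mulrC.
have [Q [QQ eQ]] := orthogonal_with_first_row v1.
have QtQ : Q^T *m Q = 1%:M by exact: mulmx1C.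
pose B : 'M[R]_(1 + m) := Q *m A *m Q^T.
have sB : B^T = B by rewrite /B !trmx_mul trmxK sA mulmxA.
have row0 : delta_mx (0 : 'I_1) (0 : 'I_m.+1) *m B = nu 0 *: delta_mx 0 0.
  by rewrite /B 2!mulmxA eQ vAv -scalemxAl -eQ -mulmxA QQ mulmx1.
have B0 j : B 0 j = nu 0 * (j == 0)%:R.
  have := congr1 (fun M : 'rV[R]_m.+1 => M 0 j) row0.
  by rewrite -rowE !mxE/= => ->.
have BE : B = block_mx (nu 0)%:M 0 0 (drsubmx B).
  clearbody B; rewrite -[LHS]submxK; congr block_mx; apply/matrixP => i j; rewrite !mxE !ord1.
  - by rewrite (_ : lshift m 0 = 0) ?B0 ?eqxx ?mulr1//; exact: val_inj.
  - by rewrite (_ : lshift m 0 = 0) ?B0 ?mulr0//; exact: val_inj.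
  - rewrite -sB mxE (_ : lshift m 0 = 0) ?B0 ?mulr0//; exact: val_inj.
have cB : \prod_i ('X - (nu i)%:P) = char_poly B by rewrite -cA; exact/esym/char_poly_conj.
have cD : char_poly (drsubmx B) = \prod_i ('X - (nu (lift ord0 i))%:P).
  have X0 : 'X - (nu 0)%:P != 0 by rewrite polyXsubC_eq0.
  (* the characteristic polynomial of the first block of size 1 is cancelled *)
  apply: (mulfI X0); rewrite big_ord_recl/= in cB; rewrite cB [in RHS]BE /char_poly char_block_diag_mx det_lblock.
  by congr (_ * _); rewrite det_mx11 !mxE !eqxx.
have sD : (drsubmx B)^T = drsubmx B by rewrite (@trmx_drsub _ 1 m 1 m) sB.
have [Q' [QQ' dD]] := IH _ _ sD cD.
pose Q2 : 'M[R]_(1 + m) := block_mx 1%:M 0 0 Q'.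
have QQ2 : Q2 *m Q2^T = 1%:M.
  rewrite /Q2 (@tr_block_mx _ 1 m 1 m) (@mulmx_block _ 1 m 1 m 1 m) !trmx0 !mulmx0 !mul0mx trmx1 mulmx1 !addr0 !add0r QQ'.
  by rewrite -scalar_mx_block.
exists (Q2 *m Q); split.
  by rewrite trmx_mul mulmxA -(mulmxA Q2) QQ mulmx1.
rewrite trmx_mul; have -> : Q2 *m Q *m A *m (Q^T *m Q2^T) = Q2 *m B *m Q2^T by rewrite /B !mulmxA.
rewrite BE /Q2 (@tr_block_mx _ 1 m 1 m) !(@mulmx_block _ 1 m 1 m 1 m) !trmx0 trmx1 !(mulmx0, mul0mx, mulmx1, mul1mx, addr0, add0r) dD.
apply/matrixP => i j; rewrite !mxE.
case: splitP => i' ii; rewrite ?mxE; case: splitP => j' jj; rewrite !mxE.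
- by rewrite !ord1 -!val_eqE/= ii jj !ord1 /= (_ : i = 0)//; apply: val_inj; rewrite /= ii ord1.
- by rewrite -val_eqE/= ii jj ord1.
- by rewrite -val_eqE/= ii jj ord1.
- rewrite -!val_eqE/= ii jj /= !add1n eqSS (_ : lift ord0 i' = i)//.
  by apply: val_inj; rewrite /= ii.
Qed.

End spectral.

(** * Resolvents of symmetric matrices with repeated eigenvalues *)
Section blocks.
Variables (n b : nat).

Lemma bidx_subproof (i : 'I_n) (k : 'I_b) : (i * b + k < n * b)%N.
Proof.
apply: (@leq_trans (i.+1 * b)); first by rewrite mulSn addnC ltn_add2r.
by rewrite leq_mul2r ltn_ord orbT.
Qed.

Definition bidx (i : 'I_n) (k : 'I_b) : 'I_(n * b) := Ordinal (bidx_subproof i k).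

Lemma bidx_inj i k i' k' : bidx i k = bidx i' k' -> i = i' /\ k = k'.
Proof.
move=> /(congr1 val)/= e.
have b0 : (0 < b)%N by exact: leq_ltn_trans (ltn_ord k).
have ei : i = i' :> nat.
  by have := congr1 (fun m => m %/ b)%N e; rewrite !divnMDl// !divn_small// !addn0.
by split; apply: val_inj => //; move: e; rewrite ei => /addnI.
Qed.

Lemma big_bidx (T : Type) (idx : T) (op : Monoid.com_law idx) (F : 'I_(n * b) -> T) :
  \big[op/idx]_j F j = \big[op/idx]_(i < n) \big[op/idx]_(k < b) F (bidx i k).
Proof.
rewrite pair_big/= (reindex (fun p : 'I_n * 'I_b => bidx p.1 p.2))//=.
apply: onW_bij; apply: inj_card_bij => [[i k] [i' k'] /= /bidx_inj[-> ->]//|].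
by rewrite card_prod !card_ord.
Qed.

Lemma bdiv_subproof (j : 'I_(n * b)) : (j %/ b < n)%N.
Proof.
rewrite ltn_divLR; first exact: ltn_ord.
by case: (posnP b) j => // -> [j]; rewrite muln0.
Qed.

Definition bdiv (j : 'I_(n * b)) : 'I_n := Ordinal (bdiv_subproof j).

Lemma bidxK (i : 'I_n) (k : 'I_b) : bdiv (bidx i k) = i.
Proof.
have b0 : (0 < b)%N by exact: leq_ltn_trans (ltn_ord k).
by apply: val_inj; rewrite /= divnMDl// divn_small// addn0.
Qed.

Lemma bmod_subproof (j : 'I_(n * b)) : (j %% b < b)%N.
Proof. by rewrite ltn_mod; case: (posnP b) j => // -> [j]; rewrite muln0. Qed.

Definition bmod (j : 'I_(n * b)) : 'I_b := Ordinal (bmod_subproof j).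

Lemma bidx_mod (i : 'I_n) (k : 'I_b) : bmod (bidx i k) = k.
Proof. by apply: val_inj; rewrite /= modnMDl modn_small. Qed.

End blocks.

Section resolvent.
Variable R : realType.

Lemma resolvent_spectral m (A Q : 'M[R]_m) (nu : 'I_m -> R) z : Q *m Q^T = 1%:M ->
  Q *m A *m Q^T = diag_mx (\row_i nu i) -> (forall i, z != nu i) ->
  forall v : 'rV_m, (v *m invmx (z%:M - A) *m v^T) 0 0 = \sum_j (v *m Q^T) 0 j ^+ 2 / (z - nu j).
Proof.
move=> QQ dA zn v; have QtQ : Q^T *m Q = 1%:M by exact: mulmx1C.
pose E := Q^T *m diag_mx (\row_i (z - nu i)^-1) *m Q.
have AE : z%:M - A = Q^T *m diag_mx (\row_i (z - nu i)) *m Q.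
  have -> : diag_mx (\row_i (z - nu i)) = Q *m (z%:M - A) *m Q^T.
    rewrite mulmxBr mulmxBl dA mul_mx_scalar -scalemxAl QQ scale_scalar_mx mulr1.
    by apply/matrixP => i j; rewrite !mxE mulrnBl.
  by rewrite !mulmxA QtQ mul1mx -mulmxA QtQ mulmx1.
have AEE : (z%:M - A) *m E = 1%:M.
  rewrite AE /E !mulmxA -(mulmxA _ Q) QQ mulmx1 -(mulmxA Q^T) mulmx_diag.
  rewrite (_ : diag_mx _ = 1%:M) ?mulmx1//; apply/matrixP => i j; rewrite !mxE.
  by rewrite mulfV// subr_eq0.
have -> : invmx (z%:M - A) = E.
  have [uA _] := mulmx1_unit AEE.
  by rewrite -[RHS]mul1mx -(mulVmx uA) -mulmxA AEE mulmx1.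
have -> : v *m E *m v^T = (v *m Q^T) *m diag_mx (\row_i (z - nu i)^-1) *m (v *m Q^T)^T.
  by rewrite trmx_mul trmxK /E !mulmxA.
rewrite mxE; apply: eq_bigr => j _.
by rewrite mul_mx_diag !mxE expr2; ring.
Qed.

(** The real coordinates of the last column of a matrix are read off from a tuple in
    some order and with some signs, which is an orthogonal change of basis. *)
Lemma signed_perm_mx m m' (s : 'I_m -> 'I_m') (sg : 'I_m -> R) : m = m' -> injective s ->
  (forall c, sg c ^+ 2 = 1) ->
  exists S : 'M[R]_(m', m), S *m S^T = 1%:M /\
    forall w : m'.-tuple R, trow w *m S = \row_c (sg c * tnth w (s c)).
Proof.
move=> e; move: s; rewrite -{}e => s si sg1.
pose S : 'M[R]_m := \matrix_(j, c) (sg c * (j == s c)%:R).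
exists S; split.
  apply: mulmx1C; apply/matrixP => i j; rewrite !mxE (bigD1 (s i))//= !mxE eqxx mulr1 big1 ?addr0.
    rewrite inj_eq//; case: eqVneq => [->|]; first by rewrite mulr1 -expr2 sg1.
    by rewrite !mulr0.
  by move=> k ki; rewrite !mxE (negbTE ki) mulr0 mul0r.
move=> w; apply/rowP => c; rewrite !mxE (bigD1 (s c))//= big1 ?addr0.
  by rewrite !mxE eqxx mulr1 mulrC.
by move=> k kc; rewrite !mxE (negbTE kc) !mulr0.
Qed.

(** When every eigenvalue mu_i of L has multiplicity b, the b coordinates of a vector in
    the corresponding eigenspace contribute to the resolvent with the same
    denominator. The basis depends on L only, not on the vector. *)
Lemma resolvent_blocks n b m (L : 'M[R]_m) (mu : 'I_n -> R) (s : 'I_m -> 'I_(n * b)) (sg : 'I_m -> R) :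
  m = (n * b)%N -> injective s -> (forall c, sg c ^+ 2 = 1) ->
  L^T = L -> char_poly L = (\prod_i ('X - (mu i)%:P)) ^+ b ->
  exists Q : 'M[R]_(n * b), Q *m Q^T = 1%:M /\
    forall (w : (n * b).-tuple R) z, (forall i, z != mu i) ->
    let v := \row_c (sg c * tnth w (s c)) in
    (v *m invmx (z%:M - L) *m v^T) 0 0 = \sum_i tnth (bnorm (tmul w Q)) i / (z - mu i).
Proof.
move=> mE si sg1 sL cL; have [S [SS Sw]] := signed_perm_mx mE si sg1.
move: L sL cL s si sg sg1 S SS Sw; rewrite mE => {m mE} L sL cL s si sg sg1 S SS Sw.
have cL' : char_poly L = \prod_(j < n * b) ('X - (mu (bdiv j))%:P).
  rewrite cL big_bidx/= -prodrXl; apply: eq_bigr => i _.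
  by under [RHS]eq_bigr do rewrite bidxK; rewrite prodr_const card_ord.
have [Q [QQ dQ]] := spectral_sym sL cL'.
exists (S *m Q^T); split.
  by rewrite trmx_mul trmxK mulmxA -(mulmxA S) (mulmx1C QQ) mulmx1.
move=> w z zmu v; rewrite (resolvent_spectral QQ dQ) // /v -Sw big_bidx/=; apply: eq_bigr => i _.
rewrite tnth_mktuple mulr_suml; apply: eq_bigr => k _.
rewrite bidxK; congr (_ ^+ 2 / _).
by rewrite -(tnth_nth 0 _ (bidx i k)) tnth_mktuple mulmxA.
Qed.

End resolvent.

(** * Hermitian matrices as real symmetric matrices *)
Section realification.
Variable R : realType.
Local Open Scope complex_scope.
Local Notation C := R[i].
Local Notation toC := (real_complex R).

(** Elementary block operations with the square root c of -1 make the matrix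
    triangular. *)
Lemma det_block_rotation (F : comNzRingType) m (c : F) (A D : 'M[F]_m) : c * c = -1 ->
  \det (block_mx A (- D) D A) = \det (A + c *: D) * \det (A - c *: D).
Proof.
move=> cc.
have E : block_mx 1%:M c%:M 0 1%:M *m block_mx A (- D) D A *m block_mx 1%:M (- c%:M) 0 1%:M =
    block_mx (A + c *: D) 0 D (A - c *: D).
  rewrite !mulmx_block !(mul1mx, mul0mx, mulmx1, mulmx0, add0r, addr0).
  rewrite !mul_scalar_mx !mulmxN !mul_mx_scalar; congr block_mx.
    by rewrite scalerDr scalerA cc scaleN1r opprD opprK addrA addrK addNr.
  by rewrite addrC.
have := congr1 (fun M => \det M) E; rewrite !det_mulmx det_lblock => <-.
by rewrite !det_ublock !det1 !mulr1 mul1r.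
Qed.

(** H as a real-linear map on pairs (real part, imaginary part). *)
Definition realify m (H : 'M[C]_m) : 'M[R]_(m + m) :=
  let A := map_mx (@complex.Re R) H in let D := map_mx (@complex.Im R) H in
  block_mx A (- D) D A.

Definition realify_col m (x : 'cV[C]_m) : 'cV[R]_(m + m) :=
  col_mx (map_mx (@complex.Re R) x) (map_mx (@complex.Im R) x).

Lemma complex_ReIm (x : C) : toC (complex.Re x) + 'i * toC (complex.Im x) = x.
Proof. by case: x => a b; simpc. Qed.

Lemma conjc_ReIm (x : C) : toC (complex.Re x) - 'i * toC (complex.Im x) = conjc x.
Proof. by case: x => a b; simpc. Qed.

Lemma det_realify m (H : 'M[C]_m) :
  toC (\det (realify H)) = \det H * conjc (\det H).
Proof.
rewrite -det_map_mx /realify map_block_mx map_mxN (@det_block_rotation _ _ 'i); last by rewrite -expr2 sqr_i.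
congr (_ * _).
  by congr (\det _); apply/matrixP => i j; rewrite !mxE complex_ReIm.
rewrite -det_map_mx.
by congr (\det _); apply/matrixP => i j; rewrite !mxE conjc_ReIm.
Qed.

Lemma realify_shift m (H : 'M[C]_m) (z : R) :
  realify ((toC z)%:M - H) = z%:M - realify H.
Proof.
rewrite /realify (@scalar_mx_block _ m m) opp_block_mx add_block_mx !sub0r opprK.
by congr block_mx; apply/matrixP => i j; rewrite !mxE; case: (H i j) => u v; case: (i == j); rewrite /= ?mulr1n ?mulr0n ?sub0r ?subr0 ?oppr0 ?opprK.
Qed.

(** The determinant of realify (z - H) is |det (z - H)|^2, and det (z - H) is real for
    real z. *)
Lemma char_poly_realify m (H : 'M[C]_m) (p : {poly R}) :
  map_poly toC p = char_poly H -> char_poly (realify H) = p ^+ 2.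
Proof.
move=> pH; apply: (@poly_eq_nat _ _ _ [::]) => k _.
rewrite horner_char_poly -realify_shift; apply: (fmorph_inj toC).
rewrite [LHS]det_realify -horner_char_poly -pH horner_map/=.
by rewrite oppr0 -expr2 horner_exp -rmorphXn.
Qed.

Lemma realify_mul m (H : 'M[C]_m) (x : 'cV[C]_m) :
  realify H *m realify_col x = realify_col (H *m x).
Proof.
rewrite /realify /realify_col mul_block_col; congr col_mx; apply/colP => i; rewrite !mxE.
  rewrite -big_split/= Re_sum; apply: eq_bigr => j _; rewrite !mxE.
  by case: (H i j) => a b; case: (x j 0) => c d; rewrite /= mulNr.
rewrite -big_split/= Im_sum; apply: eq_bigr => j _; rewrite !mxE.
by case: (H i j) => a b; case: (x j 0) => c d; rewrite /= addrC.
Qed.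

Definition adjoint m k (A : 'M[C]_(m, k)) : 'M[C]_(k, m) := map_mx conjc A^T.

Lemma adjoint_mul m k l (A : 'M[C]_(m, k)) (B : 'M[C]_(k, l)) :
  adjoint (A *m B) = adjoint B *m adjoint A.
Proof. by rewrite /adjoint trmx_mul map_mxM. Qed.

Lemma adjointK m k (A : 'M[C]_(m, k)) : adjoint (adjoint A) = A.
Proof. by apply/matrixP => i j; rewrite !mxE conjcK. Qed.

Lemma realify_dot m (x y : 'cV[C]_m) :
  ((realify_col x)^T *m realify_col y) 0 0 = complex.Re ((adjoint x *m y) 0 0).
Proof.
rewrite /realify_col tr_col_mx mul_row_col !mxE -big_split/= Re_sum; apply: eq_bigr => j _; rewrite !mxE.
by case: (x j 0) => a b; case: (y j 0) => c d; rewrite /= mulNr opprK.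
Qed.

Lemma realify_sym m (H : 'M[C]_m) : adjoint H = H -> (realify H)^T = realify H.
Proof.
move=> aH; rewrite /realify tr_block_mx; congr block_mx; apply/matrixP => i j; rewrite -[H in RHS]aH !mxE.
all: by case: (H j i) => a b /=; rewrite ?opprK.
Qed.

Lemma adjoint_inv m (H : 'M[C]_m) : adjoint H = H -> adjoint (invmx H) = invmx H.
Proof. by move=> aH; rewrite /adjoint trmx_inv map_invmx -/(adjoint H) aH. Qed.

(** The left side is real because H is hermitian, and it is the scalar product of x and
    (z - H)^-1 x, whose real part can be computed on the real side. *)
Lemma realify_resolvent m (H : 'M[C]_m) (z : R) (x : 'cV[C]_m) : adjoint H = H ->
  (toC z)%:M - H \in unitmx ->
  (adjoint x *m invmx ((toC z)%:M - H) *m x) 0 0 =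
  toC (((realify_col x)^T *m invmx (z%:M - realify H) *m realify_col x) 0 0).
Proof.
move=> aH uB; set B := _ - H in uB *.
have aB : adjoint B = B.
  rewrite /B /adjoint linearB/= map_mxB -/(adjoint H) aH tr_scalar_mx map_scalar_mx/=.
  by rewrite oppr0.
rewrite -realify_shift -/B; pose y := invmx B *m x.
have uR : realify B \in unitmx.
  rewrite unitmxE unitfE; move: uB; rewrite unitmxE unitfE; apply: contraNneq => r0.
  have := det_realify B; rewrite r0 rmorph0 => /esym/eqP.
  by rewrite mulf_eq0 conjc_eq0 orbb.
have -> : (realify_col x)^T *m invmx (realify B) *m realify_col x = (realify_col x)^T *m realify_col y.
  by rewrite -mulmxA; congr (_ *m _); rewrite -[x in LHS](mulKVmx uB) -realify_mul mulKmx.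
rewrite realify_dot /y -mulmxA -/y.
have : conjc ((adjoint x *m y) 0 0) = (adjoint x *m y) 0 0.
  have : adjoint (adjoint x *m y) = adjoint x *m y.
    by rewrite /y !adjoint_mul adjoint_inv// adjointK mulmxA.
  by move/matrixP/(_ 0 0); rewrite !mxE.
case: (_ 0 0) => u v [] /eqP; rewrite eq_sym -subr_eq0 opprK -mulr2n mulrn_eq0/= => /eqP ->.
by [].
Qed.

End realification.

(** * The characteristic polynomial of a bordered matrix *)
(** The Schur complement, for a border of width k whose complement is scalar: k = 1
    for real and complex matrices, k = 2 for complex images of quaternionic ones. *)
Lemma char_poly_border (F : fieldType) m k m' (B : 'M[F]_m') (f : 'I_(m + k) -> 'I_m')
    (A : 'M[F]_m) (u : 'M[F]_(m, k)) (v : 'M[F]_(k, m)) x q z :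
  (m + k)%N = m' -> injective f -> mxsub f f B = block_mx A u v x%:M ->
  z%:M - A \in unitmx -> v *m invmx (z%:M - A) *m u = q%:M ->
  (char_poly B).[z] = (char_poly A).[z] * (z - x - q) ^+ k.
Proof.
move=> e fi fB uA qE; rewrite !horner_char_poly -(det_mxsub_inj _ e fi).
have -> : mxsub f f (z%:M - B) = block_mx (z%:M - A) (- u) (- v) (z - x)%:M.
  have -> : mxsub f f (z%:M - B) = z%:M - mxsub f f B.
    by apply/matrixP => i j; rewrite !mxE (inj_eq fi).
  rewrite fB (@scalar_mx_block _ m k) opp_block_mx add_block_mx !sub0r; congr block_mx.
  by apply/matrixP => i j; rewrite !mxE mulrnBl.
rewrite det_schur//; congr (_ * _).
rewrite mulmxN !mulNmx opprK qE -[RHS]det_scalar; congr (\det _).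
by apply/matrixP => i j; rewrite !mxE -mulrnBl.
Qed.

Section border.
Variables (R : realType) (b n : nat).

(** The self-adjoint matrix with corner M, last column w, given by its real components
    grouped by row, and last diagonal entry x. *)
Definition hborder (M : hmatrix R b n) (w : (n * b).-tuple R) (x : R) : hmatrix R b n.+1 :=
  fun k => \matrix_(i, j)
    match unlift ord_max i, unlift ord_max j with
    | Some i', Some j' => M k i' j'
    | Some i', None => tnth w (bidx i' k)
    | None, Some j' => (if k == 0%N :> nat then 1 else -1) * tnth w (bidx j' k)
    | None, None => if k == 0%N :> nat then x else 0
    end.

Lemma hmx_compE (M : hmatrix R b n) k (kb : (k < b)%N) : hmx_comp M k = M (Ordinal kb).
Proof. by rewrite /hmx_comp insubT. Qed.

End border.

Lemma widen_ord_lift_max n (i : 'I_n) : widen_ord (leqnSn n) i = lift ord_max i.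
Proof. by apply: val_inj; rewrite /= /bump leqNgt ltn_ord. Qed.

(** The last index is put after the others, as in a block matrix. *)
Definition border_ord n (i : 'I_(n + 1)) : 'I_n.+1 :=
  match fintype.split i with inl j => lift ord_max j | inr _ => ord_max end.

Lemma border_ord_l n (i : 'I_n) : border_ord (lshift 1 i) = lift ord_max i.
Proof. by rewrite /border_ord (unsplitK (inl i)). Qed.

Lemma border_ord_r n (i : 'I_1) : border_ord (rshift n i) = ord_max.
Proof. by rewrite /border_ord (unsplitK (inr i)). Qed.

Lemma border_ord_inj n : injective (@border_ord n).
Proof.
move=> i j; rewrite -(splitK i) -(splitK j).
case: (fintype.split i) => i'; case: (fintype.split j) => j' /=; rewrite ?border_ord_l ?border_ord_r.
- by move=> /lift_inj ->.
- by move=> /eqP; rewrite eq_sym (negbTE (neq_lift _ _)).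
- by move=> /eqP; rewrite (negbTE (neq_lift _ _)).
- by rewrite !ord1.
Qed.

Lemma arrow_poly_of_resolvent (F : numFieldType) n (mu r : 'I_n -> F) x (p : {poly F}) :
  (forall z, (forall i, z != mu i) ->
    p.[z] = \prod_i (z - mu i) * (z - x - \sum_i r i / (z - mu i))) -> p = arrow_poly mu x r.
Proof.
move=> h; apply: (@poly_eq_nat _ _ _ (codom mu)) => k kmu.
have kmu' i : k%:R != mu i by apply: contraNneq kmu => ->; exact: codom_f.
by rewrite horner_arrow_poly// h.
Qed.

Lemma unitmx_off_spectrum (F : fieldType) m n (A : 'M[F]_m) (mu : 'I_n -> F) k z :
  char_poly A = (\prod_i ('X - (mu i)%:P)) ^+ k -> (forall i, z != mu i) ->
  z%:M - A \in unitmx.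
Proof.
move=> cA zmu; rewrite unitmxE unitfE -horner_char_poly cA horner_exp expf_neq0//.
by rewrite horner_prod prodf_seq_neq0; apply/allP => i _ /=; rewrite hornerXsubC subr_eq0.
Qed.

Section border1.
Variables (R : realType) (n : nat) (M : hmatrix R 1 n) (mu : 'I_n -> R).
Hypothesis saM : forall k, hmx_adj M k = M k.
Hypothesis cM : is_hmx_char_poly M (\prod_i ('X - (mu i)%:P)).

Lemma border_char_poly1 : exists Q : 'M[R]_(n * 1), Q *m Q^T = 1%:M /\
  forall w x, is_hmx_char_poly (hborder M w x) (arrow_poly mu x (tnth (bnorm (tmul w Q)))).
Proof.
have k0 : (0 < 1)%N by [].
pose A := hmx_comp M 0.
have sA : A^T = A.
  by rewrite /A (hmx_compE _ k0) -[in RHS](saM (Ordinal k0)) /hmx_adj.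
have cA : char_poly A = (\prod_i ('X - (mu i)%:P)) ^+ 1 by rewrite expr1 cM.
pose s (c : 'I_n) : 'I_(n * 1) := bidx c (Ordinal k0).
have [||Q [QQ rQ]] := resolvent_blocks (s := s) (sg := fun=> 1) (esym (muln1 n)) _ _ sA cA.
- by move=> i j /bidx_inj[].
- by move=> _; rewrite expr1n.
exists Q; split => // w x /=; apply/esym; apply: arrow_poly_of_resolvent => z zmu.
pose v : 'rV[R]_n := \row_c (1 * tnth w (s c)).
have := rQ w z zmu; rewrite -/v /= => vE.
rewrite (@char_poly_border _ n 1 _ _ (@border_ord n) A v^T v x (\sum_i tnth (bnorm (tmul w Q)) i / (z - mu i))).
- by rewrite cA !expr1 horner_prod; under eq_bigr do rewrite hornerXsubC.
- by rewrite addn1.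
- exact: border_ord_inj.
- apply/matrixP => i j; rewrite -(splitK i) -(splitK j).
  case: (fintype.split i) => i'; case: (fintype.split j) => j' /=.
  + by rewrite block_mxEul /A !(hmx_compE _ k0) !mxE !border_ord_l !liftK.
  + by rewrite block_mxEur !(hmx_compE _ k0) !mxE !border_ord_l border_ord_r liftK unlift_none mul1r.
  + by rewrite block_mxEdl !(hmx_compE _ k0) !mxE !border_ord_l border_ord_r liftK unlift_none.
  + by rewrite block_mxEdr !(hmx_compE _ k0) !mxE !border_ord_r unlift_none !ord1.
- exact: unitmx_off_spectrum cA zmu.
- by rewrite [LHS]mx11_scalar vE.
Qed.

End border1.

Section complex_borders.
Variable R : realType.
Local Open Scope complex_scope.
Local Notation C := R[i].
Local Notation toC := (real_complex R).

(** It is enough to compare values at real points off the spectrum of the corner. *)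
Lemma arrow_poly_power_of_resolvent n (mu r : 'I_n -> R) x j (p : {poly C}) :
  (forall z : R, (forall i, z != mu i) ->
    p.[toC z] = toC ((\prod_i (z - mu i) * (z - x - \sum_i r i / (z - mu i))) ^+ j)) ->
  map_poly toC (arrow_poly mu x r ^+ j) = p.
Proof.
move=> h; apply: (@poly_eq_nat _ _ _ (codom (toC \o mu))) => k kmu.
have kmu' i : k%:R != mu i.
  apply: contraNneq kmu => e; apply/codomP; exists i.
  by rewrite /= -e rmorph_nat.
rewrite -(rmorph_nat toC) horner_map horner_exp horner_arrow_poly//.
by apply/esym; exact: h.
Qed.

Section border2.
Variables (n : nat) (M : hmatrix R 2 n) (mu : 'I_n -> R).
Hypothesis saM : forall k, hmx_adj M k = M k.
Hypothesis cM : is_hmx_char_poly M (\prod_i ('X - (mu i)%:P)).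

(** The complex case: the real form of M has every eigenvalue doubled. *)
Lemma border_char_poly2 : exists Q : 'M[R]_(n * 2), Q *m Q^T = 1%:M /\
  forall w x, is_hmx_char_poly (hborder M w x) (arrow_poly mu x (tnth (bnorm (tmul w Q)))).
Proof.
have k0 : (0 < 2)%N by []. have k1 : (1 < 2)%N by [].
pose A := hmx_cpart M 0.
have sA : adjoint A = A.
  apply/matrixP => i j; rewrite !mxE !(hmx_compE _ k0) !(hmx_compE _ k1).
  by rewrite -[in RHS](saM (Ordinal k0)) -[in RHS](saM (Ordinal k1)) /hmx_adj/= !mxE.
have cA := char_poly_realify cM.
pose s (c : 'I_(n + n)) : 'I_(n * 2) :=
  match fintype.split c with inl i => bidx i (Ordinal k0) | inr i => bidx i (Ordinal k1) end.
have [||||Q [QQ rQ]] := resolvent_blocks (s := s) (sg := fun=> 1) _ _ _ _ cA.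
- by rewrite addnn muln2.
- move=> i j; rewrite -(splitK i) -(splitK j) /s !unsplitK.
  by case: (fintype.split i) => i'; case: (fintype.split j) => j' /bidx_inj[-> e].
- by move=> _; rewrite expr1n.
- exact: realify_sym.
exists Q; split => // w x /=; rewrite -[arrow_poly _ _ _]expr1.
apply: arrow_poly_power_of_resolvent => z zmu.
pose v : 'cV[C]_n := \col_i (tnth w (bidx i (Ordinal k0)) +i* tnth w (bidx i (Ordinal k1))).
have vE : (realify_col v)^T = \row_c (1 * tnth w (s c)).
  apply/rowP => c; rewrite -(splitK c) !mxE mul1r /s unsplitK.
  by case: (fintype.split c) => i /=; rewrite ?row_mxEl ?row_mxEr ?col_mxEu ?col_mxEd !mxE.
have uA : (toC z)%:M - A \in unitmx.
  apply: (@unitmx_off_spectrum _ _ n _ (toC \o mu) 1) => [|i]; last first.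
    by rewrite (inj_eq (fmorph_inj toC)).
  rewrite expr1 /A -cM rmorph_prod/=; apply: eq_bigr => i _.
  by rewrite rmorphB/= map_polyX map_polyC.
have := rQ w z zmu; rewrite /= -vE trmxK => qE.
have := realify_resolvent v sA uA; rewrite qE => {}qE.
rewrite (@char_poly_border _ n 1 _ _ (@border_ord n) A v (adjoint v) (toC x)
  (toC (\sum_i tnth (bnorm (tmul w Q)) i / (z - mu i)))).
- rewrite /A -cM horner_map/= !expr1 horner_prod; under eq_bigr do rewrite hornerXsubC.
  by rewrite -!rmorphB -rmorphM.
- by rewrite addn1.
- exact: border_ord_inj.
- apply/matrixP => i j; rewrite -(splitK i) -(splitK j).
  case: (fintype.split i) => i'; case: (fintype.split j) => j' /=.
  + by rewrite block_mxEul /A !mxE !(hmx_compE _ k0) !(hmx_compE _ k1) !mxE !border_ord_l !liftK.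
  + by rewrite block_mxEur !mxE !(hmx_compE _ k0) !(hmx_compE _ k1) !mxE !border_ord_l border_ord_r liftK unlift_none.
  + rewrite block_mxEdl !mxE !(hmx_compE _ k0) !(hmx_compE _ k1) !mxE !border_ord_l border_ord_r liftK unlift_none /=.
    by rewrite mul1r mulN1r.
  + by rewrite block_mxEdr !mxE !(hmx_compE _ k0) !(hmx_compE _ k1) !mxE !border_ord_r unlift_none !ord1.
- exact: uA.
- by rewrite [LHS]mx11_scalar qE.
Qed.

End border2.


Section quaternionic_pair.
Variables (m : nat) (J H : 'M[C]_m).
Hypotheses (JJ : J *m J = - 1%:M) (tJ : J^T = - J) (rJ : map_mx conjc J = J).
Hypotheses (aH : adjoint H = H) (HJ : H *m J = J *m map_mx conjc H).

(** The matrix J expresses multiplication by the quaternion unit j. A hermitian matrix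
    compatible with this structure has a resolvent G with G J antisymmetric, so the
    off-diagonal terms of the 2 x 2 compression of G to x and J conj(x) vanish, and
    the diagonal terms are real and conjugate to each other. *)
Lemma quaternionic_pair_resolvent (z q : R) (x : 'cV[C]_m) : (toC z)%:M - H \in unitmx ->
  (adjoint x *m invmx ((toC z)%:M - H) *m x) 0 0 = toC q ->
  let V := row_mx x (J *m map_mx conjc x) in
  adjoint V *m invmx ((toC z)%:M - H) *m V = (toC q)%:M.
Proof.
set B := _ - H => uB; set y := map_mx conjc x.
pose G := invmx B; pose G' := map_mx conjc G.
rewrite -/G => qE V.
have aB : adjoint B = B.
  rewrite /B /adjoint linearB/= map_mxB -/(adjoint H) aH tr_scalar_mx map_scalar_mx/=.
  by rewrite oppr0.
have aG : adjoint G = G by exact: adjoint_inv.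
have tG : G^T = G'.
  by rewrite /G' -[in RHS]aG; apply/matrixP => i j; rewrite !mxE conjcK.
have BJ : B *m J = J *m map_mx conjc B.
  rewrite /B mulmxBl map_mxB mulmxBr HJ mul_scalar_mx map_scalar_mx/= oppr0.
  by rewrite mul_mx_scalar.
have GJ : G *m J = J *m G'.
  rewrite /G' /G map_invmx -[RHS]mul1mx -(mulVmx uB) -!mulmxA; congr (_ *m _).
  by rewrite mulmxA BJ mulmxK// map_unitmx.
have e11 : adjoint x *m G *m x = (toC q)%:M by rewrite [LHS]mx11_scalar qE.
have e12 : adjoint x *m G *m (J *m y) = 0.
  have ax : adjoint x = y^T by rewrite /y /adjoint map_trmx.
  set K := LHS; have KN : K^T = - K.
    rewrite /K ax !trmx_mul trmxK tG tJ !mulmxN -!mulmxA.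
    by rewrite mulNmx !mulmxA -(mulmxA _ G J) GJ !mulmxA.
  rewrite [LHS]mx11_scalar; suff -> : K 0 0 = 0 by apply/matrixP => i j; rewrite !mxE mul0rn.
  have /matrixP/(_ 0 0) := KN; rewrite !mxE -/(K 0 0) => /eqP.
  by rewrite -subr_eq0 opprK -mulr2n mulrn_eq0/= => /eqP.
have e21 : adjoint (J *m y) *m G *m x = 0.
  have := congr1 (@adjoint _ _ _) e12; rewrite !adjoint_mul adjointK aG mulmxA => ->.
  by rewrite /adjoint trmx0 map_mx0.
have e22 : adjoint (J *m y) *m G *m (J *m y) = (toC q)%:M.
  have -> : adjoint (J *m y) = - (x^T *m J).
    rewrite adjoint_mul /adjoint tJ map_mxN rJ mulmxN; congr (- (_ *m _)).
    by apply/matrixP => i j; rewrite !mxE conjcK.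
  have -> : - (x^T *m J) *m G *m (J *m y) = x^T *m G' *m y.
    by rewrite !mulNmx !mulmxA -(mulmxA _ G J) GJ mulmxA -(mulmxA _ J J) JJ mulmxN mulmx1 !mulNmx opprK.
  have := congr1 (map_mx conjc) e11; rewrite !map_mxM map_scalar_mx/= oppr0 => <-.
  by congr (_ *m _ *m _); apply/matrixP => i j; rewrite !mxE conjcK.
rewrite /V /adjoint tr_row_mx map_col_mx mul_col_mx mul_col_row -!/(adjoint _) e11 e12 e21 e22.
by rewrite -scalar_mx_block.
Qed.

End quaternionic_pair.

Section symplectic.
Variable n : nat.
Variables Z W : 'M[C]_n.
Local Notation H := (block_mx Z W (- map_mx conjc W) (map_mx conjc Z)).

Lemma adjoint_quaternionic : adjoint Z = Z -> W^T = - W -> adjoint H = H.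
Proof.
move=> sZ sW; rewrite /adjoint tr_block_mx map_block_mx; congr block_mx.
- exact: sZ.
- by rewrite -[RHS]opprK -sW; apply/matrixP => i j; rewrite !mxE rmorphN/= conjcK.
- by rewrite sW map_mxN.
- by rewrite -[in RHS]sZ; apply/matrixP => i j; rewrite !mxE !conjcK.
Qed.

Definition symplectic_mx : 'M[C]_(n + n) := block_mx 0 (- 1%:M) 1%:M 0.

Lemma symplectic_sqr : symplectic_mx *m symplectic_mx = - 1%:M.
Proof.
rewrite /symplectic_mx mulmx_block !(mul0mx, mulmx0, add0r, addr0, mulmx1, mulmxN).
by rewrite (@scalar_mx_block _ n n) opp_block_mx !oppr0.
Qed.

Lemma symplectic_tr : symplectic_mx^T = - symplectic_mx.
Proof. by rewrite /symplectic_mx tr_block_mx opp_block_mx linearN/= !trmx0 trmx1 !oppr0 opprK. Qed.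

Lemma symplectic_conj : map_mx conjc symplectic_mx = symplectic_mx.
Proof. by rewrite /symplectic_mx map_block_mx map_mxN !map_mx0 map_mx1. Qed.

Lemma symplectic_comm : H *m symplectic_mx = symplectic_mx *m map_mx conjc H.
Proof.
rewrite map_block_mx /symplectic_mx !mulmx_block !(mul0mx, mulmx0, add0r, addr0, mulmx1, mul1mx, mulmxN, mulNmx).
by congr block_mx; apply/matrixP => i j; rewrite !mxE ?rmorphN/= ?conjcK ?opprK.
Qed.

End symplectic.

Section border4.
Variables (n : nat) (M : hmatrix R 4 n) (mu : 'I_n -> R).
Hypothesis saM : forall k, hmx_adj M k = M k.
Hypothesis cM : is_hmx_char_poly M (\prod_i ('X - (mu i)%:P)).

(** The complex image of a bordered quaternionic matrix has two borders, at the end of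
    each half; both are moved to the end. *)
Definition border_ord2 (i : 'I_((n + n) + (1 + 1))) : 'I_(n.+1 + n.+1) :=
  match fintype.split i with
  | inl j => match fintype.split j with
             | inl j' => lshift n.+1 (lift ord_max j')
             | inr j' => rshift n.+1 (lift ord_max j') end
  | inr j => match fintype.split j with
             | inl _ => lshift n.+1 ord_max
             | inr _ => rshift n.+1 ord_max end
  end.

Lemma border_ord2_inj : injective border_ord2.
Proof.
have nl (k : 'I_n) : (ord_max == lift ord_max k) = false by exact/negbTE/neq_lift.
have nl' (k : 'I_n) : (lift ord_max k == ord_max) = false by rewrite eq_sym nl.
move=> i j; rewrite /border_ord2 -(splitK i) -(splitK j) !unsplitK.
case: (fintype.split i) => i'; case: (fintype.split j) => j'; rewrite -(splitK i') -(splitK j') !unsplitK.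
all: case: (fintype.split i') => k; case: (fintype.split j') => l /= /eqP.
all: rewrite ?eq_lrshift ?eq_rlshift ?eq_lshift ?eq_rshift ?nl ?nl'// ?(inj_eq (@lift_inj _ _)).
all: try by move=> /eqP ->.
all: by rewrite !ord1.
Qed.

(** The quaternionic case: the complex image of M has every eigenvalue doubled, hence
    its real form has every eigenvalue with multiplicity 4, and the border has
    width 2. *)
Lemma border_char_poly4 : exists Q : 'M[R]_(n * 4), Q *m Q^T = 1%:M /\
  forall w x, is_hmx_char_poly (hborder M w x) (arrow_poly mu x (tnth (bnorm (tmul w Q)))).
Proof.
have k0 : (0 < 4)%N by []. have k1 : (1 < 4)%N by [].
have k2 : (2 < 4)%N by []. have k3 : (3 < 4)%N by [].
pose Z := hmx_cpart M 0; pose W := hmx_cpart M 2.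
pose H := hmx_complex_image M.
have sZ : adjoint Z = Z.
  apply/matrixP => i j; rewrite !mxE !(hmx_compE _ k0) !(hmx_compE _ k1).
  by rewrite -[in RHS](saM (Ordinal k0)) -[in RHS](saM (Ordinal k1)) /hmx_adj/= !mxE.
have sW : W^T = - W.
  apply/matrixP => i j; rewrite !mxE !(hmx_compE _ k2) !(hmx_compE _ k3).
  rewrite -[in RHS](saM (Ordinal k2)) -[in RHS](saM (Ordinal k3)) /hmx_adj/= !mxE.
  by apply/eqP; rewrite eq_complex /= !opprK !eqxx.
have HE : H = block_mx Z W (- map_mx conjc W) (map_mx conjc Z) by [].
have sH : adjoint H = H.
  by rewrite HE; exact: adjoint_quaternionic.
have cH : map_poly toC ((\prod_i ('X - (mu i)%:P)) ^+ 2) = char_poly H by case: cM.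
have cA := char_poly_realify cH; rewrite -exprM in cA.
pose J := symplectic_mx n.
have JJ : J *m J = - 1%:M by exact: symplectic_sqr.
have tJ : J^T = - J by exact: symplectic_tr.
have rJ : map_mx conjc J = J by exact: symplectic_conj.
have HJ : H *m J = J *m map_mx conjc H by rewrite HE; exact: symplectic_comm.
pose s (c : 'I_((n + n) + (n + n))) : 'I_(n * 4) :=
  match fintype.split c with
  | inl d => match fintype.split d with inl i => bidx i (Ordinal k0) | inr i => bidx i (Ordinal k2) end
  | inr d => match fintype.split d with inl i => bidx i (Ordinal k1) | inr i => bidx i (Ordinal k3) end
  end.
pose sg (c : 'I_((n + n) + (n + n))) : R :=
  match fintype.split c with
  | inl d => match fintype.split d with inl _ => 1 | inr _ => - 1 end
  | inr _ => 1
  end.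
have [||||Q [QQ rQ]] := resolvent_blocks (s := s) (sg := sg) _ _ _ _ cA.
- lia.
- move=> i j; rewrite -(splitK i) -(splitK j) /s !unsplitK.
  case: (fintype.split i) => i'; case: (fintype.split j) => j'; rewrite -(splitK i') -(splitK j') !unsplitK;
    by case: (fintype.split i') => k; case: (fintype.split j') => l /= /bidx_inj[-> e].
- by move=> c; rewrite /sg; case: (fintype.split c) => [d|_]; [case: (fintype.split d) => _|]; rewrite ?sqrrN expr1n.
- exact: realify_sym.
exists Q; split => // w x /=; split; first by have [] := arrow_poly_monic_size mu x (tnth (bnorm (tmul w Q))).
apply: arrow_poly_power_of_resolvent => z zmu.
pose e (i : 'I_n) (k l : nat) (kb : (k < 4)%N) (lb : (l < 4)%N) : C :=
  tnth w (bidx i (Ordinal kb)) +i* tnth w (bidx i (Ordinal lb)).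
pose v : 'cV[C]_(n + n) := col_mx (\col_i e i _ _ k0 k1) (- \col_i conjc (e i _ _ k2 k3)).
have vE : (realify_col v)^T = \row_c (sg c * tnth w (s c)).
  apply/rowP => c; rewrite -(splitK c) !mxE /s /sg !unsplitK.
  case: (fintype.split c) => d /=; rewrite ?row_mxEl ?row_mxEr ?col_mxEu ?col_mxEd mxE -(splitK d) !unsplitK.
    by case: (fintype.split d) => i /=; rewrite ?col_mxEu ?col_mxEd !mxE /= ?mul1r ?mulN1r.
  by case: (fintype.split d) => i /=; rewrite ?col_mxEu ?col_mxEd !mxE /= ?mul1r ?opprK.
have uA : (toC z)%:M - H \in unitmx.
  apply: (@unitmx_off_spectrum _ _ n _ (toC \o mu) 2) => [|i]; last first.
    by rewrite (inj_eq (fmorph_inj toC)).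
  rewrite -cH rmorphXn rmorph_prod/=; congr (_ ^+ _); apply: eq_bigr => i _.
  by rewrite rmorphB/= map_polyX map_polyC.
have := rQ w z zmu; rewrite /= -vE trmxK => qE.
have := realify_resolvent v sH uA; rewrite qE => {}qE.
have := quaternionic_pair_resolvent JJ tJ rJ sH HJ uA qE.
rewrite [X in row_mx _ X](_ : _ = col_mx (\col_i e i _ _ k2 k3) (\col_i conjc (e i _ _ k0 k1))); last first.
  rewrite /J /symplectic_mx /v map_col_mx mul_block_col !(mul0mx, mul1mx, add0r, addr0, mulNmx).
  by congr col_mx; apply/colP => i; rewrite !mxE ?rmorphN/= ?conjcK ?opprK.
set V := row_mx _ _ => /= VE.
rewrite (@char_poly_border _ (n + n) (1 + 1) _ _ border_ord2 H V (adjoint V) (toC x)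
  (toC (\sum_i tnth (bnorm (tmul w Q)) i / (z - mu i)))).
- rewrite -cH horner_map/= horner_exp horner_prod; under eq_bigr do rewrite hornerXsubC.
  by rewrite -!rmorphB -rmorphXn -rmorphM exprMn.
- lia.
- exact: border_ord2_inj.
- apply/matrixP => i j; rewrite mxE /border_ord2 -(splitK i) -(splitK j) !unsplitK.
  rewrite HE /V /v /adjoint tr_row_mx map_col_mx !tr_col_mx !map_row_mx.
  case: (fintype.split i) => i'; case: (fintype.split j) => j'; rewrite -(splitK i') -(splitK j') !unsplitK;
  case: (fintype.split i') => k; case: (fintype.split j') => l /=;
  rewrite ?(block_mxEul, block_mxEur, block_mxEdl, block_mxEdr, row_mxEl, row_mxEr, col_mxEu, col_mxEd);
  rewrite !mxE ?(hmx_compE _ k0) ?(hmx_compE _ k1) ?(hmx_compE _ k2) ?(hmx_compE _ k3) ?mxE ?liftK ?unlift_none ?ord1 /=.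
  all: rewrite ?mul1r ?mulN1r ?opprK ?eqxx ?eq_lrshift ?eq_rlshift ?oppr0 /=.
  all: try by [].
  all: try by apply/eqP; rewrite eq_complex/= ?opprK ?oppr0 ?eqxx.
Qed.

End border4.

End complex_borders.

Section spectrum.
Variable R : realType.

Definition hmx_self_adjoint b n (M : hmatrix R b n) := forall k, hmx_adj M k = M k.

(** The eigenvalues of a bordered matrix depend on its last column w only through the
    squared norms of the blocks of its coordinates in an orthonormal basis. *)
Lemma border_char_poly b n (M : hmatrix R b n) (mu : 'I_n -> R) : b \in [:: 1; 2; 4]%N ->
  hmx_self_adjoint M -> is_hmx_char_poly M (\prod_i ('X - (mu i)%:P)) ->
  exists Q : 'M[R]_(n * b), Q *m Q^T = 1%:M /\
  forall w x, is_hmx_char_poly (hborder M w x) (arrow_poly mu x (tnth (bnorm (tmul w Q)))).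
Proof.
rewrite !inE; move: M => + hb; case/or3P: hb => /eqP -> M.
- exact: border_char_poly1.
- exact: border_char_poly2.
- exact: border_char_poly4.
Qed.

(** For b = 4 a monic square root is unique. *)
Lemma hmx_char_poly_unique b n (M : hmatrix R b n) (p q : {poly R}) : b \in [:: 1; 2; 4]%N ->
  p \is monic -> q \is monic -> is_hmx_char_poly M p -> is_hmx_char_poly M q -> p = q.
Proof.
rewrite !inE; move: M => + hb; case/or3P: hb => /eqP -> M mp mq /=.
- by move=> -> ->.
- by move=> <- /map_poly_inj.
- move=> [_ <-] [_ /map_poly_inj /eqP]; rewrite eqf_sqr => /orP[/eqP->//|/eqP qE].
  have := monicP mq; rewrite qE lead_coefN (monicP mp) => /eqP.
  by rewrite eq_sym -subr_eq0 opprK -(natrD _ 1 1) pnatr_eq0.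
Qed.

Definition hmx_last_col b n (C : hmatrix R b n.+1) : (n * b).-tuple R :=
  [tuple C (bmod j) (widen_ord (leqnSn n) (bdiv j)) ord_max | j < n * b].

Lemma hborder_corner b n (C : hmatrix R b n.+1) : (0 < b)%N -> hmx_self_adjoint C ->
  C = hborder (hmx_corner C) (hmx_last_col C) (hmx_comp C 0 ord_max ord_max).
Proof.
move=> b0 sC; apply/funext => k; apply/matrixP => i j; rewrite mxE.
case: unliftP => [i'|] ->; case: unliftP => [j'|] ->.
- by rewrite mxE !widen_ord_lift_max.
- by rewrite tnth_mktuple bidx_mod bidxK widen_ord_lift_max.
- rewrite tnth_mktuple bidx_mod bidxK -{1}(sC k) /hmx_adj widen_ord_lift_max.
  by case: ifP => _; rewrite !mxE ?mul1r ?mulN1r.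
- case: ifPn => [/eqP k0|k0].
    by rewrite (hmx_compE _ b0); congr (C _ _ _); exact: val_inj.
  have := congr1 (fun M : 'M[R]_n.+1 => M ord_max ord_max) (sC k).
  rewrite /hmx_adj (negbTE k0) !mxE => /eqP.
  by rewrite eq_sym -subr_eq0 opprK -mulr2n mulrn_eq0/= => /eqP.
Qed.

Lemma hmx_self_adjoint_corner b n (C : hmatrix R b n.+1) : hmx_self_adjoint C ->
  hmx_self_adjoint (hmx_corner C).
Proof.
move=> sC k; rewrite /hmx_corner -[in RHS](sC k) /hmx_adj.
by case: ifP => _; apply/matrixP => i j; rewrite !mxE.
Qed.

Lemma hborder_eigenvalues b n (M : hmatrix R b n) : b \in [:: 1; 2; 4]%N ->
  hmx_self_adjoint M -> (exists mu, is_eigenvalues M mu) ->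
  forall w x, exists l, is_eigenvalues (hborder M w x) l.
Proof.
move=> hb sM [mu [_ cM]] w x; rewrite big_tuple in cM.
have [Q [QQ /(_ w x) cB]] := border_char_poly hb sM cM.
have [i|s [ss sE]] := @arrow_poly_split _ _ (tnth mu) (tnth (bnorm (tmul w Q))) x.
  by rewrite tnth_mktuple sumr_ge0// => k _; exact: sqr_ge0.
by exists s; split => //; rewrite -sE.
Qed.

(** By induction on the size, bordering the corner. *)
Lemma hmx_eigenvalues_exist b n (M : hmatrix R b n) : b \in [:: 1; 2; 4]%N ->
  hmx_self_adjoint M -> exists mu, is_eigenvalues M mu.
Proof.
move=> hb; elim: n M => [|n IH] M sM.
  exists [tuple]; split => //=; rewrite big_nil /is_hmx_char_poly.
  move: hb M sM; rewrite !inE => /or3P[]/eqP -> M sM /=.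
  - by rewrite /char_poly det_mx00.
  - by rewrite rmorph1 /char_poly det_mx00.
  - by rewrite monic1 expr1n rmorph1 /char_poly det_mx00.
have b0 : (0 < b)%N by move: hb; rewrite !inE => /or3P[]/eqP ->.
rewrite (hborder_corner b0 sM); apply: hborder_eigenvalues => //.
  exact: hmx_self_adjoint_corner.
exact/IH/hmx_self_adjoint_corner.
Qed.

Lemma hmx_eigenvalues_unique b n (M : hmatrix R b n) (s t : n.-tuple R) : b \in [:: 1; 2; 4]%N ->
  is_eigenvalues M s -> is_eigenvalues M t -> s = t.
Proof.
move=> hb [ss cs] [st ct]; apply: sorted_roots_unique => //.
by apply: hmx_char_poly_unique cs ct => //; exact: monic_prod_XsubC.
Qed.

End spectrum.

(** * Measurability of ordered roots *)
Section pole_roots.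
Variable R : realType.

(** The roots prescribed in the change of variables are the eigenvalues. *)
Lemma arrow_poly_pole_resid n (mu : n.-tuple R) (l : n.+1.-tuple R) : sdecr mu ->
  arrow_poly (tnth mu) (thead (pole_resid mu l)) (tnth (tbehead (pole_resid mu l))) =
  \prod_(a <- l) ('X - a%:P).
Proof.
move=> smu; apply: (@poly_eq_nat _ _ _ mu) => k kmu.
have zmu i : k%:R != tnth mu i by apply: contraNneq kmu => ->; exact: mem_tnth.
move: k%:R zmu => z zmu {kmu k}.
rewrite horner_arrow_poly// big_tuple horner_prod; under [RHS]eq_bigr do rewrite hornerXsubC.
rewrite /pole_resid thead_tcons tbehead_tcons/=.
set rr := resid mu (tbehead l); set l0 := thead l.
have -> : z - (l0 - \sum_i tnth rr i) -
    \sum_i tnth (tscale [tuple l0 - tnth mu i | i < n] rr) i / (z - tnth mu i) =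
    (z - l0) * (1 + \sum_i tnth rr i / (z - tnth mu i)).
  rewrite (_ : \sum_i _ / _ = \sum_i tnth rr i - (z - l0) * \sum_i tnth rr i / (z - tnth mu i)).
    by ring.
  rewrite mulr_sumr -sumrB; apply: eq_bigr => i _.
  have h : z - tnth mu i != 0 by rewrite subr_eq0.
  by rewrite !tnth_mktuple; field.
rewrite resid_partial_fractions// mulrCA mulrA -mulrA.
have p0 : \prod_i (z - tnth mu i) != 0.
  by rewrite prodf_seq_neq0; apply/allP => i _ /=; rewrite subr_eq0.
rewrite mulrC -mulrA; set X := \prod_i (z - tnth (tbehead l) i).
rewrite [in RHS](tcons_head_behead l) (prod_tcons (fun x => z - x))/= -/X -/l0.
by field.
Qed.

Lemma interlacing_sorted n (mu : n.-tuple R) (l : n.+1.-tuple R) : interlacing mu l ->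
  sorted >=%R l.
Proof.
move=> /forallP il; apply/(sortedP 0) => i; rewrite size_tuple ltnS => iN.
have /andP[h1 h2] := il (Ordinal iN).
by have := le_trans h2 h1; rewrite !(tnth_nth 0).
Qed.

End pole_roots.

Section measurable_roots.
Context d (T : measurableType d) (R : realType).

(** The largest root is at least s if and only if the values at rational points q >= s
    are arbitrarily small in absolute value: if it is smaller than s they are
    bounded below by a power of its distance to s. *)
Lemma measurable_largest_root n (l : T -> n.+1.-tuple R) e :
  (forall w, sorted >=%R (l w)) ->
  (forall z, measurable_fun [set: T] (fun w => (\prod_(i < n.+1) (z - tnth (l w) i)) ^+ e.+1)) ->
  measurable_fun [set: T] (fun w => thead (l w)).
Proof.
move=> sl mp; pose g z w := (\prod_(i < n.+1) (z - tnth (l w) i)) ^+ e.+1.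
have lmax w i : tnth (l w) i <= thead (l w).
  have := sl w; rewrite (tcons_head_behead (l w)) /= => /(order_path_min _)-/(_ _)/allP h.
  case: (unliftP ord0 i) => [j|] ->; rewrite ?tnth_tcons0 ?tnth_tconsS thead_tcons//=.
  by apply: h; [move=> a b c /= ab bc; exact: le_trans bc ab|exact: mem_tnth].
apply: (measurability (@RGenCInfty.G R)) => [|/= _ [_] [s] -> <-].
  exact: RGenCInfty.measurableE.
rewrite setTI (_ : _ @^-1` _ = \bigcap_(m : nat) \bigcup_(q : rat)
    [set w | s <= ratr q /\ `|g (ratr q) w| < m.+1%:R^-1]); last first.
  apply/seteqP; split => w /=; rewrite in_itv/= andbT.
  - move=> sl0 m _.
    have cg : {for thead (l w), continuous (fun z => g z w)}.
      pose p := (\prod_(i < n.+1) ('X - (tnth (l w) i)%:P)) ^+ e.+1.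
      rewrite (_ : (fun z => _) = horner p); first exact: continuous_horner.
      apply/funext => z; rewrite /g /p horner_exp horner_prod; congr (_ ^+ _).
      by apply: eq_bigr => i _; rewrite hornerXsubC.
    have g0 : g (thead (l w)) w = 0.
      by rewrite /g big_ord_recl (_ : tnth _ _ = thead (l w))// subrr mul0r expr0n.
    have : \forall z \near thead (l w), `|g z w| < m.+1%:R^-1.
      have /cvgr_dist_lt/(_ m.+1%:R^-1) := cg; rewrite g0 => h.
      have m0 : 0 < m.+1%:R^-1 :> R by rewrite invr_gt0.
      by move: (h m0); apply: filterS => z; rewrite sub0r normrN.
    case/nbhs_ballP => r /= r0 rg.
    have /rat_in_itvoo[q] : thead (l w) < thead (l w) + r by rewrite ltrDl.
    rewrite in_itv/= => /andP[q1 q2]; exists q => //=; split.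
      by rewrite (le_trans sl0)// ltW.
    by apply: rg; rewrite /ball/= distrC ger0_norm ?subr_ge0 ?ltW// ltrBlDl.
  - move=> h; rewrite leNgt; apply/negP => ls.
    (* for q >= s each of the n.+1 factors is at least s - thead (l w) *)
    pose del := (s - thead (l w)) ^+ (n.+1 * e.+1).
    have del0 : 0 < del by rewrite exprn_gt0// subr_gt0.
    have [m mdel] : exists m : nat, m.+1%:R^-1 < del.
      exists (Num.bound del^-1); rewrite invf_plt ?posrE//.
      apply: lt_trans (archi_boundP _) _; first by rewrite invr_ge0 ltW.
      by rewrite ltr_nat.
    have [q _ /= [sq]] := h m I.
    apply/negP; rewrite -leNgt (le_trans (ltW mdel))// /del exprM /g normrX.
    rewrite lerXn2r ?nnegrE ?exprn_ge0 ?subr_ge0 ?(ltW ls)//.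
    rewrite normr_prod -[in X in _ ^+ X](card_ord n.+1) -prodr_const.
    apply: ler_prod => i _; rewrite subr_ge0 (ltW ls)/=.
    by apply: le_trans (ler_norm _); rewrite lerB.
apply: bigcapT_measurable => m; apply: bigcupT_measurable_rat => q.
have [sq|sq] := boolP (s <= ratr q); last first.
  by rewrite (_ : [set w | _] = set0)//; apply/seteqP; split => w //= -[].
rewrite (_ : [set w | _] = [set w | `|g (ratr q) w| < m.+1%:R^-1]); last first.
  by apply/seteqP; split => w /= => [[]|].
rewrite -[X in measurable X]setTI.
have mg : measurable_fun [set: T] (fun w => `|g (ratr q) w|).
  exact: (measurableT_comp (@normr_measurable _ _) (mp _)).
have := mg measurableT `]-oo, m.+1%:R^-1[%classic (measurable_itv _).
by congr (measurable (_ `&` _)); apply/seteqP; split => w /=; rewrite in_itv.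
Qed.

(** The largest root is measurable, and it can be divided out: the quotient at z is
    the limit of its values at z + 1/k, where the divisor vanishes for at most one k.
    The hypothesis is about a power of the polynomial because the determinant of a
    real form is such a power. *)
Lemma measurable_sorted_roots n (l : T -> n.-tuple R) e :
  (forall w, sorted >=%R (l w)) ->
  (forall z, measurable_fun [set: T] (fun w => (\prod_(i < n) (z - tnth (l w) i)) ^+ e.+1)) ->
  measurable_fun [set: T] l.
Proof.
elim: n l => [|n IH] l sl ml.
  by rewrite (_ : l = fun=> [tuple])//; apply/funext => w; exact: tuple0.
have m0 := measurable_largest_root sl ml.
rewrite (_ : l = fun w => tcons (thead (l w), tbehead (l w))); last first.
  by apply/funext => w; exact: tcons_eta.
apply: measurable_tcons_pair => //; apply: IH => [w|z].
  by have := sl w; rewrite {1}(tcons_head_behead (l w))/= => /path_sorted.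
pose g z w := (\prod_(i < n.+1) (z - tnth (l w) i)) ^+ e.+1.
pose h (k : nat) w := g (z + k.+1%:R^-1) w / (z + k.+1%:R^-1 - thead (l w)) ^+ e.+1.
apply: (@measurable_fun_cvg _ _ _ _ h) => [k|w _].
  apply: measurable_funM; first exact: ml.
  by apply: measurable_fun_inv; apply: measurable_funX; exact: measurable_funB.
pose p := (\prod_(i < n) ('X - (tnth (tbehead (l w)) i)%:P)) ^+ e.+1.
have pE y : p.[y] = (\prod_(i < n) (y - tnth (tbehead (l w)) i)) ^+ e.+1.
  by rewrite horner_exp horner_prod; congr (_ ^+ _); apply: eq_bigr => i _; rewrite hornerXsubC.
have cz : (fun k : nat => z + k.+1%:R^-1) @ \oo --> z.
  rewrite -[X in _ --> X]addr0; apply: cvgD; [exact: cvg_cst|exact: cvg_harmonic].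
have : (fun k : nat => p.[z + k.+1%:R^-1]) @ \oo --> p.[z].
  apply: continuous_cvg => //; exact: continuous_horner.
rewrite pE; apply: cvg_trans; apply: near_eq_cvg.
have nz : \forall k \near \oo, z + k.+1%:R^-1 - thead (l w) != 0.
  have [zl|zl] := leP (thead (l w)) z.
    apply: nearW => k; rewrite gt_eqF// addrAC ltr_wpDl ?subr_ge0//.
  move/cvgrPdist_lt : cz => /(_ (thead (l w) - z)); rewrite subr_gt0 => /(_ zl).
  apply: filterS => k; rewrite opprD addrA subrr sub0r normrN => kl.
  rewrite lt_eqF// subr_lt0 -ltrBrDl (le_lt_trans (ler_norm _))//.
near=> k.
have knz : z + k.+1%:R^-1 - thead (l w) != 0 by near: k.
rewrite pE /h /g; move: (z + _) knz => y knz.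
have -> : \prod_(i < n.+1) (y - tnth (l w) i) =
    (y - thead (l w)) * \prod_(i < n) (y - tnth (tbehead (l w)) i).
  by rewrite [in LHS](tcons_head_behead (l w)) (prod_tcons (fun x => y - x)).
by rewrite exprMn mulrAC mulfV ?mul1r// expf_neq0.
Unshelve. all: end_near. Qed.

End measurable_roots.

(** * Measurability of eigenvalues *)
Section measurable_eigenvalues.
Context d (T : measurableType d) (R : realType).
Local Open Scope complex_scope.
Local Notation toC := (real_complex R).

Definition mx_measurable m k (M : T -> 'M[R]_(m, k)) :=
  forall i j, measurable_fun [set: T] (fun w => M w i j).

Lemma measurable_det m (M : T -> 'M[R]_m) : mx_measurable M ->
  measurable_fun [set: T] (fun w => \det (M w)).
Proof.
move=> mM; rewrite /determinant; apply: measurable_sum => s; apply: measurable_funM => //.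
by apply: measurable_prod => i _; exact: mM.
Qed.

Lemma mx_measurable_block m (A B C D : T -> 'M[R]_m) :
  mx_measurable A -> mx_measurable B -> mx_measurable C -> mx_measurable D ->
  mx_measurable (fun w => block_mx (A w) (B w) (C w) (D w)).
Proof.
move=> mA mB mC mD i j; rewrite -(splitK i) -(splitK j).
case: (fintype.split i) => i'; case: (fintype.split j) => j' /=.
- by under eq_fun do rewrite block_mxEul; exact: mA.
- by under eq_fun do rewrite block_mxEur; exact: mB.
- by under eq_fun do rewrite block_mxEdl; exact: mC.
- by under eq_fun do rewrite block_mxEdr; exact: mD.
Qed.

Lemma mx_measurableN m k (A : T -> 'M[R]_(m, k)) : mx_measurable A ->
  mx_measurable (fun w => - A w).
Proof. by move=> mA i j; under eq_fun do rewrite mxE; exact: measurable_funN. Qed.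

Lemma measurable_realify_det m (H : T -> 'M[R[i]]_m) z :
  mx_measurable (fun w => map_mx (@complex.Re R) (H w)) ->
  mx_measurable (fun w => map_mx (@complex.Im R) (H w)) ->
  measurable_fun [set: T] (fun w => (\det (z%:M - realify (H w)))).
Proof.
move=> mRe mIm; apply: measurable_det => i j.
under eq_fun do rewrite mxE [X in _ + X]mxE.
apply: measurable_funB => //.
exact: (mx_measurable_block mRe (mx_measurableN mIm) mIm mRe).
Qed.

(** The b-th power of the characteristic polynomial is a determinant of a real matrix
    with measurable entries. *)
Lemma measurable_eigenvalues b n (M : T -> hmatrix R b n) (l : T -> n.-tuple R) :
  b \in [:: 1; 2; 4]%N -> (forall k, mx_measurable (fun w => M w k)) ->
  (forall w, is_eigenvalues (M w) (l w)) -> measurable_fun [set: T] l.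
Proof.
move=> hb mM eM.
apply: (@measurable_sorted_roots _ _ _ _ _ b.-1) => [w|z]; first by case: (eM w).
have pE w : \prod_(i < n) (z - tnth (l w) i) = (\prod_(x <- l w) ('X - x%:P)).[z].
  by rewrite big_tuple horner_prod; apply: eq_bigr => i _; rewrite hornerXsubC.
under eq_fun do rewrite pE -horner_exp.
have mcomp k : mx_measurable (fun w => hmx_comp (M w) k).
  move=> i j; rewrite /hmx_comp; case: insubP => [u _ _|_] /=; first exact: mM.
  by under eq_fun do rewrite mxE; exact: measurable_cst.
have mRe k : mx_measurable (fun w => map_mx (@complex.Re R) (hmx_cpart (M w) k)).
  by move=> i j; under eq_fun do rewrite !mxE /=; exact: mcomp.
have mIm k : mx_measurable (fun w => map_mx (@complex.Im R) (hmx_cpart (M w) k)).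
  by move=> i j; under eq_fun do rewrite !mxE /=; exact: mcomp.
move: hb M eM {mM} mcomp mRe mIm; rewrite !inE => /or3P[]/eqP -> M eM mcomp mRe mIm.
- under eq_fun => w do rewrite expr1 (eM w).2 horner_char_poly.
  apply: measurable_det => i j; under eq_fun do rewrite !mxE.
  by apply: measurable_funB => //; exact: mcomp.
- under eq_fun => w do rewrite -(char_poly_realify (eM w).2) horner_char_poly.
  exact: measurable_realify_det.
- under eq_fun => w do rewrite (exprM _ 2 2) -(char_poly_realify (eM w).2.2) horner_char_poly.
  have NRe m (A : 'M[R[i]]_m) : map_mx (@complex.Re R) (- map_mx conjc A) = - map_mx (@complex.Re R) A.
    by apply/matrixP => i j; rewrite !mxE; case: (A i j).
  have NIm m (A : 'M[R[i]]_m) : map_mx (@complex.Im R) (- map_mx conjc A) = map_mx (@complex.Im R) A.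
    by apply/matrixP => i j; rewrite !mxE; case: (A i j) => u v /=; rewrite opprK.
  have PRe m (A : 'M[R[i]]_m) : map_mx (@complex.Re R) (map_mx conjc A) = map_mx (@complex.Re R) A.
    by apply/matrixP => i j; rewrite !mxE; case: (A i j).
  have PIm m (A : 'M[R[i]]_m) : map_mx (@complex.Im R) (map_mx conjc A) = - map_mx (@complex.Im R) A.
    by apply/matrixP => i j; rewrite !mxE; case: (A i j).
  apply: measurable_realify_det => i j.
    under eq_fun do rewrite map_block_mx NRe PRe.
    by apply: mx_measurable_block => //; exact: mx_measurableN.
  under eq_fun do rewrite map_block_mx NIm PIm.
  by apply: mx_measurable_block => //; exact: mx_measurableN.
Qed.

End measurable_eigenvalues.

(** * Gaussian tuples and the law of the entries *)
Section gaussian_tuples.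
Variable R : realType.
Local Notation leb := (@lebesgue_measure R).
Local Open Scope ereal_scope.

Definition tbox m (B : 'I_m -> set R) : set (m.-tuple R) := [set t | forall i, B i (tnth t i)].

Lemma measurable_tbox m (B : 'I_m -> set R) : (forall i, measurable (B i)) -> measurable (tbox B).
Proof.
move=> mB; rewrite (_ : tbox B = \bigcap_(i in [set: 'I_m]) ((fun t => tnth t i) @^-1` B i)).
  apply: fin_bigcap_measurable => [|i _]; first exact: finite_finset.
  by rewrite -[X in measurable X]setTI; apply: measurable_tnth => //; exact: mB.
by apply/seteqP; split => t /= h i => [_|]; apply: h.
Qed.

(** Boxes form a generating family that is stable under intersection. *)
Lemma measurable_tuple_boxes m : @measurable _ (m.-tuple R) =
  <<s [set A | exists2 B : 'I_m -> set R, (forall i, measurable (B i)) & A = tbox B] >>.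
Proof.
apply/seteqP; split.
  apply: smallest_sub; first exact: smallest_sigma_algebra.
  rewrite -bigcup_seq => A [i _] [Y mY <-]; apply: sub_sigma_algebra.
  exists (fun j => if j == i then Y else setT) => [j|]; first by case: eqP.
  rewrite setTI; apply/seteqP; split => t /=.
    by move=> Yt j; case: eqP => // ->.
  by move/(_ i); rewrite eqxx.
apply: smallest_sub; first exact: sigma_algebra_measurable.
by move=> A [B mB ->]; exact: measurable_tbox.
Qed.

Lemma integral_prod_coordinates m (g : 'I_m -> R -> R) :
  (forall i, measurable_fun [set: R] (g i)) -> (forall i x, (0 <= g i x)%R) ->
  \int[lebesgue_tuple R m]_t (\prod_i g i (tnth t i))%:E = \prod_i \int[leb]_x (g i x)%:E.
Proof.
have mp k (h : 'I_k -> R -> R) : (forall i, measurable_fun [set: R] (h i)) ->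
    measurable_fun [set: k.-tuple R] (fun t => (\prod_i h i (tnth t i))%:E).
  move=> mh; apply/measurable_EFinP; apply: measurable_prod => i _.
  by apply: (measurableT_comp (mh i)); exact: measurable_tnth.
elim: m g => [|m IH] g mg g0.
  rewrite integral_lebesgue_tuple0 ?big_ord0//; first exact: mp.
  by move=> t; rewrite big_ord0.
rewrite integral_lebesgue_tupleS; [|exact: mp|by move=> t; rewrite lee_fin prodr_ge0].
have Q0 : 0 <= \prod_(i < m) \int[leb]_x (g (lift ord0 i) x)%:E.
  by apply: prode_ge0 => i _; apply: integral_ge0 => x _; rewrite lee_fin.
rewrite big_ord_recl -IH//.
set Q := \int[lebesgue_tuple R m]_t (\prod_i g (lift ord0 i) (tnth t i))%:E.
transitivity (\int[leb]_x ((g ord0 x)%:E * Q)).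
  apply: eq_integral => x _; rewrite /Q -ge0_integralZl//.
  - apply: eq_integral => t _; rewrite big_ord_recl tnth_tcons0 -EFinM; congr (_ * _)%:E.
    by apply: eq_bigr => i _; rewrite tnth_tconsS.
  - exact: (mp m (fun i => g (lift ord0 i)) (fun i => mg _)).
  - by move=> t _; rewrite lee_fin prodr_ge0.
  - by rewrite lee_fin.
rewrite ge0_integralZr//.
- by apply/measurable_EFinP; exact: mg.
- by move=> x _; rewrite lee_fin.
- by apply: integral_ge0 => t _; rewrite lee_fin prodr_ge0.
Qed.

Definition gauss_density m (t : m.-tuple R) : R := (\prod_(i < m) normal_pdf 0 1 (tnth t i))%R.

Lemma gauss_density_ge0 m (t : m.-tuple R) : (0 <= gauss_density t)%R.
Proof. by apply: prodr_ge0 => i _; exact: normal_pdf_ge0. Qed.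

Lemma measurable_gauss_density m : measurable_fun [set: m.-tuple R] (@gauss_density m).
Proof.
apply: measurable_prod => i _; apply: (measurableT_comp (measurable_normal_pdf _ _)).
exact: measurable_tnth.
Qed.

Lemma integral_gauss_tbox m (B : 'I_m -> set R) : (forall i, measurable (B i)) ->
  \int[lebesgue_tuple R m]_(t in tbox B) (gauss_density t)%:E = \prod_i normal_prob 0 1 (B i).
Proof.
move=> mB; rewrite integral_mkcond.
pose g i x : R := (\1_(B i) x * normal_pdf 0 1 x)%R.
rewrite (eq_integral (fun t => (\prod_i g i (tnth t i))%:E)); last first.
  move=> t _; rewrite patchE; case: ifPn => [tB|tB].
    rewrite /gauss_density; congr (_%:E); apply: eq_bigr => i _.
    by rewrite /g indicE mem_set ?mul1r//; move: tB; rewrite inE; exact.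
  have [i Bi] : exists i, ~ B i (tnth t i) by apply/existsNP => h; move: tB; rewrite notin_setE; exact.
  by rewrite (bigD1 i)//= /g indicE memNset// !mul0r.
rewrite integral_prod_coordinates => [|i|i x].
- apply: eq_bigr => i _; rewrite /normal_prob [RHS]integral_mkcond; apply: eq_integral => x _.
  by rewrite patchE /g indicE; case: ifPn => _; rewrite ?mul1r ?mul0r.
- by apply: measurable_funM; [exact: measurable_indic|exact: measurable_normal_pdf].
- by rewrite mulr_ge0// normal_pdf_ge0.
Qed.

Lemma integral_gauss_density m : \int[lebesgue_tuple R m]_t (gauss_density t)%:E = 1.
Proof.
rewrite (@integral_prod_coordinates m (fun _ => normal_pdf 0 1)) => [|i|i x]; [|exact: measurable_normal_pdf|exact: normal_pdf_ge0].
by rewrite big1// => i _; rewrite integral_normal_pdf.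
Qed.

Lemma gauss_densityE m (t : m.-tuple R) :
  gauss_density t = ((normal_peak 1 : R) ^+ m * expR (- (2^-1 * tnorm2 t)))%R.
Proof.
rewrite /gauss_density; under eq_bigr do rewrite normal_pdfE ?oner_neq0// /normal_fun subr0 expr1n.
rewrite big_split/= prodr_const card_ord -expR_sum; congr (_ * expR _)%R.
rewrite /tnorm2 mulr_sumr -sumrN; apply: eq_bigr => i _.
by rewrite mulNr mulrC.
Qed.

End gaussian_tuples.

Section law.
Context d (T : measurableType d) (R : realType) (P : probability T R) (I : finType).
Variable X : I -> {RV P >-> R}.
Hypothesis indepX : mutually_independent P (fun i => X i : T -> R).
Hypothesis normalX : forall i (B : set R), measurable B -> distribution P (X i) B = normal_prob 0 1 B.
Local Open Scope ereal_scope.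

Definition rv_tuple (w : T) : #|I|.-tuple R := [tuple X (enum_val i) w | i < #|I|].

Lemma measurable_rv_tuple : measurable_fun [set: T] rv_tuple.
Proof. by apply: measurable_mktuple => i; exact: measurable_funPT. Qed.

(** On boxes this is independence; boxes determine a finite measure. *)
Lemma law_rv_tuple (S : set (#|I|.-tuple R)) : measurable S ->
  P (rv_tuple @^-1` S) = \int[lebesgue_tuple R #|I|]_(t in S) (gauss_density t)%:E.
Proof.
move=> mS.
pose mg := @measurable_gauss_density R #|I|.
pose g0 := @gauss_density_ge0 R #|I|.
pose m1 : {measure set _ -> \bar R} :=
  measure_function_pushforward__canonical__measure_function_Measure P measurable_rv_tuple.
pose m2 : {measure set _ -> \bar R} := density_measure (lebesgue_tuple R #|I|) mg g0.
have -> : P (rv_tuple @^-1` S) = m1 S by [].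
have -> : \int[lebesgue_tuple R #|I|]_(t in S) (gauss_density t)%:E = m2 S by [].
apply: (measure_unique [set A | exists2 B : 'I_#|I| -> set R, (forall i, measurable (B i)) & A = tbox B] (fun=> setT)).
- exact: measurable_tuple_boxes.
- move=> _ _ [B mB ->] [B' mB' ->]; exists (fun i => B i `&` B' i) => [i|].
    exact: measurableI.
  by apply/seteqP; split => t /= => [[h h'] i|h]; [split; [exact: h|exact: h']|split => i; have [] := h i].
- by move=> _; exists (fun=> setT) => //; apply/seteqP; split.
- by apply/seteqP; split => // t _; exists 0%N.
- move=> _ [B mB ->]; rewrite [RHS]integral_gauss_tbox//.
  pose B' i := B (enum_rank i).
  rewrite [LHS](_ : _ = P (\bigcap_(i in [set` [set: I]%SET]) (X i @^-1` B' i))); last first.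
    congr (P _); apply/seteqP; split => w /= h => [i _|i].
      by have := h (enum_rank i); rewrite tnth_mktuple enum_rankK.
    by rewrite tnth_mktuple; have := h (enum_val i); rewrite /B' enum_valK; apply; rewrite /= inE.
  rewrite indepX; last by move=> i; exact: mB.
  rewrite (eq_bigl xpredT); last by move=> i; rewrite inE.
  rewrite (reindex (@enum_val I predT))/=; last first.
    by apply: onW_bij; exact: enum_val_bij.
  apply: eq_bigr => i _; rewrite /B' enum_valK.
  exact: (normalX (enum_val i) (mB i)).
- move=> _; rewrite (le_lt_trans (probability_le1 P _)) ?ltry//.
  by rewrite -[X in measurable X]setTI; exact: measurable_rv_tuple.
- exact: mS.
Qed.

Lemma integral_rv_tuple (F : #|I|.-tuple R -> \bar R) : measurable_fun [set: #|I|.-tuple R] F ->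
  (forall t, 0 <= F t) ->
  \int[P]_w F (rv_tuple w) = \int[lebesgue_tuple R #|I|]_t (F t * (gauss_density t)%:E).
Proof.
move=> mF F0.
pose mg := @measurable_gauss_density R #|I|.
pose g0 := @gauss_density_ge0 R #|I|.
pose m1 : {measure set _ -> \bar R} :=
  measure_function_pushforward__canonical__measure_function_Measure P measurable_rv_tuple.
pose m2 : {measure set _ -> \bar R} := density_measure (lebesgue_tuple R #|I|) mg g0.
transitivity (\int[m1]_t F t).
  by rewrite [RHS](@ge0_integral_pushforward _ _ _ _ _ _ measurable_rv_tuple)// preimage_setT.
transitivity (\int[m2]_t F t); last exact: ge0_integral_density.
by apply: eq_measure_integral => A mA _; exact: law_rv_tuple.
Qed.

End law.

(** * An isometry separating the corner from the last column *)
Section isometries.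
Variable R : realType.

Definition tlin m (c : R) (s t : m.-tuple R) : m.-tuple R := [tuple c * tnth s i + tnth t i | i < m].

(** Polarization. *)
Lemma orthogonal_of_norm m (Q : 'M[R]_m) :
  (forall t, tnorm2 (tmul t Q) = tnorm2 t) -> Q *m Q^T = 1%:M.
Proof.
move=> nQ; pose S := Q *m Q^T.
have SE (u : 'rV[R]_m) : (u *m S *m u^T) 0 0 = (u *m u^T) 0 0.
  have uE : u = trow [tuple u 0 i | i < m] by apply/rowP => i; rewrite mxE tnth_mktuple.
  rewrite uE; have := nQ [tuple u 0 i | i < m]; rewrite !tnorm2E trow_tmul trmx_mul => <-.
  by rewrite /S !mulmxA.
have Sij (i j : 'I_m) : (delta_mx (0 : 'I_1) i *m S *m (delta_mx (0 : 'I_1) j)^T) 0 0 = S i j.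
  by rewrite trmx_delta -colE -rowE !mxE.
have S1 i : S i i = 1.
  by rewrite -Sij SE trmx_delta mul_delta_mx mxE !eqxx.
have symS i j : S i j = S j i by rewrite /S -[in LHS](trmxK Q) -trmx_mul mxE trmxK.
change (S = 1%:M); clearbody S; apply/matrixP => i j; rewrite mxE; case: (eqVneq i j) => [->|ij]; first by rewrite S1.
have := SE (delta_mx 0 i + delta_mx 0 j).
have add00 (A B : 'M[R]_1) : (A + B) 0 0 = A 0 0 + B 0 0 by rewrite mxE.
have d00 (k l : 'I_m) : (delta_mx (0 : 'I_1) k *m (delta_mx (0 : 'I_1) l)^T) 0 0 = (k == l)%:R :> R.
  by rewrite trmx_delta mul_delta_mx_cond; case: (k == l); rewrite ?mulr1n ?mulr0n !mxE ?eqxx.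
rewrite linearD/= !(mulmxDl, mulmxDr) !add00 !Sij !d00 !S1 (symS j i) !eqxx (eq_sym j i) (negbTE ij) => h.
have : S i j *+ 2 = 0 by move: h => /=; lra.
by move/eqP; rewrite mulrn_eq0/= => /eqP.
Qed.

(** The two dimensions are equal but need not be convertible. *)
Lemma integral_isometry m m' (f : m.-tuple R -> m'.-tuple R) (F : m'.-tuple R -> \bar R) : m = m' ->
  (forall c s t, f (tlin c s t) = tlin c (f s) (f t)) -> (forall t, tnorm2 (f t) = tnorm2 t) ->
  measurable_fun [set: m'.-tuple R] F -> (forall t, 0 <= F t)%E ->
  (\int[lebesgue_tuple R m]_t F (f t) = \int[lebesgue_tuple R m']_t F t)%E.
Proof.
move=> e; move: F f; rewrite -{m'}e => F f lf nf mF F0.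
pose g (u : 'rV[R]_m) := trow (f [tuple u 0 i | i < m]).
have lg : linear g.
  move=> c u v; rewrite /g (_ : [tuple _ | _ < _] = tlin c [tuple u 0 i | i < m] [tuple v 0 i | i < m]).
    by rewrite lf; apply/rowP => i; rewrite !mxE tnth_mktuple.
  by apply: eq_from_tnth => i; rewrite !tnth_mktuple !mxE.
pose gL : {linear 'rV[R]_m -> 'rV[R]_m} := HB.pack g (GRing.isLinear.Build _ _ _ _ g lg).
have fE t : f t = tmul t (lin1_mx gL).
  apply: trow_inj; rewrite trow_tmul mul_rV_lin1 /= /g; congr (trow (f _)).
  by apply: eq_from_tnth => i; rewrite tnth_mktuple mxE.
under eq_integral do rewrite fE.
by apply: integral_tmul => //; apply: orthogonal_of_norm => t; rewrite -fE.
Qed.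

End isometries.

Section assembling.
Variables (R : realType) (b n : nat).

Definition gdim m := #|{: 'I_m * 'I_m * 'I_b}|.

Lemma gdimS : (gdim n + (n * b + (n * b + b)))%N = gdim n.+1.
Proof. by rewrite /gdim !card_prod !card_ord; nia. Qed.

Definition tleft m k (t : (m + k).-tuple R) : m.-tuple R := [tuple tnth t (lshift k i) | i < m].
Definition tright m k (t : (m + k).-tuple R) : k.-tuple R := [tuple tnth t (rshift m i) | i < k].

Lemma tleft_tcat m k (s : m.-tuple R) (t : k.-tuple R) : tleft (tcat s t) = s.
Proof. by apply: eq_from_tnth => i; rewrite tnth_mktuple tnth_tcat_lshift. Qed.

Lemma tright_tcat m k (s : m.-tuple R) (t : k.-tuple R) : tright (tcat s t) = t.
Proof. by apply: eq_from_tnth => i; rewrite tnth_mktuple tnth_tcat_rshift. Qed.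

Lemma tnorm2_left_right m k (t : (m + k).-tuple R) : tnorm2 t = tnorm2 (tleft t) + tnorm2 (tright t).
Proof.
by rewrite /tnorm2 big_split_ord; congr (_ + _); apply: eq_bigr => i _; rewrite tnth_mktuple.
Qed.

Lemma tleft_tlin m k c (s t : (m + k).-tuple R) : tleft (tlin c s t) = tlin c (tleft s) (tleft t).
Proof. by apply: eq_from_tnth => i; rewrite !tnth_mktuple. Qed.

Lemma tright_tlin m k c (s t : (m + k).-tuple R) : tright (tlin c s t) = tlin c (tright s) (tright t).
Proof. by apply: eq_from_tnth => i; rewrite !tnth_mktuple. Qed.

Definition adj_sign (k : 'I_b) : R := if k == 0%N :> nat then 1 else -1.

Lemma adj_sign_sqr k : adj_sign k ^+ 2 = 1.
Proof. by rewrite /adj_sign; case: ifP; rewrite ?sqrrN expr1n. Qed.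

(** Coordinates adapted to the last row and column: y lists the components of the
    entries of X in the corner, x those of the last diagonal entry, and v, v' are
    the normalized sums and differences of the components of opposite entries X_in,
    X_ni, ordered so that v is sqrt 2 times the component of the self-adjoint part. *)
Definition assemble (y : (gdim n).-tuple R) (v v' : (n * b).-tuple R) (x : b.-tuple R) :
    (gdim n.+1).-tuple R :=
  [tuple (let: (i, j, k) := enum_val p in
    match unlift ord_max i, unlift ord_max j with
    | Some i', Some j' => tnth y (enum_rank (i', j', k))
    | Some i', None => (Num.sqrt 2)^-1 * (tnth v (bidx i' k) + tnth v' (bidx i' k))
    | None, Some j' => (Num.sqrt 2)^-1 * (adj_sign k * (tnth v (bidx j' k) - tnth v' (bidx j' k)))
    | None, None => tnth x k
    end) | p < gdim n.+1].

Lemma tnth_assemble y v v' x i j k : tnth (assemble y v v' x) (enum_rank (i, j, k)) =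
    match unlift ord_max i, unlift ord_max j with
    | Some i', Some j' => tnth y (enum_rank (i', j', k))
    | Some i', None => (Num.sqrt 2)^-1 * (tnth v (bidx i' k) + tnth v' (bidx i' k))
    | None, Some j' => (Num.sqrt 2)^-1 * (adj_sign k * (tnth v (bidx j' k) - tnth v' (bidx j' k)))
    | None, None => tnth x k
    end.
Proof. by rewrite tnth_mktuple enum_rankK. Qed.

Lemma assemble_tlin c y1 v1 v1' x1 y2 v2 v2' x2 :
  assemble (tlin c y1 y2) (tlin c v1 v2) (tlin c v1' v2') (tlin c x1 x2) =
  tlin c (assemble y1 v1 v1' x1) (assemble y2 v2 v2' x2).
Proof.
apply: eq_from_tnth => p; rewrite -(enum_valK p); case: (enum_val p) => -[i j] k.
rewrite [RHS]tnth_mktuple !tnth_assemble.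
by case: (unlift ord_max i) => [i'|]; case: (unlift ord_max j) => [j'|]; rewrite !tnth_mktuple; ring.
Qed.

Lemma sum_ord_max m (G : 'I_m.+1 -> R) :
  \sum_i G i = \sum_(i < m) G (lift ord_max i) + G ord_max.
Proof.
rewrite big_ord_recr/=; congr (_ + _); apply: eq_bigr => i _; congr G.
exact: widen_ord_lift_max.
Qed.

Lemma sum_gdim m (G : 'I_m * 'I_m * 'I_b -> R) :
  \sum_(p < gdim m) G (enum_val p) = \sum_(i < m) \sum_(j < m) \sum_(k < b) G (i, j, k).
Proof.
rewrite pair_big pair_big/= (reindex (fun q : 'I_m * 'I_m * 'I_b => enum_rank q))/=; last first.
  by apply: onW_bij; exact: enum_rank_bij.
by apply: eq_bigr => -[[i j] k] _; rewrite enum_rankK.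
Qed.

Lemma tnorm2_assemble y v v' x :
  tnorm2 (assemble y v v' x) = tnorm2 y + tnorm2 v + tnorm2 v' + tnorm2 x.
Proof.
rewrite /tnorm2.
under eq_bigr do rewrite -[p in tnth _ p]enum_valK.
rewrite (sum_gdim (fun q => tnth (assemble y v v' x) (enum_rank q) ^+ 2)) sum_ord_max.
under eq_bigr do rewrite sum_ord_max.
rewrite big_split/= sum_ord_max.
have s2 : (Num.sqrt 2)^-1 ^+ 2 = 2^-1 :> R by rewrite exprVn sqr_sqrtr.
rewrite -!addrA; congr (_ + _).
  under [RHS]eq_bigr do rewrite -[i in tnth _ i]enum_valK.
  rewrite (sum_gdim (fun q => tnth y (enum_rank q) ^+ 2)).
  apply: eq_bigr => i _; apply: eq_bigr => j _; apply: eq_bigr => k _.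
  by rewrite tnth_assemble !liftK.
rewrite addrA addrA; congr (_ + _); last first.
  by apply: eq_bigr => k _; rewrite tnth_assemble unlift_none.
rewrite !big_bidx -!big_split/=; apply: eq_bigr => i _; rewrite -!big_split/=; apply: eq_bigr => k _.
rewrite !tnth_assemble liftK unlift_none !exprMn adj_sign_sqr s2.
by field.
Qed.

Lemma integral_assemble (F : (gdim n.+1).-tuple R -> \bar R) :
  measurable_fun [set: (gdim n.+1).-tuple R] F -> (forall t, 0 <= F t)%E ->
  (\int[lebesgue_tuple R (gdim n.+1)]_t F t =
   \int[lebesgue_tuple R (gdim n)]_y \int[lebesgue_tuple R (n * b)]_v
   \int[lebesgue_tuple R (n * b)]_v' \int[lebesgue_tuple R b]_x F (assemble y v v' x))%E.
Proof.
move=> mF F0.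
pose f (t : (gdim n + (n * b + (n * b + b))).-tuple R) :=
  assemble (tleft t) (tleft (tright t)) (tleft (tright (tright t))) (tright (tright (tright t))).
have lf c s t : f (tlin c s t) = tlin c (f s) (f t).
  by rewrite /f !(tright_tlin, tleft_tlin) assemble_tlin.
have nf t : tnorm2 (f t) = tnorm2 t.
  rewrite /f tnorm2_assemble (tnorm2_left_right t) (tnorm2_left_right (tright t)).
  by rewrite (tnorm2_left_right (tright (tright t))) !addrA.
have ml m k : measurable_fun [set: (m + k).-tuple R] (@tleft m k).
  by apply: measurable_mktuple => i; exact: measurable_tnth.
have mr m k : measurable_fun [set: (m + k).-tuple R] (@tright m k).
  by apply: measurable_mktuple => i; exact: measurable_tnth.
have masm : measurable_fun [set: _.-tuple R] f.
  have mt d (T : measurableType d) k (g : T -> k.-tuple R) i : measurable_fun [set: T] g ->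
    measurable_fun [set: T] (fun t => tnth (g t) i) by exact: measurable_fun_tnth.
  apply: measurable_mktuple => p; case: (enum_val p) => -[i j] k.
  case: (unlift ord_max i) => [i'|]; case: (unlift ord_max j) => [j'|].
  - by apply: (measurable_fun_tnth _ (ml _ _)).
  - apply: measurable_funM => //; apply: measurable_funD; apply: measurable_fun_tnth.
    + by apply: (measurableT_comp (ml _ _)); exact: mr.
    + by apply: (measurableT_comp (ml _ _)); apply: (measurableT_comp (mr _ _)); exact: mr.
  - apply: measurable_funM => //; apply: measurable_funM => //; apply: measurable_funB; apply: measurable_fun_tnth.
    + by apply: (measurableT_comp (ml _ _)); exact: mr.
    + by apply: (measurableT_comp (ml _ _)); apply: (measurableT_comp (mr _ _)); exact: mr.
  - by apply: measurable_fun_tnth; apply: (measurableT_comp (mr _ _)); apply: (measurableT_comp (mr _ _)); exact: mr.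
rewrite -(integral_isometry gdimS lf nf mF F0).
have mtc m k (s : m.-tuple R) : measurable_fun [set: k.-tuple R] (fun t => tcat s t).
  by apply: measurable_tcat.
have mFf : measurable_fun [set: _.-tuple R] (fun t => F (f t)) by exact: measurableT_comp.
rewrite (integral_tcat mFf (fun t => F0 _)); apply: eq_integral => y _.
have mF1 : measurable_fun [set: _.-tuple R] (fun t => F (f (tcat y t))) by exact: (measurableT_comp mFf (mtc _ _ y)).
rewrite (integral_tcat mF1 (fun t => F0 _)); apply: eq_integral => v _.
have mF2 : measurable_fun [set: _.-tuple R] (fun t => F (f (tcat y (tcat v t)))) by exact: (measurableT_comp mF1 (mtc _ _ v)).
rewrite (integral_tcat mF2 (fun t => F0 _)); apply: eq_integral => v' _; apply: eq_integral => x _.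
by rewrite /f !(tleft_tcat, tright_tcat).
Qed.

End assembling.

(** * The law of the eigenvalues for a fixed corner *)
Section eigenvalue_function.
Variables (R : realType) (b n : nat).

(** The eigenvalues as a function of the matrix; by [eigsP] a self-adjoint matrix never
    falls back on the default tuple. *)
Definition eigs (M : hmatrix R b n) : n.-tuple R :=
  xget [tuple 0 | i < n] [set l | is_eigenvalues M l].

Lemma eigsP (M : hmatrix R b n) : b \in [:: 1; 2; 4]%N -> hmx_self_adjoint M ->
  is_eigenvalues M (eigs M).
Proof.
move=> hb sM; have [l hl] := hmx_eigenvalues_exist hb sM.
by rewrite /eigs; case: xgetP => [s _ //|/(_ l)].
Qed.

End eigenvalue_function.

Section integrals.
Variable R : realType.
Local Notation leb := (@lebesgue_measure R).
Local Open Scope ereal_scope.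

Definition trescale m (c : R) (t : m.-tuple R) : m.-tuple R := [tuple (c * tnth t i)%R | i < m].

Lemma measurable_trescale m c : measurable_fun [set: m.-tuple R] (@trescale m c).
Proof.
by apply: measurable_mktuple => i; apply: measurable_funM => //; exact: measurable_tnth.
Qed.

Lemma integral_gauss_rescale m (Psi : m.-tuple R -> \bar R) :
  measurable_fun [set: m.-tuple R] Psi -> (forall t, 0 <= Psi t) ->
  \int[lebesgue_tuple R m]_v (Psi (trescale (Num.sqrt 2)^-1 v) * (gauss_density v)%:E) =
  ((normal_peak 1 * Num.sqrt 2) ^+ m)%:E * \int[lebesgue_tuple R m]_u (Psi u * (tgauss u)%:E).
Proof.
move=> mPsi Psi0.
have s20 : (0 < Num.sqrt 2 :> R)%R by rewrite sqrtr_gt0.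
pose k : m.-tuple R := [tuple Num.sqrt 2 | i < m].
have mF : measurable_fun [set: m.-tuple R]
    (fun v => Psi (trescale (Num.sqrt 2)^-1 v) * (gauss_density v)%:E).
  apply: emeasurable_funM; first by apply: (measurableT_comp mPsi); exact: measurable_trescale.
  by apply/measurable_EFinP; exact: measurable_gauss_density.
rewrite (@integral_tscale _ _ k)//; first last.
- by move=> t; rewrite mule_ge0// lee_fin gauss_density_ge0.
- by apply/forallP => i; rewrite tnth_mktuple.
have -> : (\prod_i tnth k i = Num.sqrt 2 ^+ m)%R.
  by under eq_bigr do rewrite tnth_mktuple; rewrite prodr_const card_ord.
rewrite exprMn mulrC EFinM -muleA; congr (_ * _).
rewrite -ge0_integralZl//.
- apply: eq_integral => t _; rewrite muleCA; congr (_ * _).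
    congr Psi; apply: eq_from_tnth => i; rewrite !tnth_mktuple mulrA mulVf ?mul1r//.
  rewrite -EFinM gauss_densityE; congr (_ * expR _)%:E; congr (- _)%R.
  rewrite /tnorm2 mulr_sumr; apply: eq_bigr => i _.
  by rewrite !tnth_mktuple exprMn sqr_sqrtr// mulrA mulVf// mul1r.
- by apply: emeasurable_funM => //; apply/measurable_EFinP; exact: measurable_tgauss.
- by move=> t _; rewrite mule_ge0// lee_fin expR_ge0.
- by rewrite lee_fin exprn_ge0// normal_peak_ge0.
Qed.

Lemma integral_bnorm_rotated n b c (Q : 'M[R]_(n * b)) (Psi : n.-tuple R -> \bar R) :
  (Q *m Q^T = 1%:M)%R -> (0 < c)%R -> gamma_block b c%:E ->
  measurable_fun [set: n.-tuple R] Psi -> (forall t, 0 <= Psi t) ->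
  \int[lebesgue_tuple R (n * b)]_u (Psi (bnorm (tmul u Q)) * (tgauss u)%:E) =
  (c ^+ n)%:E * \int[lebesgue_tuple R n]_r ((tpos r)%:R%:E *
    (Psi r * (\prod_i (expR (- tnth r i) * tnth r i `^ (b%:R / 2 - 1)))%:E)).
Proof.
move=> QQ c0 gb mPsi Psi0.
pose phi (r : n.-tuple R) := Psi r * (expR (- \sum_i tnth r i))%:E.
have mphi : measurable_fun [set: n.-tuple R] phi.
  apply: emeasurable_funM => //; apply/measurable_EFinP.
  apply: (measurableT_comp (@measurable_expR R)); apply: measurable_funN.
  by apply: measurable_sum => i; exact: measurable_tnth.
have phi0 r : 0 <= phi r by rewrite mule_ge0// lee_fin expR_ge0.
have mpb : measurable_fun [set: (n * b).-tuple R] (fun w => phi (bnorm w)).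
  by apply: (measurableT_comp mphi); exact: measurable_bnorm.
transitivity (\int[lebesgue_tuple R (n * b)]_u phi (bnorm (tmul u Q))).
  apply: eq_integral => u _; rewrite /phi; congr (_ * (expR (- _))%:E)%E.
  have -> : tnorm2 u = tnorm2 (tmul u Q).
    by rewrite !tnorm2E trow_tmul trmx_mul mulmxA -(mulmxA (trow u)) QQ mulmx1.
  rewrite /tnorm2 big_bidx; apply: eq_bigr => i _; rewrite tnth_mktuple; apply: eq_bigr => k _.
  by rewrite (tnth_nth 0%R).
rewrite (integral_tmul QQ mpb (fun t => phi0 _)) (integral_bnorm c0 gb mphi phi0); congr (_ * _).
apply: eq_integral => r _; congr (_ * _); rewrite /phi -muleA -EFinM; congr (_ * _%:E).
by rewrite big_split/= -expR_sum sumrN.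
Qed.

Lemma integral_gauss_head m (G : R -> \bar R) : measurable_fun [set: R] G -> (forall x, 0 <= G x) ->
  \int[lebesgue_tuple R m.+1]_x (G (thead x) * (gauss_density x)%:E) =
  \int[leb]_x (G x * (normal_pdf 0 1 x)%:E).
Proof.
move=> mG G0.
have mF : measurable_fun [set: m.+1.-tuple R] (fun x => G (thead x) * (gauss_density x)%:E).
  apply: emeasurable_funM; first exact: (measurableT_comp mG (measurable_tnth ord0)).
  by apply/measurable_EFinP; exact: measurable_gauss_density.
rewrite integral_lebesgue_tupleS//; last first.
  by move=> t; rewrite mule_ge0// lee_fin gauss_density_ge0.
apply: eq_integral => x _.
have gE t : gauss_density (tcons (x, t)) = (normal_pdf 0 1 x * gauss_density t)%R :> R.
  by rewrite /gauss_density (prod_tcons (normal_pdf 0 1)).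
under eq_integral do rewrite thead_tcons gE EFinM muleA /=.
rewrite ge0_integralZl//.
- by rewrite integral_gauss_density mule1.
- by apply/measurable_EFinP; exact: measurable_gauss_density.
- by move=> t _; rewrite lee_fin gauss_density_ge0.
- by rewrite mule_ge0// lee_fin normal_pdf_ge0.
Qed.

End integrals.

Section arrow_roots.
Variables (R : realType) (n : nat) (mu : n.-tuple R).

(** The absolute values make the arrow polynomial split for every u, so that the roots
    are defined and measurable on the whole space. *)
Definition arrow_roots (u : n.+1.-tuple R) : n.+1.-tuple R :=
  xget [tuple 0 | i < n.+1] [set s | sorted >=%R s /\
    arrow_poly (tnth mu) (thead u) (fun i => `|tnth (tbehead u) i|) = \prod_(a <- s) ('X - a%:P)].

Lemma arrow_rootsP u : sorted >=%R (arrow_roots u) /\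
  arrow_poly (tnth mu) (thead u) (fun i => `|tnth (tbehead u) i|) =
  \prod_(a <- arrow_roots u) ('X - a%:P).
Proof.
have [|s hs] := @arrow_poly_split R n (tnth mu) (fun i => `|tnth (tbehead u) i|) (thead u).
  by move=> i; exact: normr_ge0.
by rewrite /arrow_roots; case: xgetP => [t _ //|/(_ s)].
Qed.

Lemma arrow_roots_unique x (r : n.-tuple R) (s : n.+1.-tuple R) : (forall i, 0 <= tnth r i) ->
  sorted >=%R s -> arrow_poly (tnth mu) x (tnth r) = \prod_(a <- s) ('X - a%:P) ->
  arrow_roots (tcons (x, r)) = s.
Proof.
move=> r0 ss sE; have [st tE] := arrow_rootsP (tcons (x, r)).
apply: sorted_roots_unique => //; rewrite -tE -sE thead_tcons tbehead_tcons; congr arrow_poly.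
by apply/funext => i; rewrite ger0_norm.
Qed.

Lemma measurable_arrow_roots : measurable_fun [set: n.+1.-tuple R] arrow_roots.
Proof.
apply: (@measurable_sorted_roots _ _ _ _ _ 0) => [u|z]; first by have [] := arrow_rootsP u.
have mth : measurable_fun [set: n.+1.-tuple R] (fun u => thead u) by exact: (measurable_tnth ord0).
pose p (u : n.+1.-tuple R) := arrow_poly (tnth mu) (thead u) (fun i => `|tnth (tbehead u) i|).
have pE u : (\prod_(i < n.+1) (z - tnth (arrow_roots u) i)) ^+ 1 = (p u).[z].
  rewrite expr1 /p (arrow_rootsP u).2 big_tuple horner_prod.
  by apply: eq_bigr => i _; rewrite hornerXsubC.
under eq_fun do rewrite pE /p /arrow_poly hornerD hornerN hornerM hornerXsubC horner_sum.
apply: measurable_funB.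
  by apply: measurable_funM => //; exact: measurable_funB.
apply: measurable_sum => i; under eq_fun do rewrite hornerM hornerC.
apply: measurable_funM => //; apply: (measurableT_comp (@normr_measurable _ _)).
by apply: measurable_fun_tnth; apply: measurable_behead.
Qed.

Lemma arrow_roots_pole_resid l : sdecr mu -> pole_ilace mu l -> arrow_roots (pole_resid mu l) = l.
Proof.
move=> smu il; rewrite (tcons_head_behead (pole_resid mu l)); apply: arrow_roots_unique.
- exact: pole_resid_ge0.
- by apply: (interlacing_sorted (mu := mu)); rewrite -pole_ilaceE.
- exact: arrow_poly_pole_resid.
Qed.

End arrow_roots.

Section corner_density_facts.
Variables (R : realType) (b n : nat) (aN : R).

Lemma corner_density_ge0 (mu : n.-tuple R) l : 0 <= corner_density b aN mu l.
Proof.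
rewrite /corner_density; case: (boolP (interlacing mu l)) => il; last by rewrite mulr0.
rewrite mulr1 !mulr_ge0 ?expR_ge0//.
  apply: prodr_ge0 => i _; apply: prodr_ge0 => j ij.
  have ls := interlacing_sorted il.
  rewrite subr_ge0 !(tnth_nth 0).
  apply: (sorted_leq_nth _ _ 0 ls); rewrite ?inE ?size_tuple//; last exact: ltnW.
    by move=> x y z /= yx zy; exact: le_trans zy yx.
  by move=> x /=.
by apply: prodr_ge0 => i _; apply: prodr_ge0 => j _; exact: powR_ge0.
Qed.

Lemma measurable_corner_density d (T : measurableType d) (f : T -> n.-tuple R) (g : T -> n.+1.-tuple R) :
  measurable_fun [set: T] f -> measurable_fun [set: T] g ->
  measurable_fun [set: T] (fun t => corner_density b aN (f t) (g t)).
Proof.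
move=> mf mg; have mfi i := measurable_fun_tnth i mf; have mgi i := measurable_fun_tnth i mg.
have mexp h : measurable_fun [set: T] h -> measurable_fun [set: T] (fun t => expR (h t) : R).
  by move=> mh; exact: (measurableT_comp (@measurable_expR R)).
rewrite /corner_density; apply: measurable_funM; [apply: measurable_funM; [apply: measurable_funM; [apply: measurable_funM|]|]|].
- apply: mexp; apply: measurable_funN; apply: measurable_funM => //.
  by apply: measurable_sum => i; exact: measurable_funX.
- by apply: mexp; apply: measurable_funM => //; exact: measurable_sum.
- apply: measurable_prod => i _; under eq_fun do rewrite big_mkcond.
  by apply: measurable_prod => j _; case: (i < j)%N => //; exact: measurable_funB.
- apply: measurable_prod => i _; apply: measurable_prod => j _.
  apply: (measurableT_comp (@measurable_powR R _)); apply: (measurableT_comp (@normr_measurable _ _)).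
  exact: measurable_funB.
- under eq_fun do rewrite /interlacing forall_natmul.
  apply: measurable_prod => i _; under eq_fun do rewrite -mulnb natrM.
  by apply: measurable_funM; exact: measurable_ler_indic.
Qed.

Lemma measurable_corner_density_section (mu : n.-tuple R) :
  measurable_fun [set: n.+1.-tuple R] (corner_density b aN mu).
Proof. exact: (measurable_corner_density (f := fun=> mu)). Qed.

End corner_density_facts.

Section corner_law.
Variables (R : realType) (b n : nat).
Hypothesis hb : b \in [:: 1; 2; 4]%N.
Local Notation leb := (@lebesgue_measure R).
Variable aN : R.
Variables (M : hmatrix R b n) (mu : n.-tuple R).
Hypotheses (sM : hmx_self_adjoint M) (eM : is_eigenvalues M mu) (smu : sdecr mu).
Local Open Scope ereal_scope.

Lemma hmx_self_adjoint_border w x : hmx_self_adjoint (hborder M w x).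
Proof.
move=> k; apply/matrixP => i j; rewrite /hmx_adj; case: ifPn => k0; rewrite !mxE ?k0 ?(negbTE k0).
all: case: (unlift ord_max i) => [i'|]; case: (unlift ord_max j) => [j'|] //.
all: rewrite ?mul1r ?mulN1r ?opprK ?oppr0 //.
all: by rewrite -[in RHS](sM k) /hmx_adj ?k0 ?(negbTE k0) !mxE.
Qed.

Lemma eigs_border : exists Q : 'M[R]_(n * b), (Q *m Q^T = 1%:M)%R /\
  forall w x, eigs (hborder M w x) = arrow_roots mu (tcons (x, bnorm (tmul w Q))).
Proof.
have [_ cM] := eM; rewrite big_tuple in cM.
have [Q [QQ cQ]] := border_char_poly hb sM cM; exists Q; split => // w x.
have [sl cl] := eigsP hb (hmx_self_adjoint_border w x).
apply/esym/arrow_roots_unique => //.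
  by move=> i; rewrite tnth_mktuple sumr_ge0// => k _; exact: sqr_ge0.
apply: hmx_char_poly_unique (cQ w x) cl => //; last exact: monic_prod_XsubC.
by have [] := arrow_poly_monic_size (tnth mu) x (tnth (bnorm (tmul w Q))).
Qed.

(** The factors of the conditional density that depend on neither mu nor l. *)
Definition corner_factor (c : R) : R :=
  ((normal_peak 1 * Num.sqrt 2) ^+ (n * b) * c ^+ n *
   (normal_peak 1 * expR (- (2^-1 * aN ^+ 2))))%R.

(** For a fixed corner with simple spectrum, the integral over the last column and
    the last diagonal entry becomes an integral over the eigenvalues: rotate the
    column into the eigenbasis, pass to squared norms, then to the roots. *)
Theorem integral_corner_law c (Phi : n.+1.-tuple R -> \bar R) : (0 < c)%R -> gamma_block b c%:E ->
  measurable_fun [set: n.+1.-tuple R] Phi -> (forall l, 0 <= Phi l) ->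
  \int[lebesgue_tuple R (n * b)]_v \int[leb]_x
    (Phi (eigs (hborder M (trescale (Num.sqrt 2)^-1 v) (aN + x)%R)) * (normal_pdf 0 1 x)%:E *
     (gauss_density v)%:E) =
  (corner_factor c * corner_constant b aN mu)%:E *
  \int[lebesgue_tuple R n.+1]_l (Phi l * (corner_density b aN mu l)%:E).
Proof.
move=> c0 gb mPhi Phi0; have [Q [QQ rE]] := eigs_border.
pose f (u : n.+1.-tuple R) := Phi (arrow_roots mu u) * (normal_pdf aN 1 (thead u))%:E.
have mf : measurable_fun [set: n.+1.-tuple R] f.
  apply: emeasurable_funM; first by apply: (measurableT_comp mPhi); exact: measurable_arrow_roots.
  apply/measurable_EFinP; apply: (measurableT_comp (measurable_normal_pdf _ _)).
  exact: (measurable_tnth ord0).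
have f0 u : 0 <= f u by rewrite mule_ge0// lee_fin normal_pdf_ge0.
pose Theta (r : n.-tuple R) := \int[leb]_x f (tcons (x, r)).
have mfp : measurable_fun [set: measurableTypeR R * n.-tuple R] (fun p => f (tcons p)).
  by apply: (measurableT_comp mf); exact: measurable_tcons.
have mTheta : measurable_fun [set: n.-tuple R] Theta.
  exact: (measurable_fun_fubini_tonelli_G (m1 := leb) (fun p => f (tcons p)) mfp (fun p => f0 _)).
have Theta0 r : 0 <= Theta r by apply: integral_ge0 => x _.
have mfr r : measurable_fun [set: R] (fun x => f (tcons (x, r))).
  by apply: (measurableT_comp mf); apply: measurable_tcons_pair.
have ThetaE r : Theta r = \int[leb]_x (Phi (arrow_roots mu (tcons ((aN + x)%R, r))) * (normal_pdf 0 1 x)%:E).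
  rewrite /Theta -(ge0_integral_shift aN (mfr r) (fun x => f0 _)).
  apply: eq_integral => x _; rewrite /f thead_tcons /= addrC; congr (_ * _%:E).
  by rewrite !normal_pdfE ?oner_neq0// normal_fun_center /= addrC addrK.
transitivity (\int[lebesgue_tuple R (n * b)]_v
    (Theta (bnorm (tmul (trescale (Num.sqrt 2)^-1 v) Q)) * (gauss_density v)%:E)).
  apply: eq_integral => v _; rewrite ThetaE -ge0_integralZr//.
  - by apply: eq_integral => x _; rewrite rE.
  - apply: emeasurable_funM; last by apply/measurable_EFinP; exact: measurable_normal_pdf.
    apply: (measurableT_comp mPhi); apply: (measurableT_comp (@measurable_arrow_roots _ _ _)).
    by apply: measurable_tcons_pair => //; exact: measurable_funD.
  - by move=> x _; rewrite mule_ge0// lee_fin normal_pdf_ge0.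
  - by rewrite lee_fin gauss_density_ge0.
pose Psi w := Theta (bnorm (tmul w Q)).
have mPsi : measurable_fun [set: (n * b).-tuple R] Psi.
  apply: (measurableT_comp mTheta); apply: (measurableT_comp (@measurable_bnorm _ _ _)).
  exact: measurable_tmul.
rewrite (integral_gauss_rescale mPsi (fun w => Theta0 _)).
rewrite (integral_bnorm_rotated QQ c0 gb mTheta Theta0).
pose W (r : n.-tuple R) := (\prod_i (expR (- tnth r i) * tnth r i `^ (b%:R / 2 - 1)))%R.
have mW : measurable_fun [set: n.-tuple R] W.
  apply: measurable_prod => i _; apply: measurable_funM.
    by apply: (measurableT_comp (@measurable_expR R)); apply: measurable_funN; exact: measurable_tnth.
  by apply: (measurableT_comp (@measurable_powR R _)); exact: measurable_tnth.
have W0 r : (0 <= W r)%R by apply: prodr_ge0 => i _; rewrite mulr_ge0 ?expR_ge0 ?powR_ge0.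
pose phi u := f u * (W (tbehead u))%:E.
have mtb : measurable_fun [set: n.+1.-tuple R] (@tbehead R n) by exact: measurable_behead.
have mphi : measurable_fun [set: n.+1.-tuple R] phi.
  apply: emeasurable_funM; first exact: mf.
  by apply/measurable_EFinP; exact: (measurableT_comp mW).
have phi0 u : 0 <= phi u by rewrite mule_ge0// lee_fin.
have mtp : measurable_fun [set: n.-tuple R] (fun t => (tpos t)%:R%:E : \bar R).
  by apply/measurable_EFinP; exact: measurable_tpos.
have -> : \int[lebesgue_tuple R n]_r ((tpos r)%:R%:E * (Theta r * (W r)%:E)) =
    \int[lebesgue_tuple R n.+1]_u ((tpos (tbehead u))%:R%:E * phi u).
  rewrite integral_lebesgue_tupleS_swap; first last.
  - by move=> u; rewrite mule_ge0// lee_fin.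
  - apply: emeasurable_funM; last exact: mphi.
    exact: (measurableT_comp mtp mtb).
  apply: eq_integral => r _; rewrite /phi.
  under [RHS]eq_integral do rewrite tbehead_tcons/=.
  rewrite ge0_integralZl//.
  - rewrite ge0_integralZr//; last by rewrite lee_fin.
    exact: mfr.
  - by apply: emeasurable_funM; first exact: mfr.
  - by move=> x _; rewrite mule_ge0// lee_fin.
rewrite (integral_pole_resid smu mphi phi0).
set k := (normal_peak 1 * expR (- (2^-1 * aN ^+ 2)))%R.
have k0 : (0 <= k)%R by rewrite mulr_ge0 ?normal_peak_ge0 ?expR_ge0.
have cc0 : (0 <= corner_constant b aN mu)%R by apply: ltW; exact: corner_constant_gt0.
have mcd : measurable_fun [set: n.+1.-tuple R] (fun l => (corner_density b aN mu l)%:E).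
  by apply/measurable_EFinP; exact: measurable_corner_density_section.
transitivity (((normal_peak 1 * Num.sqrt 2) ^+ (n * b))%:E * ((c ^+ n)%:E *
  ((k * corner_constant b aN mu)%:E *
    \int[lebesgue_tuple R n.+1]_l (Phi l * (corner_density b aN mu l)%:E)))); last first.
  by rewrite !muleA -!EFinM; congr (_%:E * _); rewrite /corner_factor -/k; ring.
congr (_ * (_ * _)).
rewrite -ge0_integralZl//; first last.
- by rewrite lee_fin mulr_ge0.
- by move=> l _; rewrite mule_ge0// lee_fin corner_density_ge0.
- by apply: emeasurable_funM.
apply: eq_integral => l _; rewrite [RHS]muleCA -EFinM -mulrA -corner_densityE// /phi /f.
have [il|il] := boolP (pole_ilace mu l); last by rewrite !mul0r mulr0 mul0e mule0.
rewrite mul1e mul1r arrow_roots_pole_resid// -!muleA -!EFinM; congr (_ * _%:E).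
rewrite normal_pdfE ?oner_neq0// /normal_fun /W.
set x := thead _.
have -> : expR (- (x - aN) ^+ 2 / (1 ^+ 2 *+ 2)) =
    (expR (- (2^-1 * aN ^+ 2)) * (expR (- (2^-1 * x ^+ 2)) * expR (aN * x)))%R.
  by rewrite -!expRD; congr expR; rewrite expr1n; field.
by rewrite /k; ring.
Qed.

End corner_law.

(** * Integration over the corner *)
Section ensemble.
Variables (R : realType) (b : nat).

Definition gauss_matrix n (t : (gdim b n).-tuple R) : hmatrix R b n :=
  fun k => \matrix_(i, j) tnth t (enum_rank (i, j, k)).

Definition ensemble n (a : 'I_n -> R) (t : (gdim b n).-tuple R) : hmatrix R b n :=
  hmx_add (hmx_diag a) (hmx_self_adjoint_part (gauss_matrix t)).

Lemma ensembleE n (a : 'I_n -> R) t k i j : ensemble a t k i j =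
  (if (k == 0%N :> nat) && (i == j) then a i else 0) +
  2^-1 * (tnth t (enum_rank (i, j, k)) + adj_sign R k * tnth t (enum_rank (j, i, k))).
Proof.
rewrite /ensemble /hmx_self_adjoint_part /hmx_diag /hmx_adj /adj_sign /hmx_add /gauss_matrix.
case: (k == 0%N :> nat); rewrite !mxE; last by rewrite mulN1r.
by case: eqVneq => [->|]; rewrite ?mulr1n ?mulr0n ?mul1r.
Qed.

Lemma ensemble_self_adjoint n (a : 'I_n -> R) t : hmx_self_adjoint (ensemble a t).
Proof.
move=> k; apply/matrixP => i j; rewrite /hmx_adj.
have s2 := @adj_sign_sqr R b k.
have -> : (if k == 0%N :> nat then (ensemble a t k)^T else - (ensemble a t k)^T) i j =
    adj_sign R k * ensemble a t k j i.
  by rewrite /adj_sign; case: ifP => _; rewrite !mxE ?mul1r ?mulN1r.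
rewrite !ensembleE mulrDr mulrCA mulrDr mulrA -expr2 s2 mul1r [X in _ + _ * X]addrC; congr (_ + _).
rewrite /adj_sign; case: (k == 0%N :> nat) => /=; last by rewrite mulr0.
by rewrite mul1r eq_sym; case: eqVneq => // ->.
Qed.

Lemma measurable_ensemble n (a : 'I_n -> R) k :
  mx_measurable (fun t : (gdim b n).-tuple R => ensemble a t k).
Proof.
move=> i j; under eq_fun do rewrite ensembleE.
apply: measurable_funD => //; apply: measurable_funM => //; apply: measurable_funD.
  exact: measurable_tnth.
by apply: measurable_funM => //; exact: measurable_tnth.
Qed.

End ensemble.

(** In the adapted coordinates the matrix is a bordered corner, and the components v'
    disappear from it. *)
Lemma ensemble_assemble (R : realType) b n (a : 'I_n.+1 -> R) (y : (gdim b.+1 n).-tuple R) v v' x :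
  ensemble a (assemble y v v' x) =
  hborder (ensemble (fun i => a (widen_ord (leqnSn n) i)) y)
    (trescale (Num.sqrt 2)^-1 v) (a ord_max + thead x).
Proof.
apply/funext => k; apply/matrixP => i j; rewrite ensembleE [RHS]mxE !tnth_assemble.
have s2 := @adj_sign_sqr R b.+1 k; rewrite expr2 in s2.
case: unliftP => [i'|] ->; case: unliftP => [j'|] ->.
- by rewrite ensembleE widen_ord_lift_max (inj_eq lift_inj).
- rewrite [lift _ _ == _]eq_sym (negbTE (neq_lift _ _)) andbF add0r tnth_mktuple.
  by rewrite [adj_sign R k * (_ * _)]mulrCA (mulrA (adj_sign R k)) s2 mul1r; field; rewrite gt_eqF// sqrtr_gt0.
- rewrite (negbTE (neq_lift _ _)) andbF add0r tnth_mktuple -/(adj_sign R k).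
  by field; rewrite gt_eqF// sqrtr_gt0.
- rewrite eqxx andbT /adj_sign; case: ifPn => [/eqP k0|k0]; last first.
    by rewrite add0r mulN1r subrr mulr0.
  rewrite mul1r (_ : k = ord0); last exact: val_inj.
  by congr (_ + _); rewrite -[thead x]/(tnth x ord0); field.
Qed.

Lemma hmx_corner_border (R : realType) b n (M : hmatrix R b n) w x :
  hmx_corner (hborder M w x) = M.
Proof.
apply/funext => k; apply/matrixP => i j; rewrite !mxE.
by rewrite !widen_ord_lift_max !liftK.
Qed.

Section reduction.
Variables (R : realType) (b n : nat).
Hypothesis hb : b.+1 \in [:: 1; 2; 4]%N.
Variable a : 'I_n.+1 -> R.
Local Notation leb := (@lebesgue_measure R).
Local Notation a' := (fun i => a (widen_ord (leqnSn n) i)).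
Local Open Scope ereal_scope.

Definition spectrum m (c : 'I_m -> R) (t : (gdim b.+1 m).-tuple R) : m.-tuple R := eigs (ensemble c t).
Definition corner_spectrum (t : (gdim b.+1 n.+1).-tuple R) : n.-tuple R :=
  eigs (hmx_corner (ensemble a t)).

Lemma measurable_spectrum m (c : 'I_m -> R) :
  measurable_fun [set: (gdim b.+1 m).-tuple R] (spectrum c).
Proof.
apply: (measurable_eigenvalues hb (@measurable_ensemble R b.+1 m c)) => t.
exact/eigsP/ensemble_self_adjoint.
Qed.

Lemma measurable_corner_spectrum : measurable_fun [set: (gdim b.+1 n.+1).-tuple R] corner_spectrum.
Proof.
apply: (measurable_eigenvalues (M := fun t => hmx_corner (ensemble a t)) hb) => [k i j|t].
  by under eq_fun do rewrite mxE; exact: measurable_ensemble.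
exact/eigsP/hmx_self_adjoint_corner/ensemble_self_adjoint.
Qed.

Lemma gauss_density_assemble (y : (gdim b.+1 n).-tuple R) v v' x :
  gauss_density (assemble y v v' x) =
  (gauss_density y * gauss_density v * gauss_density v' * gauss_density x)%R :> R.
Proof.
rewrite !gauss_densityE tnorm2_assemble -(gdimS b.+1 n) !exprD !mulrDr !opprD !expRD.
by ring.
Qed.

Definition border_integral (M : hmatrix R b.+1 n) (Psi : n.+1.-tuple R -> \bar R) : \bar R :=
  \int[lebesgue_tuple R (n * b.+1)]_v \int[leb]_x
    (Psi (eigs (hborder M (trescale (Num.sqrt 2)^-1 v) (a ord_max + x)%R)) * (normal_pdf 0 1 x)%:E *
     (gauss_density v)%:E).

(** The integral of a function of both spectra is computed by integrating first over
    the last column and the last diagonal entry, the corner being fixed. *)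
Lemma integral_ensemble (F : n.-tuple R -> \bar R) (Psi : n.+1.-tuple R -> \bar R) :
  measurable_fun [set: n.-tuple R] F -> (forall m, 0 <= F m) ->
  measurable_fun [set: n.+1.-tuple R] Psi -> (forall l, 0 <= Psi l) ->
  \int[lebesgue_tuple R (gdim b.+1 n.+1)]_t
    (F (corner_spectrum t) * Psi (spectrum a t) * (gauss_density t)%:E) =
  \int[lebesgue_tuple R (gdim b.+1 n)]_y
    (F (spectrum a' y) * (gauss_density y)%:E * border_integral (ensemble a' y) Psi).
Proof.
move=> mF F0 mPsi Psi0.
have mgd m : measurable_fun [set: m.-tuple R] (fun t => (gauss_density t)%:E).
  by apply/measurable_EFinP; exact: measurable_gauss_density.
have gd0 m (t : m.-tuple R) : 0 <= (gauss_density t)%:E by rewrite lee_fin gauss_density_ge0.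
rewrite integral_assemble; first last.
- by move=> t; rewrite !mule_ge0.
- apply: emeasurable_funM; last exact: mgd.
  apply: emeasurable_funM; first exact: (measurableT_comp mF measurable_corner_spectrum).
  exact: (measurableT_comp mPsi (measurable_spectrum _)).
apply: eq_integral => y _.
pose M := ensemble a' y.
have sM : hmx_self_adjoint M by exact: ensemble_self_adjoint.
pose p (v : (n * b.+1).-tuple R) (x : R) :=
  Psi (eigs (hborder M (trescale (Num.sqrt 2)^-1 v) (a ord_max + x)%R)).
have p0 v x : 0 <= p v x by exact: Psi0.
have mp2 : measurable_fun [set: (n * b.+1).-tuple R * measurableTypeR R] (fun q => p q.1 q.2).
  apply: (measurableT_comp mPsi).
  apply: (measurable_eigenvalues (M := fun q : (n * b.+1).-tuple R * measurableTypeR R =>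
    hborder M (trescale (Num.sqrt 2)^-1 q.1) (a ord_max + q.2)%R) hb) => [k i j|q].
    under eq_fun do rewrite mxE.
    case: (unlift ord_max i) => [i'|]; case: (unlift ord_max j) => [j'|].
    - exact: measurable_cst.
    - apply: measurable_fun_tnth; apply: (measurableT_comp (@measurable_trescale _ _ _)).
      exact: measurable_fst.
    - apply: measurable_funM => //.
      apply: measurable_fun_tnth; apply: (measurableT_comp (@measurable_trescale _ _ _)).
      exact: measurable_fst.
    - case: (k == 0%N :> nat); last exact: measurable_cst.
      exact: measurable_funD.
  by apply: eigsP => //; exact: hmx_self_adjoint_border.
have mpv v : measurable_fun [set: R] (p v).
  exact: (measurableT_comp mp2 (measurable_pair1 v)).
have mnp : measurable_fun [set: R] (fun x => (normal_pdf 0 1 x)%:E : \bar R).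
  by apply/measurable_EFinP; exact: measurable_normal_pdf.
pose q v := \int[leb]_x (p v x * (normal_pdf 0 1 x)%:E).
have q0 v : 0 <= q v by apply: integral_ge0 => x _; rewrite mule_ge0// lee_fin normal_pdf_ge0.
have mq : measurable_fun [set: (n * b.+1).-tuple R] q.
  apply: (measurable_fun_fubini_tonelli_F (m2 := leb)
    (fun z : (n * b.+1).-tuple R * measurableTypeR R => p z.1 z.2 * (normal_pdf 0 1 z.2)%:E)).
    apply: emeasurable_funM => //.
    exact: (measurableT_comp mnp measurable_snd).
  by move=> z; rewrite mule_ge0// lee_fin normal_pdf_ge0.
have spE v v' x : spectrum a (assemble y v v' x) =
    eigs (hborder M (trescale (Num.sqrt 2)^-1 v) (a ord_max + thead x)%R).
  by rewrite /spectrum ensemble_assemble.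
have csE v v' x : corner_spectrum (assemble y v v' x) = spectrum a' y.
  by rewrite /corner_spectrum ensemble_assemble hmx_corner_border.
pose c := F (spectrum a' y) * (gauss_density y)%:E.
have c0 : 0 <= c by rewrite mule_ge0.
have inner v v' : \int[lebesgue_tuple R b.+1]_x
    (F (corner_spectrum (assemble y v v' x)) * Psi (spectrum a (assemble y v v' x)) *
     (gauss_density (assemble y v v' x))%:E) =
   c * (q v * (gauss_density v)%:E) * (gauss_density v')%:E.
  rewrite /q -(@integral_gauss_head R b (p v) (mpv v) (p0 v)).
  rewrite (eq_integral (fun x => c * (gauss_density v)%:E * (gauss_density v')%:E *
      (p v (thead x) * (gauss_density x)%:E))).
    rewrite ge0_integralZl//.
    - by rewrite -!muleA; congr (_ * (_ * _)); rewrite [RHS]muleCA; congr (_ * _); rewrite muleC.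
    - apply: emeasurable_funM; last exact: mgd.
      exact: (measurableT_comp (mpv v) (measurable_tnth ord0)).
    - by move=> x _; rewrite mule_ge0.
    - by rewrite !mule_ge0.
  move=> x _; rewrite spE csE gauss_density_assemble !EFinM /c -/(p v (thead x)) -!muleA; congr (_ * _).
  rewrite muleCA; congr (_ * _); rewrite muleCA; congr (_ * _); rewrite muleCA; congr (_ * _).
transitivity (\int[lebesgue_tuple R (n * b.+1)]_v (c * (q v * (gauss_density v)%:E))).
  apply: eq_integral => v _.
  transitivity (\int[lebesgue_tuple R (n * b.+1)]_v'
      (c * (q v * (gauss_density v)%:E) * (gauss_density v')%:E)).
    by apply: eq_integral => v' _; exact: inner.
  rewrite (ge0_integralZl _ _ (mgd _) (fun v' _ => gd0 _ v')); last by rewrite !mule_ge0.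
    by rewrite integral_gauss_density mule1.
  exact: measurableT.
rewrite ge0_integralZl //; last 2 first.
- by apply: emeasurable_funM; [exact: mq|exact: mgd].
- by move=> v _; rewrite mule_ge0.
rewrite /c; congr (_ * _); apply: eq_integral => v _.
rewrite /q -ge0_integralZr//.
- by apply: emeasurable_funM; [exact: mpv|exact: mnp].
- by move=> x _; rewrite mule_ge0// lee_fin normal_pdf_ge0.
Qed.

End reduction.

(** * Simplicity of the spectrum and the conditional density *)
Section strictly_decreasing.
Variable R : realType.

Lemma sdecrE m (t : m.-tuple R) :
  sdecr t = [forall i : 'I_m, forall j : 'I_m, (i < j)%N ==> (tnth t j < tnth t i)].
Proof.
rewrite /sdecr sorted_pairwise; last by move=> x y z /= yx zy; exact: lt_trans zy yx.
apply/(pairwiseP 0)/'forall_forallP => h.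
  by move=> i j; apply/implyP => ij; rewrite !(tnth_nth 0); apply: h; rewrite ?inE ?size_tuple.
move=> i j; rewrite !inE size_tuple => im jm ij.
by have := h (Ordinal im) (Ordinal jm); rewrite /= ij !(tnth_nth 0).
Qed.

Lemma measurable_sdecr m : measurable_fun [set: m.-tuple R] (fun t => (sdecr t)%:R : R).
Proof.
under eq_fun do rewrite sdecrE forall_natmul.
apply: measurable_prod => i _; under eq_fun do rewrite forall_natmul.
apply: measurable_prod => j _; case: (i < j)%N => /=; last exact: measurable_cst.
by apply: measurable_ltr_indic; exact: measurable_tnth.
Qed.

(** A repeated eigenvalue kills a factor of the Vandermonde product. *)
Lemma corner_density_sdecr b aN n (m : n.-tuple R) (l : n.+1.-tuple R) :
  ~~ sdecr l -> corner_density b aN m l = 0.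
Proof.
move=> nl; rewrite /corner_density; case: (boolP (interlacing m l)) => il; last by rewrite mulr0.
suff -> : \prod_(i < n.+1) \prod_(j < n.+1 | (i < j)%N) (tnth l i - tnth l j) = 0.
  by rewrite mulr0 !mul0r.
apply/eqP; apply: contraNT nl => p0; rewrite sdecrE.
apply/'forall_forallP => i j; apply/implyP => ij.
have lji : tnth l j <= tnth l i.
  rewrite !(tnth_nth 0).
  apply: (sorted_leq_nth _ _ 0 (interlacing_sorted il)); rewrite ?inE ?size_tuple//; last exact: ltnW.
    by move=> x y z /= yx zy; exact: le_trans zy yx.
  by move=> x /=.
rewrite lt_neqAle lji andbT; apply: contraNneq p0 => lE.
by rewrite (bigD1 i)//= (bigD1 j)//= lE subrr !mul0r.
Qed.

Lemma measurable_corner_constant b aN n :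
  measurable_fun [set: n.-tuple R] (corner_constant b aN).
Proof.
have mt i : measurable_fun [set: n.-tuple R] (fun t : n.-tuple R => tnth t i) by exact: measurable_tnth.
have mv : measurable_fun [set: n.-tuple R] (@vdm R n).
  apply: measurable_prod => i _; under eq_fun do rewrite big_mkcond.
  by apply: measurable_prod => j _; case: (i < j)%N => //; exact: measurable_funB.
have mexp (h : n.-tuple R -> R) : measurable_fun [set: n.-tuple R] h ->
    measurable_fun [set: n.-tuple R] (fun t => expR (h t) : R).
  by move=> mh; exact: (measurableT_comp (@measurable_expR R)).
apply: measurable_funM; [apply: measurable_funM; [apply: measurable_funM|]|].
- apply: mexp; apply: measurable_funM => //.
  by apply: measurable_sum => i; apply: measurable_funX.
- by apply: mexp; apply: measurable_funM => //; exact: measurable_sum.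
- exact: measurable_fun_inv.
- apply: (measurableT_comp (@measurable_powR R _)); apply: measurable_fun_inv.
  exact: measurable_funX.
Qed.

End strictly_decreasing.

(** As g is positive, the hypothesis says that S holds almost everywhere. *)
Lemma ge0_integral_ae_true d (T : measurableType d) (R : realType)
    (mu : {measure set T -> \bar R}) (S : T -> bool) (g : T -> R) (H : T -> \bar R) :
  measurable_fun [set: T] (fun t => (S t)%:R : R) -> measurable_fun [set: T] g ->
  (forall t, 0 < g t) -> measurable_fun [set: T] H -> (forall t, 0 <= H t)%E ->
  (\int[mu]_t ((~~ S t)%:R * g t)%:E = 0 ->
   \int[mu]_t (H t * (g t)%:E) = \int[mu]_t ((S t)%:R%:E * (H t * (g t)%:E)))%E.
Proof.
move=> mS mg g0 mH H0 N0.
have mN : measurable_fun [set: T] (fun t => ((~~ S t)%:R * g t)%:E : \bar R).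
  apply/measurable_EFinP; apply: measurable_funM => //.
  rewrite (_ : (fun _ => _) = fun t => 1 - (S t)%:R); first exact: measurable_funB.
  by apply/funext => t; case: (S t) => /=; rewrite ?subrr ?subr0.
have ae : ae_eq mu [set: T] (fun t => ((~~ S t)%:R * g t)%:E : \bar R) (cst 0%E).
  apply/(ae_eq_integral_abs mu measurableT mN); rewrite -[RHS]N0; apply: eq_integral => t _.
  by rewrite gee0_abs// lee_fin mulr_ge0// ltW.
have mHg : measurable_fun [set: T] (fun t => H t * (g t)%:E)%E.
  by apply: emeasurable_funM => //; exact/measurable_EFinP.
have Hg0 t : (0 <= H t * (g t)%:E)%E by rewrite mule_ge0// lee_fin ltW.
apply: ge0_ae_eq_integral => //.
- by apply: emeasurable_funM; [exact/measurable_EFinP|exact: mHg].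
- by move=> t _; rewrite mule_ge0// lee_fin.
- case: ae => N [mN' muN sub]; exists N; split => // t /= ht; apply: sub => /= h; apply: ht => _.
  have /= := h I; case: (S t) => /=; first by rewrite mul1e.
  by move/eqP; rewrite mul1r eqe gt_eqF.
Qed.

Section conclusion.
Variables (R : realType) (b : nat).
Hypothesis hb : b.+1 \in [:: 1; 2; 4]%N.
Variable k : R.
Hypotheses (k0 : 0 < k) (gk : gamma_block b.+1 k%:E).
Local Notation leb := (@lebesgue_measure R).
Local Open Scope ereal_scope.

(** The value 1 keeps the function positive at spectra that are not simple, which have
    probability 0. *)
Definition corner_normalization n (aN : R) (m : n.-tuple R) : R :=
  if sdecr m then (corner_factor b.+1 n aN k * corner_constant b.+1 aN m)%R else 1%R.

Lemma corner_normalization_gt0 n aN (m : n.-tuple R) : (0 < corner_normalization aN m)%R.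
Proof.
rewrite /corner_normalization; case: ifP => // sm.
rewrite mulr_gt0 ?corner_constant_gt0// /corner_factor.
by rewrite !mulr_gt0 ?exprn_gt0 ?mulr_gt0 ?normal_peak_gt0 ?expR_gt0 ?sqrtr_gt0 ?oner_neq0.
Qed.

Lemma measurable_corner_normalization n aN :
  measurable_fun [set: n.-tuple R] (@corner_normalization n aN).
Proof.
rewrite (_ : corner_normalization aN = fun m => (sdecr m)%:R *
    (corner_factor b.+1 n aN k * corner_constant b.+1 aN m) + (1 - (sdecr m)%:R))%R.
  have ms := @measurable_sdecr R n.
  apply: measurable_funD; last exact: measurable_funB.
  by apply: measurable_funM => //; apply: measurable_funM => //; exact: measurable_corner_constant.
apply/funext => m; rewrite /corner_normalization.
by case: (sdecr m); rewrite ?mul1r ?subrr ?addr0 ?mul0r ?subr0 ?add0r.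
Qed.

(** The conditional expectation of Psi lambda given mu = m. *)
Definition corner_kernel n (aN : R) (Psi : n.+1.-tuple R -> \bar R) (m : n.-tuple R) : \bar R :=
  \int[lebesgue_tuple R n.+1]_l (Psi l * (corner_normalization aN m * corner_density b.+1 aN m l)%:E).

Lemma measurable_corner_kernel n aN (Psi : n.+1.-tuple R -> \bar R) :
  measurable_fun [set: n.+1.-tuple R] Psi -> (forall l, 0 <= Psi l) ->
  measurable_fun [set: n.-tuple R] (corner_kernel aN Psi).
Proof.
move=> mPsi Psi0.
apply: (measurable_fun_fubini_tonelli_F (m2 := lebesgue_tuple R n.+1)
  (fun z : n.-tuple R * n.+1.-tuple R =>
    Psi z.2 * (corner_normalization aN z.1 * corner_density b.+1 aN z.1 z.2)%:E)).
  apply: emeasurable_funM; first exact: (measurableT_comp mPsi measurable_snd).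
  apply/measurable_EFinP; apply: measurable_funM.
    exact: (measurableT_comp (@measurable_corner_normalization n aN) measurable_fst).
  exact: (measurable_corner_density b.+1 aN measurable_fst measurable_snd).
move=> z; rewrite mule_ge0// lee_fin mulr_ge0 ?corner_density_ge0//.
by apply: ltW; exact: corner_normalization_gt0.
Qed.

Lemma corner_kernel_ge0 n aN (Psi : n.+1.-tuple R -> \bar R) m : (forall l, 0 <= Psi l) ->
  0 <= corner_kernel aN Psi m.
Proof.
move=> Psi0; apply: integral_ge0 => l _; rewrite mule_ge0// lee_fin mulr_ge0 ?corner_density_ge0//.
by apply: ltW; exact: corner_normalization_gt0.
Qed.

Section one_size.
Variables (n : nat) (a : 'I_n.+1 -> R).
Local Notation a' := (fun i => a (widen_ord (leqnSn n) i)).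
Local Notation aN := (a ord_max).

Lemma border_integral_kernel y (Psi : n.+1.-tuple R -> \bar R) : sdecr (spectrum a' y) ->
  measurable_fun [set: n.+1.-tuple R] Psi -> (forall l, 0 <= Psi l) ->
  border_integral a (ensemble a' y) Psi = corner_kernel aN Psi (spectrum (b := b) a' y).
Proof.
move=> sy mPsi Psi0.
have sM := ensemble_self_adjoint a' y.
rewrite /border_integral (integral_corner_law hb aN sM (eigsP hb sM) sy k0 gk mPsi Psi0).
rewrite /corner_kernel /corner_normalization sy -ge0_integralZl//.
- by apply: eq_integral => l _; rewrite muleCA -EFinM.
- by apply: emeasurable_funM => //; apply/measurable_EFinP; exact: measurable_corner_density_section.
- by move=> l _; rewrite mule_ge0// lee_fin corner_density_ge0.
- rewrite lee_fin; have := corner_normalization_gt0 aN (spectrum a' y).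
  by rewrite /corner_normalization sy => /ltW.
Qed.

Lemma border_integral1 M : border_integral (b := b) (n := n) a M (fun=> 1) = 1.
Proof.
rewrite /border_integral -[RHS](@integral_gauss_density R (n * b.+1)); apply: eq_integral => v _.
rewrite ge0_integralZr//.
- by under eq_integral do rewrite mul1e; rewrite integral_normal_pdf mul1e.
- by apply: emeasurable_funM => //; apply/measurable_EFinP; exact: measurable_normal_pdf.
- by move=> x _; rewrite mul1e lee_fin normal_pdf_ge0.
- by rewrite lee_fin gauss_density_ge0.
Qed.

Lemma integral_corner_spectrum (F : n.-tuple R -> \bar R) :
  measurable_fun [set: n.-tuple R] F -> (forall m, 0 <= F m) ->
  \int[lebesgue_tuple R (gdim b.+1 n.+1)]_t (F (corner_spectrum a t) * (gauss_density t)%:E) =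
  \int[lebesgue_tuple R (gdim b.+1 n)]_y (F (spectrum a' y) * (gauss_density y)%:E).
Proof.
move=> mF F0.
have := @integral_ensemble R b n hb a F (fun=> 1) mF F0 (measurable_cst _) (fun=> lee01).
under eq_integral do rewrite mule1; move=> ->.
by apply: eq_integral => y _; rewrite border_integral1 mule1.
Qed.

Hypothesis simple : \int[lebesgue_tuple R (gdim b.+1 n)]_y
  ((~~ sdecr (spectrum a' y))%:R * gauss_density y)%:E = 0.

Lemma corner_simple : \int[lebesgue_tuple R (gdim b.+1 n.+1)]_t
  ((~~ sdecr (corner_spectrum a t))%:R * gauss_density t)%:E = 0.
Proof.
pose F (m : n.-tuple R) : \bar R := (~~ sdecr m)%:R%:E.
have mF : measurable_fun [set: n.-tuple R] F.
  apply/measurable_EFinP; rewrite (_ : (fun _ => _) = fun m => 1 - (sdecr m)%:R)%R.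
    by apply: measurable_funB => //; exact: measurable_sdecr.
  by apply/funext => m; case: (sdecr m); rewrite ?subrr ?subr0.
by rewrite -[RHS]simple; apply: (integral_corner_spectrum mF) => m; rewrite lee_fin.
Qed.

(** The disintegration formula, provided that the spectrum of the corner is almost
    surely simple. *)
Theorem integral_corner_kernel (F : n.-tuple R -> \bar R) (Psi : n.+1.-tuple R -> \bar R) :
  measurable_fun [set: n.-tuple R] F -> (forall m, 0 <= F m) ->
  measurable_fun [set: n.+1.-tuple R] Psi -> (forall l, 0 <= Psi l) ->
  \int[lebesgue_tuple R (gdim b.+1 n.+1)]_t
    (F (corner_spectrum a t) * Psi (spectrum a t) * (gauss_density t)%:E) =
  \int[lebesgue_tuple R (gdim b.+1 n.+1)]_t
    (F (corner_spectrum a t) * corner_kernel aN Psi (corner_spectrum a t) * (gauss_density t)%:E).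
Proof.
move=> mF F0 mPsi Psi0.
have mcs := measurable_corner_spectrum hb a.
have msp := measurable_spectrum hb a.
have mS : measurable_fun [set: (gdim b.+1 n.+1).-tuple R] (fun t => (sdecr (corner_spectrum a t))%:R : R).
  exact: (measurableT_comp (@measurable_sdecr R n) mcs).
have mg := @measurable_gauss_density R (gdim b.+1 n.+1).
have gp (t : (gdim b.+1 n.+1).-tuple R) : (0 < gauss_density t)%R.
  by rewrite gauss_densityE mulr_gt0 ?expR_gt0// exprn_gt0// normal_peak_gt0// oner_neq0.
have mK := measurable_corner_kernel aN mPsi Psi0.
have K0 m := @corner_kernel_ge0 n aN Psi m Psi0.
pose SF m : \bar R := (sdecr m)%:R%:E * F m.
have mSF : measurable_fun [set: n.-tuple R] SF.
  by apply: emeasurable_funM => //; apply/measurable_EFinP; exact: measurable_sdecr.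
have SF0 m : 0 <= SF m by rewrite mule_ge0// lee_fin.
pose SFK m : \bar R := SF m * corner_kernel aN Psi m.
have mSFK : measurable_fun [set: n.-tuple R] SFK by exact: emeasurable_funM.
have SFK0 m : 0 <= SFK m by rewrite mule_ge0.
rewrite (ge0_integral_ae_true (S := fun t => sdecr (corner_spectrum a t)) mS mg gp _ _ corner_simple); last 2 first.
- apply: emeasurable_funM; first exact: (measurableT_comp mF mcs).
  exact: (measurableT_comp mPsi msp).
- by move=> t; rewrite mule_ge0.
rewrite [RHS](ge0_integral_ae_true (S := fun t => sdecr (corner_spectrum a t)) mS mg gp _ _ corner_simple); last 2 first.
- apply: emeasurable_funM; first exact: (measurableT_comp mF mcs).
  exact: (measurableT_comp mK mcs).
- by move=> t; rewrite mule_ge0.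
transitivity (\int[lebesgue_tuple R (gdim b.+1 n.+1)]_t
    (SF (corner_spectrum a t) * Psi (spectrum a t) * (gauss_density t)%:E)).
  by apply: eq_integral => t _; rewrite /SF !muleA.
rewrite (integral_ensemble hb a mSF SF0 mPsi Psi0).
transitivity (\int[lebesgue_tuple R (gdim b.+1 n.+1)]_t
    (SFK (corner_spectrum a t) * (gauss_density t)%:E)); last first.
  by apply: eq_integral => t _; rewrite /SFK /SF !muleA.
rewrite (integral_corner_spectrum mSFK SFK0).
apply: eq_integral => y _; rewrite /SFK /SF.
have [sy|sy] := boolP (sdecr (spectrum a' y)); last by rewrite !mul0e.
by rewrite (border_integral_kernel sy mPsi Psi0) muleAC.
Qed.

End one_size.

(** By induction: once the corner has almost surely simple spectrum, the conditional
    density of the spectrum given that of the corner is available, and it vanishes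
    at spectra that are not simple. *)
Lemma simple_spectrum n (a : 'I_n -> R) : \int[lebesgue_tuple R (gdim b.+1 n)]_t
  ((~~ sdecr (spectrum a t))%:R * gauss_density t)%:E = 0.
Proof.
elim: n a => [|n IH] a.
  by apply: integral0_eq => t _; rewrite (tuple0 (spectrum a t)) mul0r.
pose Psi (l : n.+1.-tuple R) : \bar R := (~~ sdecr l)%:R%:E.
have mPsi : measurable_fun [set: n.+1.-tuple R] Psi.
  apply/measurable_EFinP; rewrite (_ : (fun _ => _) = fun m => 1 - (sdecr m)%:R)%R.
    by apply: measurable_funB => //; exact: measurable_sdecr.
  by apply/funext => m; case: (sdecr m); rewrite ?subrr ?subr0.
have Psi0 l : 0 <= Psi l by rewrite lee_fin.
have := @integral_corner_kernel n a (IH _) (fun=> 1) Psi (measurable_cst _) (fun=> lee01) mPsi Psi0.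
under eq_integral do rewrite mul1e; move=> ->.
apply: integral0_eq => t _; rewrite mul1e (_ : corner_kernel _ _ _ = 0) ?mul0e//.
apply: integral0_eq => l _; rewrite /Psi.
by have [sl|sl] := boolP (sdecr l); rewrite ?mul0e// corner_density_sdecr// mulr0 mule0.
Qed.

End conclusion.

(** * The theorem *)
Section random_matrix.
Context d (T : measurableType d) (R : realType) (P : probability T R) (b n : nat).
Variable X : 'I_n.+1 * 'I_n.+1 * 'I_b.+1 -> {RV P >-> R}.
Hypothesis hb : b.+1 \in [:: 1; 2; 4]%N.
Variable a : 'I_n.+1 -> R.
Hypothesis indepX : mutually_independent P (fun ijk => X ijk : T -> R).
Hypothesis normalX : forall ijk (B : set R), measurable B ->
  distribution P (X ijk) B = normal_prob 0 1 B.
Variables (k : R) (k0 : 0 < k) (gk : gamma_block b.+1 k%:E).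
Variables (lambda : T -> n.+1.-tuple R) (mu : T -> n.-tuple R).
Local Notation C w := (hmx_add (hmx_diag a)
  (hmx_self_adjoint_part (fun k => \matrix_(i, j) X (i, j, k) w))).
Hypothesis lambdaE : forall w, is_eigenvalues (C w) (lambda w).
Hypothesis muE : forall w, is_eigenvalues (hmx_corner (C w)) (mu w).

Let Y : T -> (gdim b.+1 n.+1).-tuple R := rv_tuple X.

Let ensembleY w : C w = ensemble a (Y w).
Proof.
rewrite /ensemble; congr (hmx_add _ (hmx_self_adjoint_part _)); apply/funext => c.
by apply/matrixP => i j; rewrite !mxE tnth_mktuple enum_rankK.
Qed.

Let lambda_spectrum w : lambda w = spectrum a (Y w).
Proof.
have := lambdaE w; rewrite ensembleY => e.
by apply: (hmx_eigenvalues_unique hb e); exact/eigsP/ensemble_self_adjoint.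
Qed.

Let mu_spectrum w : mu w = corner_spectrum a (Y w).
Proof.
have := muE w; rewrite ensembleY => e.
apply: (hmx_eigenvalues_unique hb e); apply: eigsP => //.
exact/hmx_self_adjoint_corner/ensemble_self_adjoint.
Qed.

Let mY : measurable_fun [set: T] Y.
Proof. exact: measurable_rv_tuple. Qed.

(** The eigenvalues are unique, so lambda and mu are the functions of the entries
    studied above. *)
Lemma conditional_density_of_spectrum : is_conditional_density P (lebesgue_tuple R n.+1) lambda mu
  (fun m l => corner_normalization b k (a ord_max) m * corner_density b.+1 (a ord_max) m l).
Proof.
have mlambda : measurable_fun [set: T] lambda.
  by rewrite (funext lambda_spectrum); apply: (measurableT_comp (measurable_spectrum hb a)).
have mmu : measurable_fun [set: T] mu.
  by rewrite (funext mu_spectrum); apply: (measurableT_comp (measurable_corner_spectrum hb a)).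
split => //.
- move=> m l; rewrite mulr_ge0 ?corner_density_ge0//.
  by apply: ltW; exact: corner_normalization_gt0.
- apply: measurable_funM.
    by apply: (measurableT_comp (@measurable_corner_normalization _ _ _ n (a ord_max))).
  exact: (measurable_corner_density b.+1 (a ord_max) measurable_fst measurable_snd).
move=> B D mB mD.
pose Psi (l : n.+1.-tuple R) : \bar R := (\1_B l)%:E.
pose F (m : n.-tuple R) : \bar R := (\1_D m)%:E.
have mPsi : measurable_fun [set: n.+1.-tuple R] Psi.
  by apply/measurable_EFinP; exact: measurable_indic.
have mF : measurable_fun [set: n.-tuple R] F by apply/measurable_EFinP; exact: measurable_indic.
have Psi0 l : (0 <= Psi l)%E by rewrite lee_fin.
have F0 m : (0 <= F m)%E by rewrite lee_fin.
pose K := corner_kernel b k (a ord_max) Psi.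
have mK : measurable_fun [set: n.-tuple R] K by exact: measurable_corner_kernel.
have K0 m : (0 <= K m)%E by exact: corner_kernel_ge0.
have msp := measurable_spectrum hb a.
have mcs := measurable_corner_spectrum hb a.
have mBD : measurable (lambda @^-1` B `&` mu @^-1` D).
  by apply: measurableI; rewrite -[X in measurable X]setTI; [exact: mlambda|exact: mmu].
transitivity (\int[P]_w (F (corner_spectrum a (Y w)) * Psi (spectrum a (Y w))))%E.
  rewrite -[X in P X]setIT -integral_indic//; apply: eq_integral => w _.
  rewrite -mu_spectrum -lambda_spectrum /F /Psi -EFinM; congr (_%:E).
  by rewrite indicI /= mulrC.
rewrite (integral_rv_tuple indepX normalX
  (F := fun t => F (corner_spectrum a t) * Psi (spectrum a t))%E); last 2 first.
- apply: emeasurable_funM; first exact: (measurableT_comp mF mcs).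
  exact: (measurableT_comp mPsi msp).
- by move=> t; rewrite mule_ge0.
etransitivity.
  exact: (@integral_corner_kernel _ _ hb _ k0 gk _ a (simple_spectrum hb k0 gk _) _ _ mF F0 mPsi Psi0).
rewrite -(integral_rv_tuple indepX normalX
  (F := fun t => F (corner_spectrum a t) * K (corner_spectrum a t))%E); last 2 first.
- apply: emeasurable_funM; first exact: (measurableT_comp mF mcs).
  exact: (measurableT_comp mK mcs).
- by move=> t; rewrite mule_ge0.
rewrite [RHS]integral_mkcond; apply: eq_integral => w _.
rewrite -/(Y w) -mu_spectrum patchE /F indicE (_ : (w \in mu @^-1` D) = (mu w \in D)); last first.
  by apply/idP/idP; rewrite !inE.
case: ifP => _; last by rewrite mul0e.
rewrite mul1e /K /corner_kernel [RHS]integral_mkcond; apply: eq_integral => l _.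
by rewrite patchE /Psi indicE; case: ifP => _; rewrite ?mul1e ?mul0e.
Qed.

End random_matrix.

Theorem proposition2p1 (R : realType) (b : nat) (hb : b \in [:: 1; 2; 4]%N)
    (n : nat) (a : 'I_n.+1 -> R) :
  exists c : n.-tuple R -> R, (forall m, 0 < c m) /\
  forall (d : measure_display) (T : measurableType d) (P : probability T R)
    (X : 'I_n.+1 * 'I_n.+1 * 'I_b -> {RV P >-> R}),
    mutually_independent P (fun ijk => X ijk : T -> R) ->
    (forall ijk (B : set R), measurable B ->
      distribution P (X ijk) B = normal_prob 0 1 B) ->
  let G (w : T) : hmatrix R b n.+1 :=
    hmx_self_adjoint_part (fun k => \matrix_(i, j) X (i, j, k) w) in
  let C (w : T) : hmatrix R b n.+1 := hmx_add (hmx_diag a) (G w) in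
  forall (lambda : T -> n.+1.-tuple R) (mu : T -> n.-tuple R),
    (forall w, is_eigenvalues (C w) (lambda w)) ->
    (forall w, is_eigenvalues (hmx_corner (C w)) (mu w)) ->
  is_conditional_density P (lebesgue_tuple R n.+1) lambda mu
    (fun m l => c m * corner_density b (a ord_max) m l).
Proof.
have [k k0 gk] := gamma_block_exists R hb.
case: b hb gk => // b hb gk.
exists (corner_normalization b k (a ord_max)); split.
  by move=> m; exact: corner_normalization_gt0.
move=> d T P X indepX normalX G C lambda mu lambdaE muE.
exact: (conditional_density_of_spectrum hb indepX normalX k0 gk lambdaE muE).
Qed.
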